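(* Let $\theta:(0,1)\to(0,\infty)$ be a positive continuous nonincreasing function. There exists a separated $\theta$-thin sequence $\{z_k\}\subset\mathbb{D}$ which is not a Blaschke sequence if and only if $$\int_0\frac{dt}{t\,\theta(t)}=\infty .$$
   Context: $\mathbb{D}=\{z\in\mathbb{C}:|z|<1\}$, and $H^\infty$ is the space of bounded holomorphic functions on $\mathbb{D}$. All sequences $\{z_k\}\subset\mathbb{D}$ are infinite and satisfy $|z_k|\to1$. A sequence $\{z_k\}$ is separated if $\inf_{n\neq k}\left|\frac{z_n-z_k}{1-\overline{z}_n z_k}\right|>0$. It is a Blaschke sequence if $\sum_k(1-|z_k|)<\infty$. For a real-valued function $\theta$ on $(0,1)$, a sequence $\{z_k\}$ is $\theta$-thin if there exists $f\in H^\infty$, $f\not\equiv0$, with $\sum_k(1-|z_k|)e^{\theta(1-|z_k|)}|f(z_k)|<\infty$ (if some $z_k=0$, the corresponding term is omitted). $\int_0 g(t)\,dt=\infty$ means that $\int_0^{\varepsilon}g(t)\,dt=\infty$ for small $\varepsilon\in(0,1)$. *)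

(* Defs.v *)
From Stdlib Require Import Reals.
From Coquelicot Require Import Coquelicot.

Open Scope R_scope.

(* Functions on the disc D (resp. on (0,1)) are represented by total functions
   C -> C (resp. R -> R); only their values on D (resp. on (0,1)) are used. *)

Definition in_disc (z : C) : Prop := Cmod z < 1.

(* Complex differentiability: the derivative is taken over the field C_AbsRing,
   so this is not real (Frechet) differentiability on C = R * R. *)
Definition holomorphic_on_disc (f : C -> C) : Prop :=
  forall z : C, in_disc z -> @ex_derive C_AbsRing C_NormedModule f z.

Definition Hinfty (f : C -> C) : Prop :=
  holomorphic_on_disc f /\
  exists M : R, forall z : C, in_disc z -> Cmod (f z) <= M.

Definition disc_sequence (z : nat -> C) : Prop :=
  (forall k : nat, in_disc (z k)) /\ is_lim_seq (fun k => Cmod (z k)) 1.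

Definition separated (z : nat -> C) : Prop :=
  Rbar_lt 0
    (Glb_Rbar (fun r : R => exists n k : nat, n <> k /\
       r = Cmod ((z n - z k) / (1 - Cconj (z n) * z k))%C)).

(* For points of D the terms are positive, so convergence of the series is
   finiteness of the sum. *)
Definition Blaschke (z : nat -> C) : Prop :=
  ex_series (fun k => 1 - Cmod (z k)).

(* The term of a point z_k = 0 is omitted, since theta is not defined at 1. *)
Definition thin_term (theta : R -> R) (f : C -> C) (w : C) : R :=
  if Req_EM_T (Cmod w) 0 then 0
  else (1 - Cmod w) * exp (theta (1 - Cmod w)) * Cmod (f w).

Definition thin (theta : R -> R) (z : nat -> C) : Prop :=
  exists f : C -> C,
    Hinfty f /\
    (exists w : C, in_disc w /\ f w <> 0%C) /\
    ex_series (fun k => thin_term theta f (z k)).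

(* [RInt] is total, hence the explicit integrability on [a, eps]. *)
Definition int_from_0_infinite (g : R -> R) (eps : R) : Prop :=
  (forall a : R, 0 < a < eps -> ex_RInt g a eps) /\
  filterlim (fun a : R => RInt g a eps) (at_right 0) (Rbar_locally p_infty).

Definition int_0_diverges (g : R -> R) : Prop :=
  exists d : R, 0 < d < 1 /\
    forall eps : R, 0 < eps < d -> int_from_0_infinite g eps.

(* Main.v *)
Require Import Defs.
From Stdlib Require Import Reals Lra Lia Psatz ZArith List ClassicalEpsilon.
From Coquelicot Require Import Coquelicot.
Open Scope R_scope.

(* Write theta_n for theta(2^-n); monotonicity turns the integral condition into divergence of
   the sum of 1/theta_n.

   Necessity. Let f be bounded by M, and let S be a finite separated set of points z with
   |f(z)| <= exp(-theta(1-|z|)), all close to the circle. Separation bounds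
   sum_z (1-|z|^2)^2 / |1-conj(a) z|^2 over a dyadic annulus, uniformly in a, so weights
   1/theta(1-|z|) make the full sum small. By Fubini the points whose local mass
   sum_b (1-|mob b z|^2) exceeds a small multiple of theta(1-|z|) carry at most half of
   sum_S (1-|z|). On the other half the Lagrange interpolant g of f by Blaschke products is small
   on the whole disc, because the Carleson constants lose at most exp(theta/2). Hence f-g is bounded and
   not small at a fixed point w, it vanishes on that half, and comparison with the
   Blaschke product bounds sum (1-|z|). The maximum principle needed here is derived from
   Goursat's lemma on squares, through circles parametrised by w + exp(s + i phi).

   Sufficiency. Choose nested sets E_n of dyadic arcs of length 2^-n with |E_n| = a_n, halved only
   when a_n exceeds T_n / (C (1 + theta_n + S_n)), where S_n is the sum of a_m over m < n
   and T_n = 1/(1+S_n). If S_n were bounded, a_n would dominate a multiple of 1/theta_n; so S_n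
   diverges, and T_n tends to 0. Put mass T_n - T_(n+1) uniformly on the left endpoints
   of E_n and let f = exp(-G) with G the Herglotz integral. At height 2^-n above an arc of E_n
   one has Re G >= c T_n / a_n, which exceeds theta_n + S_n on the stages where a_n is under the cap.
   These stages carry at least half of the sum of the a_n, and sum a_n exp(-S_n) converges. *)

(** The weights 1/theta link both sides of the necessity. A point with |f(z)| > exp(-theta(1-|z|))
    is paid for by its own term of the thin series, so only points of small value matter. There half
    of the decay pays for the Carleson constant, and what remains of the interpolation coefficient
    is at most exp(-theta/2) <= 2/theta; summed over annuli, this is a tail of the series of
    1/theta_n. A separated sequence may have points of too large local mass, so an average over
    pairs of points replaces a pointwise Carleson estimate.

    In the converse every step treats all arcs alike, so each arc of E_n receives an equal share of
    the later mass T_n; the Poisson kernel at height comparable to 2^-n turns this share into a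
    multiple of T_n / a_n. The summand S_n in the cap has no counterpart in theta: it gains the
    factor exp(-S_n) that makes the thin series converge although the sum of the a_n diverges. The
    choice T_n = 1/(1+S_n) keeps the mass finite, yet leaves the cap comparable to 1/theta_n as long
    as S_n is bounded. *)

(** * Complex derivatives *)

(** Stated by increments, so that remainders are explicit inequalities in [h]; [cderiv_ex_derive]
    links it to the derivative used by [holomorphic_on_disc]. *)
Definition cderiv (F : C -> C) (z l : C) : Prop :=
  forall eps : R, 0 < eps -> exists d : R, 0 < d /\
    forall h : C, Cmod h < d -> Cmod (F (z + h) - F z - l * h)%C <= eps * Cmod h.

Lemma Cmod_triang_sub (x y : C) : Cmod (x - y)%C <= Cmod x + Cmod y.
Proof. unfold Cminus. rewrite <- (Cmod_opp y). apply Cmod_triangle. Qed.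

Lemma Cmod_sub_ge (x y : C) : Cmod x - Cmod y <= Cmod (x - y)%C.
Proof.
  replace x with ((x - y) + y)%C at 1 by ring.
  pose proof (Cmod_triangle (x - y)%C y). lra.
Qed.

Lemma Cmod_sub_sym (x y : C) : Cmod (x - y)%C = Cmod (y - x)%C.
Proof. rewrite <- Cmod_opp. f_equal. ring. Qed.

Lemma Cplus_minus (x y : C) : (x + (y - x))%C = y.
Proof. ring. Qed.

Lemma im_le_Cmod (c : C) : Rabs (Im c) <= Cmod c.
Proof.
  pose proof (Rmax_Cmod c). pose proof (Rmax_r (Rabs (fst c)) (Rabs (snd c))).
  unfold Im. lra.
Qed.

Lemma cderiv_ex_derive (F : C -> C) (z : C) :
  @ex_derive C_AbsRing C_NormedModule F z <-> exists l : C, cderiv F z l.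
Proof.
  split.
  - intros [l [_ Hl]]. exists l. intros eps Heps.
    specialize (Hl z (fun P H => H) (mkposreal eps Heps)).
    destruct Hl as [d Hd]. exists d. split; [apply cond_pos|].
    intros h Hh.
    specialize (Hd (z + h)%C).
    assert (E : (z + h - z)%C = h) by ring.
    assert (Hb : @ball (AbsRing_UniformSpace C_AbsRing) z d (z + h)%C).
    { change (Cmod (z + h - z)%C < d). now rewrite E. }
    specialize (Hd Hb).
    change (Cmod (F (z + h)%C - F z - (z + h - z) * l)%C <= eps * Cmod (z + h - z)%C) in Hd.
    rewrite E in Hd. now rewrite (Cmult_comm l h).
  - intros [l Hl]. exists l. split; [apply is_linear_scal_l|].
    intros x Hx. apply (@is_filter_lim_locally_unique C_AbsRing (AbsRing_NormedModule C_AbsRing)) in Hx. subst x.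
    intros eps. destruct (Hl eps (cond_pos eps)) as [d [Hd Hh]].
    exists (mkposreal d Hd). intros y Hy.
    change C in y. change (Cmod (y - z)%C < d) in Hy.
    specialize (Hh _ Hy).
    change (Cmod (F y - F z - (y - z) * l)%C <= eps * Cmod (y - z)%C).
    rewrite Cplus_minus in Hh.
    now rewrite (Cmult_comm _ l).
Qed.

Lemma cderiv_lip (F : C -> C) (z l : C) : cderiv F z l ->
  exists d, 0 < d /\ forall h, Cmod h < d ->
    Cmod (F (z + h) - F z)%C <= (Cmod l + 1) * Cmod h.
Proof.
  intros H. destruct (H 1 Rlt_0_1) as [d [Hd Hh]]. exists d; split; [easy|].
  intros h Hlt. specialize (Hh h Hlt).
  replace (F (z + h) - F z)%C with ((F (z + h) - F z - l * h) + l * h)%C by ring.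
  eapply Rle_trans; [apply Cmod_triangle|]. rewrite Cmod_mult. lra.
Qed.

Lemma cderiv_continuous (F : C -> C) (z l : C) : cderiv F z l ->
  forall eps, 0 < eps -> exists d, 0 < d /\ forall h, Cmod h < d ->
    Cmod (F (z + h) - F z)%C < eps.
Proof.
  intros H eps Heps. destruct (cderiv_lip _ _ _ H) as [d [Hd Hh]].
  pose proof (Cmod_ge_0 l) as Hl.
  exists (Rmin d (eps / (Cmod l + 1))). split.
  - apply Rmin_glb_lt; [easy|]. apply Rdiv_lt_0_compat; lra.
  - intros h Hlt. pose proof (Rmin_l d (eps / (Cmod l + 1))).
    pose proof (Rmin_r d (eps / (Cmod l + 1))).
    eapply Rle_lt_trans; [apply Hh; lra|].
    replace eps with ((Cmod l + 1) * (eps / (Cmod l + 1))) by (field; lra).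
    apply Rmult_lt_compat_l; lra.
Qed.

Lemma cderiv_ext (F G : C -> C) (z l : C) :
  (forall x, F x = G x) -> cderiv F z l -> cderiv G z l.
Proof.
  intros E H eps Heps. destruct (H eps Heps) as [d [Hd Hh]]. exists d; split; [easy|].
  intros h Hlt. rewrite <- !E. auto.
Qed.

Lemma cderiv_eq (F : C -> C) (z l m : C) : l = m -> cderiv F z l -> cderiv F z m.
Proof. now intros ->. Qed.

Lemma cderiv_const (c z : C) : cderiv (fun _ => c) z 0.
Proof.
  intros eps Heps. exists 1; split; [lra|]. intros h _.
  replace (c - c - 0 * h)%C with (RtoC 0) by ring. rewrite Cmod_0.
  pose proof (Cmod_ge_0 h). nra.
Qed.

Lemma cderiv_id (z : C) : cderiv (fun x => x) z 1.
Proof.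
  intros eps Heps. exists 1; split; [lra|]. intros h _.
  replace (z + h - z - 1 * h)%C with (RtoC 0) by ring. rewrite Cmod_0.
  pose proof (Cmod_ge_0 h). nra.
Qed.

Lemma cderiv_plus (F G : C -> C) (z l m : C) :
  cderiv F z l -> cderiv G z m -> cderiv (fun x => F x + G x)%C z (l + m)%C.
Proof.
  intros HF HG eps Heps.
  destruct (HF (eps / 2)) as [d1 [Hd1 H1]]; [lra|].
  destruct (HG (eps / 2)) as [d2 [Hd2 H2]]; [lra|].
  exists (Rmin d1 d2); split; [now apply Rmin_glb_lt|]. intros h Hh.
  pose proof (Rmin_l d1 d2). pose proof (Rmin_r d1 d2).
  specialize (H1 h ltac:(lra)). specialize (H2 h ltac:(lra)).
  replace (F (z + h) + G (z + h) - (F z + G z) - (l + m) * h)%C with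
    ((F (z + h) - F z - l * h) + (G (z + h) - G z - m * h))%C by ring.
  eapply Rle_trans; [apply Cmod_triangle|]. lra.
Qed.

Lemma cderiv_comp (F G : C -> C) (z l m : C) :
  cderiv F (G z) l -> cderiv G z m -> cderiv (fun x => F (G x)) z (l * m)%C.
Proof.
  intros HF HG eps Heps.
  pose proof (Cmod_ge_0 l) as Hl0. pose proof (Cmod_ge_0 m) as Hm0.
  destruct (HF (eps / (2 * (Cmod m + 1)))) as [d1 [Hd1 H1]].
  { apply Rdiv_lt_0_compat; lra. }
  destruct (HG (eps / (2 * (Cmod l + 1)))) as [d2 [Hd2 H2]].
  { apply Rdiv_lt_0_compat; lra. }
  destruct (cderiv_lip _ _ _ HG) as [d3 [Hd3 H3]].
  destruct (cderiv_continuous _ _ _ HG d1 Hd1) as [d4 [Hd4 H4]].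
  exists (Rmin (Rmin d2 d3) d4); split; [now repeat apply Rmin_glb_lt|]. intros h Hh.
  pose proof (Rmin_l (Rmin d2 d3) d4). pose proof (Rmin_r (Rmin d2 d3) d4).
  pose proof (Rmin_l d2 d3). pose proof (Rmin_r d2 d3).
  specialize (H2 h ltac:(lra)). specialize (H3 h ltac:(lra)). specialize (H4 h ltac:(lra)).
  specialize (H1 _ H4).
  replace (G z + (G (z + h) - G z))%C with (G (z + h)%C) in H1 by ring.
  replace (F (G (z + h)) - F (G z) - l * m * h)%C with
    ((F (G (z + h)) - F (G z) - l * (G (z + h) - G z)) + l * (G (z + h) - G z - m * h))%C
    by ring.
  eapply Rle_trans; [apply Cmod_triangle|]. rewrite Cmod_mult.
  pose proof (Cmod_ge_0 h).
  assert (A : eps / (2 * (Cmod m + 1)) * Cmod (G (z + h) - G z)%C <= eps / 2 * Cmod h).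
  { eapply Rle_trans; [apply Rmult_le_compat_l; [|exact H3]|].
    - apply Rlt_le, Rdiv_lt_0_compat; lra.
    - right. field. lra. }
  assert (B : Cmod l * Cmod (G (z + h) - G z - m * h)%C <= eps / 2 * Cmod h).
  { eapply Rle_trans; [apply Rmult_le_compat_l; [easy|exact H2]|].
    replace (Cmod l * (eps / (2 * (Cmod l + 1)) * Cmod h)) with
      (eps / 2 * Cmod h * (Cmod l / (Cmod l + 1))) by (field; lra).
    assert (Cmod l / (Cmod l + 1) <= 1) by (apply (Rdiv_le_1 (Cmod l)); lra).
    rewrite <- (Rmult_1_r (eps / 2 * Cmod h)) at 2. apply Rmult_le_compat_l; [nra|easy]. }
  lra.
Qed.

Lemma cderiv_mult (F G : C -> C) (z l m : C) :
  cderiv F z l -> cderiv G z m ->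
  cderiv (fun x => F x * G x)%C z (l * G z + F z * m)%C.
Proof.
  intros HF HG eps Heps.
  pose proof (Cmod_ge_0 l) as Hl0. pose proof (Cmod_ge_0 m) as Hm0.
  pose proof (Cmod_ge_0 (F z)) as Hf0. pose proof (Cmod_ge_0 (G z)) as Hg0.
  destruct (HF (eps / (3 * (Cmod (G z) + 1)))) as [d1 [Hd1 H1]].
  { apply Rdiv_lt_0_compat; lra. }
  destruct (HG (eps / (3 * (Cmod (F z) + 1)))) as [d2 [Hd2 H2]].
  { apply Rdiv_lt_0_compat; lra. }
  destruct (cderiv_lip _ _ _ HF) as [d3 [Hd3 H3]].
  destruct (cderiv_continuous _ _ _ HG (eps / (3 * (Cmod l + 1)))) as [d4 [Hd4 H4]].
  { apply Rdiv_lt_0_compat; lra. }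
  exists (Rmin (Rmin d1 d2) (Rmin d3 d4)); split; [now repeat apply Rmin_glb_lt|]. intros h Hh.
  pose proof (Rmin_l (Rmin d1 d2) (Rmin d3 d4)). pose proof (Rmin_r (Rmin d1 d2) (Rmin d3 d4)).
  pose proof (Rmin_l d1 d2). pose proof (Rmin_r d1 d2).
  pose proof (Rmin_l d3 d4). pose proof (Rmin_r d3 d4).
  specialize (H1 h ltac:(lra)). specialize (H2 h ltac:(lra)).
  specialize (H3 h ltac:(lra)). specialize (H4 h ltac:(lra)).
  replace (F (z + h) * G (z + h) - F z * G z - (l * G z + F z * m) * h)%C with
    ((F (z + h) - F z - l * h) * G z + F z * (G (z + h) - G z - m * h)
     + (F (z + h) - F z) * (G (z + h) - G z))%C by ring.
  eapply Rle_trans; [apply Cmod_triangle|].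
  eapply Rle_trans; [apply Rplus_le_compat_r, Cmod_triangle|].
  rewrite !Cmod_mult. pose proof (Cmod_ge_0 h) as Hh0.
  assert (Q : forall a, 0 <= a -> 0 <= a / (a + 1) <= 1).
  { intros a Ha. split; [apply Rdiv_le_0_compat; lra|apply (Rdiv_le_1 a); lra]. }
  assert (Heh : 0 <= eps / 3 * Cmod h) by nra.
  assert (A : Cmod (F (z + h) - F z - l * h)%C * Cmod (G z) <= eps / 3 * Cmod h).
  { eapply Rle_trans; [apply Rmult_le_compat_r; [easy|exact H1]|].
    replace (eps / (3 * (Cmod (G z) + 1)) * Cmod h * Cmod (G z)) with
      (eps / 3 * Cmod h * (Cmod (G z) / (Cmod (G z) + 1))) by (field; lra).
    destruct (Q _ Hg0). nra. }
  assert (B : Cmod (F z) * Cmod (G (z + h) - G z - m * h)%C <= eps / 3 * Cmod h).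
  { eapply Rle_trans; [apply Rmult_le_compat_l; [easy|exact H2]|].
    replace (Cmod (F z) * (eps / (3 * (Cmod (F z) + 1)) * Cmod h)) with
      (eps / 3 * Cmod h * (Cmod (F z) / (Cmod (F z) + 1))) by (field; lra).
    destruct (Q _ Hf0). nra. }
  assert (D : Cmod (F (z + h) - F z)%C * Cmod (G (z + h) - G z)%C <= eps / 3 * Cmod h).
  { replace (eps / 3 * Cmod h) with ((Cmod l + 1) * Cmod h * (eps / (3 * (Cmod l + 1))))
      by (field; lra).
    apply Rmult_le_compat; try apply Cmod_ge_0; [easy|]. now apply Rlt_le. }
  lra.
Qed.

Lemma cderiv_inv (z : C) : z <> 0%C -> cderiv Cinv z (- / (z * z))%C.
Proof.
  intros Hz eps Heps. pose proof (proj1 (Cmod_gt_0 z) Hz) as Hm.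
  assert (Hm3 : 0 < Cmod z ^ 3) by now apply pow_lt.
  exists (Rmin (Cmod z / 2) (eps * Cmod z ^ 3 / 2)). split.
  { apply Rmin_glb_lt; nra. }
  intros h Hh.
  pose proof (Rmin_l (Cmod z / 2) (eps * Cmod z ^ 3 / 2)).
  pose proof (Rmin_r (Cmod z / 2) (eps * Cmod z ^ 3 / 2)).
  assert (Hzh : Cmod z / 2 <= Cmod (z + h)%C).
  { pose proof (Cmod_sub_ge z (- h)%C) as H1. rewrite Cmod_opp in H1.
    replace (z - - h)%C with (z + h)%C in H1 by ring. lra. }
  assert (Hzh0 : (z + h)%C <> 0%C) by (apply Cmod_gt_0; lra).
  replace (/ (z + h) - / z - - / (z * z) * h)%C with (h * h / (z * z * (z + h)))%C
    by (field; auto).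
  rewrite Cmod_div by (repeat apply Cmult_neq_0; auto).
  rewrite !Cmod_mult.
  apply (Rle_trans _ (Cmod h * Cmod h / (Cmod z * Cmod z * (Cmod z / 2)))).
  - apply Rmult_le_compat_l; [pose proof (Cmod_ge_0 h); nra|].
    apply Rinv_le_contravar; [nra|]. apply Rmult_le_compat_l; nra.
  - replace (Cmod h * Cmod h / (Cmod z * Cmod z * (Cmod z / 2))) with
      (2 * Cmod h / Cmod z ^ 3 * Cmod h) by (field; lra).
    apply Rmult_le_compat_r; [apply Cmod_ge_0|].
    apply Rle_div_l; lra.
Qed.

Lemma exp_le_compat (x y : R) : x <= y -> exp x <= exp y.
Proof.
  intros [H| ->]; [|apply Rle_refl]. now apply Rlt_le, exp_increasing.
Qed.

(** * The complex exponential *)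

Definition Cexp (z : C) : C := (exp (Re z) * cos (Im z), exp (Re z) * sin (Im z)).

Lemma Cexp_plus (z w : C) : Cexp (z + w)%C = (Cexp z * Cexp w)%C.
Proof.
  unfold Cexp. destruct z as [x y], w as [x' y']; simpl.
  rewrite exp_plus, cos_plus, sin_plus. unfold Cmult; simpl. f_equal; ring.
Qed.

Lemma Cmod_Cexp (z : C) : Cmod (Cexp z) = exp (Re z).
Proof.
  pose proof (exp_pos (Re z)). unfold Cmod, Cexp. simpl fst. simpl snd.
  replace ((exp (Re z) * cos (Im z)) ^ 2 + (exp (Re z) * sin (Im z)) ^ 2)
    with (Rsqr (exp (Re z))).
  - rewrite sqrt_Rsqr; lra.
  - pose proof (sin2_cos2 (Im z)). unfold Rsqr in *.
    replace ((exp (Re z) * cos (Im z)) ^ 2 + (exp (Re z) * sin (Im z)) ^ 2)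
    with (exp (Re z) * exp (Re z) * (sin (Im z) * sin (Im z) + cos (Im z) * cos (Im z))) by ring.
    rewrite H0. ring.
Qed.

Lemma Cexp_neq_0 (z : C) : Cexp z <> 0%C.
Proof. apply Cmod_gt_0. rewrite Cmod_Cexp. apply exp_pos. Qed.

Lemma Cexp_0 : Cexp 0 = 1%C.
Proof. unfold Cexp; simpl. rewrite exp_0, cos_0, sin_0. unfold RtoC. f_equal; ring. Qed.

Lemma derivable_pt_lim_0_bound (f : R -> R) (l : R) : derivable_pt_lim f 0 l ->
  forall eps, 0 < eps -> exists d, 0 < d /\
    forall x, Rabs x < d -> Rabs (f x - f 0 - l * x) <= eps * Rabs x.
Proof.
  intros H eps Heps. destruct (H eps Heps) as [d Hd]. exists d; split; [apply cond_pos|].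
  intros x Hx. destruct (Req_dec x 0) as [->|Hx0].
  - replace (f 0 - f 0 - l * 0) with 0 by ring. rewrite Rabs_R0. lra.
  - specialize (Hd x Hx0 Hx). rewrite Rplus_0_l in Hd.
    replace (f x - f 0 - l * x) with (((f x - f 0) / x - l) * x) by (field; easy).
    rewrite Rabs_mult. apply Rmult_le_compat_r; [apply Rabs_pos|lra].
Qed.

Lemma Cmod_le_abs (z : C) : Cmod z <= Rabs (Re z) + Rabs (Im z).
Proof.
  unfold Cmod, Re, Im. rewrite <- (sqrt_Rsqr (Rabs (fst z) + Rabs (snd z))).
  - apply sqrt_le_1_alt. unfold Rsqr.
    pose proof (Rabs_pos (fst z)). pose proof (Rabs_pos (snd z)).
    rewrite <- (pow2_abs (fst z)), <- (pow2_abs (snd z)). nra.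
  - pose proof (Rabs_pos (fst z)). pose proof (Rabs_pos (snd z)). lra.
Qed.

Lemma cderiv_exp_0 : cderiv Cexp 0 1.
Proof.
  intros eps Heps.
  destruct (derivable_pt_lim_0_bound _ _ derivable_pt_lim_exp_0 (eps / 12)) as [d1 [Hd1 H1]]; [lra|].
  destruct (derivable_pt_lim_0_bound _ _ derivable_pt_lim_cos_0 (eps / 12)) as [d2 [Hd2 H2]]; [lra|].
  destruct (derivable_pt_lim_0_bound _ _ derivable_pt_lim_sin_0 (eps / 12)) as [d3 [Hd3 H3]]; [lra|].
  destruct (derivable_pt_lim_0_bound _ _ derivable_pt_lim_exp_0 1) as [d4 [Hd4 H4]]; [lra|].
  exists (Rmin (Rmin (Rmin d1 d2) (Rmin d3 d4)) (Rmin 1 (eps / 24))); split.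
  { repeat apply Rmin_glb_lt; lra. }
  intros [x y] Hh.
  assert (Hh' : Cmod (x, y) < d1 /\ Cmod (x, y) < d2 /\ Cmod (x, y) < d3 /\ Cmod (x, y) < d4
    /\ Cmod (x, y) < 1 /\ Cmod (x, y) < eps / 24).
  { repeat split; (eapply Rlt_le_trans; [exact Hh|]).
    1-4: eapply Rle_trans; [apply Rmin_l|].
    1,2: eapply Rle_trans; [apply Rmin_l|]; try apply Rmin_l; apply Rmin_r.
    1,2: eapply Rle_trans; [apply Rmin_r|]; try apply Rmin_l; apply Rmin_r.
    1,2: eapply Rle_trans; [apply Rmin_r|]; try apply Rmin_l; apply Rmin_r. }
  clear Hh. destruct Hh' as (A1 & A2 & A3 & A4 & A5 & A6).
  pose proof (re_le_Cmod (x, y)) as Hx. pose proof (im_le_Cmod (x, y)) as Hy.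
  unfold Re in Hx; unfold Im in Hy; simpl in Hx, Hy.
  specialize (H1 x ltac:(lra)). specialize (H2 y ltac:(lra)).
  specialize (H3 y ltac:(lra)). specialize (H4 x ltac:(lra)).
  set (m := Cmod (x, y)) in *.
  rewrite exp_0 in *. rewrite cos_0 in H2. rewrite sin_0 in H3.
  rewrite Rmult_0_l, Rminus_0_r in H2.
  replace (sin y - 0 - 1 * y) with (sin y - y) in H3 by ring.
  replace (exp x - 1 - 1 * x) with (exp x - 1 - x) in H1, H4 by ring.
  assert (Ee : Rabs (exp x - 1) <= 2 * m).
  { replace (exp x - 1) with ((exp x - 1 - x) + x) by ring.
    eapply Rle_trans; [apply Rabs_triang|]. lra. }
  assert (E3 : 0 < exp x <= 3).
  { split; [apply exp_pos|]. apply Rabs_le_between in Ee. lra. }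
  eapply Rle_trans; [apply Cmod_le_abs|].
  (* Both parts of exp(h) - 1 - h are rearranged into products and sums of the real remainders
     bounded in [H1], [H2], [H3] and [Ee]. *)
  replace (Re _) with (exp x * (cos y - 1) + (exp x - 1 - x)).
  2:{ rewrite Cexp_0. unfold Cexp, Re, Im. simpl. rewrite !Rplus_0_l. ring. }
  replace (Im _) with (exp x * (sin y - y) + y * (exp x - 1)).
  2:{ rewrite Cexp_0. unfold Cexp, Re, Im. simpl. rewrite !Rplus_0_l. ring. }
  pose proof (Rabs_pos (cos y - 1)). pose proof (Rabs_pos (sin y - y)).
  pose proof (Rabs_pos y). pose proof (Rabs_pos x). pose proof (Rabs_pos (exp x - 1)).
  assert (B1 : Rabs (exp x * (cos y - 1) + (exp x - 1 - x)) <= 3 * (eps / 12 * m) + eps / 12 * m).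
  { eapply Rle_trans; [apply Rabs_triang|]. rewrite Rabs_mult, (Rabs_pos_eq (exp x)) by lra.
    apply Rplus_le_compat; [apply Rmult_le_compat; nra|nra]. }
  assert (B2 : Rabs (exp x * (sin y - y) + y * (exp x - 1)) <= 3 * (eps / 12 * m) + m * (eps / 12)).
  { eapply Rle_trans; [apply Rabs_triang|]. rewrite !Rabs_mult, (Rabs_pos_eq (exp x)) by lra.
    apply Rplus_le_compat; apply Rmult_le_compat; nra. }
  assert (0 <= m) by apply Cmod_ge_0.
  nra.
Qed.

Lemma cderiv_exp (z : C) : cderiv Cexp z (Cexp z).
Proof.
  apply (cderiv_ext (fun x => Cexp z * Cexp (x + (- z)))%C).
  { intros x. rewrite <- Cexp_plus. f_equal. ring. }
  apply (cderiv_eq _ _ (0 * Cexp (z + - z) + Cexp z * (1 * (1 + 0)))%C); [ring|].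
  apply (cderiv_mult (fun _ => Cexp z) (fun x => Cexp (x + - z)%C)); [apply cderiv_const|].
  apply (cderiv_comp Cexp (fun x => x + - z)%C).
  - replace (z + - z)%C with (RtoC 0) by ring. apply cderiv_exp_0.
  - apply cderiv_plus; [apply cderiv_id|apply cderiv_const].
Qed.

(** * Goursat's lemma on squares *)

Section SquareCousin.
Variable P : R -> R -> R -> Prop.

Let next (p : R * R) (M : R) : R * R :=
  let (x, y) := p in
  if excluded_middle_informative (~ P x y M) then (x, y)
  else if excluded_middle_informative (~ P (x + M) y M) then (x + M, y)
  else if excluded_middle_informative (~ P x (y + M) M) then (x, y + M)
  else (x + M, y + M).

Fixpoint bad_square (X Y L : R) (n : nat) : R * R :=
  match n with
  | O => (X, Y)
  | S n => next (bad_square X Y L n) (L / 2 ^ S n)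
  end.

(** Cousin's lemma by bisection: if [P] fails, some quarter fails at each step, and the failing
    squares shrink to a point where the local hypothesis is violated. It serves Goursat's lemma and,
    as a substitute for compactness, the maximum principle. *)
Lemma square_cousin (X Y L : R) : 0 < L ->
  (forall x y M, 0 < M -> P x y M -> P (x + M) y M -> P x (y + M) M ->
     P (x + M) (y + M) M -> P x y (2 * M)) ->
  (forall a b, X <= a <= X + L -> Y <= b <= Y + L -> exists d, 0 < d /\
     forall x y M, 0 < M < d -> x <= a <= x + M -> y <= b <= y + M -> P x y M) ->
  P X Y L.
Proof.
  intros HL Hsub Hloc. apply NNPP. intros Hbad.
  set (s := bad_square X Y L).
  assert (Hpos : forall n, 0 < L / 2 ^ n).
  { intros n. apply Rdiv_lt_0_compat; [easy|]. apply pow_lt; lra. }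
  assert (Hhalf : forall n, L / 2 ^ n = 2 * (L / 2 ^ S n)).
  { intros n. simpl. field. apply pow_nonzero; lra. }
  assert (Hs : forall n, ~ P (fst (s n)) (snd (s n)) (L / 2 ^ n)).
  { intros n. induction n as [|n IH].
    - simpl. now replace (L / 1) with L by field.
    - unfold s in *. cbn [bad_square]. destruct (bad_square X Y L n) as [x y].
      simpl fst in IH; simpl snd in IH. unfold next.
      destruct (excluded_middle_informative _) as [H1|H1]; [exact H1|].
      destruct (excluded_middle_informative _) as [H2|H2]; [exact H2|].
      destruct (excluded_middle_informative _) as [H3|H3]; [exact H3|].
      (* The upper right quarter is the default of [next]; it fails too, since otherwise all four
         quarters hold and [Hsub] gives the parent. *)
      intros H4. apply IH. rewrite Hhalf. apply Hsub; auto; apply NNPP; assumption. }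
  assert (Hstep : forall n, fst (s n) <= fst (s (S n)) /\
    fst (s (S n)) + L / 2 ^ S n <= fst (s n) + L / 2 ^ n /\
    snd (s n) <= snd (s (S n)) /\ snd (s (S n)) + L / 2 ^ S n <= snd (s n) + L / 2 ^ n).
  { intros n. rewrite (Hhalf n). pose proof (Hpos (S n)) as Hp.
    unfold s. cbn [bad_square]. set (M := L / 2 ^ S n) in *.
    destruct (bad_square X Y L n) as [x y]. unfold next.
    repeat destruct (excluded_middle_informative _); cbn [fst snd]; repeat split; lra. }
  assert (Hlim : forall u : nat -> R,
    (forall n, u n <= u (S n) /\ u (S n) + L / 2 ^ S n <= u n + L / 2 ^ n) ->
    exists a, forall n, u n <= a <= u n + L / 2 ^ n).
  { intros u Hu.
    assert (Hmono : forall n k, u n <= u (n + k)%nat /\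
       u (n + k)%nat + L / 2 ^ (n + k) <= u n + L / 2 ^ n).
    { intros n k. induction k as [|k IH].
      - rewrite Nat.add_0_r. lra.
      - rewrite Nat.add_succ_r. destruct (Hu (n + k)%nat). lra. }
    assert (Hub : forall n m, u m <= u n + L / 2 ^ n).
    { intros n m. destruct (Nat.le_ge_cases n m) as [H|H].
      - destruct (Hmono n (m - n)%nat) as [_ H2].
        replace (n + (m - n))%nat with m in H2 by lia. pose proof (Hpos m). lra.
      - destruct (Hmono m (n - m)%nat) as [H2 _].
        replace (m + (n - m))%nat with n in H2 by lia. pose proof (Hpos n). lra. }
    destruct (completeness (fun x => exists n, x = u n)) as [a [Ha1 Ha2]].
    - exists (u O + L / 2 ^ 0). intros x [n ->]. apply Hub.
    - exists (u O). now exists O.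
    - exists a. intros n. split.
      + apply Ha1. now exists n.
      + apply Ha2. intros x [m ->]. apply Hub. }
  destruct (Hlim (fun n => fst (s n))) as [a Ha].
  { intros n. destruct (Hstep n) as (?&?&?&?). easy. }
  destruct (Hlim (fun n => snd (s n))) as [b Hb].
  { intros n. destruct (Hstep n) as (?&?&?&?). easy. }
  destruct (Hloc a b) as [d [Hd Hd2]].
  { specialize (Ha O). simpl in Ha. lra. }
  { specialize (Hb O). simpl in Hb. lra. }
  assert (Hd' : 0 < d / L) by now apply Rdiv_lt_0_compat.
  destruct (pow_lt_1_zero (/ 2) ltac:(rewrite Rabs_pos_eq; lra) (d / L) Hd') as [N HN].
  specialize (HN N (Nat.le_refl N)).
  apply (Hs N), Hd2; auto. split; [apply Hpos|].
  rewrite pow_inv, Rabs_pos_eq in HN.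
  - apply (Rmult_lt_compat_l L) in HN; [|easy].
    replace (L * (d / L)) with d in HN by (field; lra). exact HN.
  - apply Rlt_le, Rinv_0_lt_compat, pow_lt; lra.
Qed.
End SquareCousin.

Lemma continuous_along (G : C -> C) (g : R -> C) (t : R) (l : C) (K : R) :
  (forall t', Cmod (g t' - g t)%C <= K * Rabs (t' - t)) -> cderiv G (g t) l ->
  continuous (fun t => Re (G (g t))) t /\ continuous (fun t => Im (G (g t))) t.
Proof.
  intros Hg HG.
  assert (H : forall eps : posreal, exists d : posreal, forall t', Rabs (t' - t) < d ->
     Cmod (G (g t') - G (g t))%C < eps).
  { intros eps. destruct (cderiv_continuous _ _ _ HG eps (cond_pos eps)) as [d [Hd Hc]].
    assert (HK : 0 < Rabs K + 1) by (pose proof (Rabs_pos K); lra).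
    assert (Hd' : 0 < d / (Rabs K + 1)) by now apply Rdiv_lt_0_compat.
    exists (mkposreal _ Hd'). intros t' Ht'. simpl in Ht'.
    replace (g t') with (g t + (g t' - g t))%C by ring.
    apply Hc. eapply Rle_lt_trans; [apply Hg|].
    apply Rlt_div_r in Ht'; [|easy].
    pose proof (RRle_abs K). pose proof (Rabs_pos (t' - t)). nra. }
  split; apply filterlim_locally; intros eps; destruct (H eps) as [d Hd];
    exists d; intros t' Ht'; specialize (Hd t' Ht');
    eapply Rle_lt_trans; try exact Hd.
  - apply (re_le_Cmod (G (g t') - G (g t))%C).
  - apply (im_le_Cmod (G (g t') - G (g t))%C).
Qed.

(** Integrand of the real part of the counterclockwise contour integral of [G], with the four sides
    folded onto one parameter [t]. *)
Definition square_boundary (G : C -> C) (x y L t : R) : R :=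
  Re (G (x + t, y)) - Re (G (x + t, y + L)) - Im (G (x + L, y + t)) + Im (G (x, y + t)).

Lemma Cmod_pair_l (a b c : R) : Cmod ((a, c) - (b, c))%C = Rabs (a - b).
Proof.
  unfold Cmod, Cminus, Cplus, Copp; simpl fst; simpl snd.
  rewrite <- sqrt_Rsqr_abs. f_equal. unfold Rsqr, Rminus. ring.
Qed.

Lemma Cmod_pair_r (a b c : R) : Cmod ((c, a) - (c, b))%C = Rabs (a - b).
Proof.
  unfold Cmod, Cminus, Cplus, Copp; simpl fst; simpl snd.
  rewrite <- sqrt_Rsqr_abs. f_equal. unfold Rsqr, Rminus. ring.
Qed.

Lemma continuous_sides (G : C -> C) (X Y L : R) :
  (forall x y, X <= x <= X + L -> Y <= y <= Y + L -> exists l, cderiv G (x, y) l) ->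
  forall x y, X <= x <= X + L -> Y <= y <= Y + L ->
  continuous (fun t => Re (G (t, y))) x /\ continuous (fun t => Im (G (x, t))) y.
Proof.
  intros H x y Hx Hy. destruct (H x y Hx Hy) as [l Hl]. split.
  - apply (continuous_along G (fun t => (t, y)) x l 1); [|exact Hl].
    intros t'. rewrite Cmod_pair_l. lra.
  - apply (continuous_along G (fun t => (x, t)) y l 1); [|exact Hl].
    intros t'. rewrite Cmod_pair_r. lra.
Qed.

Lemma continuous_translate (f : R -> R) (a t : R) :
  continuous f (a + t) -> continuous (fun t => f (a + t)) t.
Proof.
  intros H. apply (continuous_comp (fun t => a + t) f); [|exact H].
  apply (continuous_plus (fun _ => a) (fun t => t)); [apply continuous_const|apply continuous_id].
Qed.

Lemma ex_RInt_square_boundary (G : C -> C) (X Y L : R) : 0 < L ->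
  (forall x y, X <= x <= X + L -> Y <= y <= Y + L -> exists l, cderiv G (x, y) l) ->
  ex_RInt (square_boundary G X Y L) 0 L.
Proof.
  intros HL H. apply @ex_RInt_continuous. intros t Ht.
  rewrite Rmin_left, Rmax_right in Ht by lra.
  pose proof (continuous_sides G X Y L H) as Hc.
  pose proof (continuous_translate _ X t (proj1 (Hc (X + t) Y ltac:(lra) ltac:(lra)))) as C1.
  pose proof (continuous_translate _ X t (proj1 (Hc (X + t) (Y + L) ltac:(lra) ltac:(lra)))) as C2.
  pose proof (continuous_translate _ Y t (proj2 (Hc (X + L) (Y + t) ltac:(lra) ltac:(lra)))) as C3.
  pose proof (continuous_translate _ Y t (proj2 (Hc X (Y + t) ltac:(lra) ltac:(lra)))) as C4.
  exact (continuous_plus _ _ t (continuous_minus _ _ t (continuous_minus _ _ t C1 C2) C3) C4).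
Qed.

Lemma RInt_halves (f : R -> R) (M : R) : 0 < M -> ex_RInt f 0 (2 * M) ->
  RInt f 0 (2 * M) = RInt (fun t => f t + f (M + t)) 0 M.
Proof.
  intros HM Hf.
  assert (H1 : ex_RInt f 0 M) by (apply (ex_RInt_Chasles_1 f 0 M (2 * M)); [lra|easy]).
  assert (H2 : ex_RInt f M (2 * M)) by (apply (ex_RInt_Chasles_2 f 0 M (2 * M)); [lra|easy]).
  rewrite <- (RInt_Chasles f 0 M (2 * M)) by easy.
  assert (H3 : is_RInt (fun t => f (1 * t + M)) 0 M (RInt f M (2 * M))).
  { apply (is_RInt_ext (fun t => scal 1 (f (1 * t + M)))).
    { intros t _. apply Rmult_1_l. }
    apply (is_RInt_comp_lin f 1 M 0 M).
    replace (1 * 0 + M) with M by ring. replace (1 * M + M) with (2 * M) by ring.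
    now apply (@RInt_correct R_CompleteNormedModule). }
  symmetry. apply is_RInt_unique.
  apply (is_RInt_plus f (fun t => f (M + t))).
  - now apply (@RInt_correct R_CompleteNormedModule).
  - apply (is_RInt_ext (fun t => f (1 * t + M))); [|exact H3].
    intros t _. f_equal. ring.
Qed.

Lemma square_boundary_subdivide (G : C -> C) (X Y M : R) : 0 < M ->
  (forall x y, X <= x <= X + 2 * M -> Y <= y <= Y + 2 * M -> exists l, cderiv G (x, y) l) ->
  RInt (square_boundary G X Y (2 * M)) 0 (2 * M) =
  (RInt (square_boundary G X Y M) 0 M + RInt (square_boundary G (X + M) Y M) 0 M) +
  (RInt (square_boundary G X (Y + M) M) 0 M + RInt (square_boundary G (X + M) (Y + M) M) 0 M).
Proof.
  intros HM H.
  rewrite RInt_halves; [|easy|apply ex_RInt_square_boundary; [lra|easy]].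
  assert (E : forall x y, X <= x -> x + M <= X + 2 * M -> Y <= y -> y + M <= Y + 2 * M ->
     ex_RInt (square_boundary G x y M) 0 M).
  { intros x y ? ? ? ?. apply ex_RInt_square_boundary; [easy|]. intros. apply H; lra. }
  apply is_RInt_unique.
  (* Sides common to two quarters occur with opposite signs and cancel pointwise. *)
  apply (is_RInt_ext (fun t =>
    (square_boundary G X Y M t + square_boundary G (X + M) Y M t) +
    (square_boundary G X (Y + M) M t + square_boundary G (X + M) (Y + M) M t))).
  { intros t _. unfold square_boundary.
    rewrite !Rplus_assoc, Rplus_diag. simpl. ring. }
  apply (is_RInt_plus (fun t => _ + _) (fun t => _ + _));
    apply (is_RInt_plus (square_boundary G _ _ M) (square_boundary G _ _ M));
    apply (@RInt_correct R_CompleteNormedModule); apply E; lra.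
Qed.

Lemma goursat_square (G : C -> C) (X Y L : R) : 0 < L ->
  (forall x y, X <= x <= X + L -> Y <= y <= Y + L -> exists l, cderiv G (x, y) l) ->
  RInt (square_boundary G X Y L) 0 L = 0.
Proof.
  intros HL H.
  (* The 8 is four sides times the bound 2 M for the distance between two points of a square of side
     M; the bound is quadratic in the side, hence additive over quarters. *)
  assert (B : forall eps, 0 < eps -> Rabs (RInt (square_boundary G X Y L) 0 L) <= 8 * eps * L ^ 2).
  2:{ apply Rle_antisym; [apply Rnot_lt_le; intros Hc|apply Rnot_lt_le; intros Hc];
      (set (I := RInt _ _ _) in *;
      assert (HI : 0 < Rabs I) by (apply Rabs_pos_lt; lra);
      assert (HL2 : 0 < L ^ 2) by (apply pow_lt; easy);
      specialize (B (Rabs I / (16 * L ^ 2)));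
      replace (8 * (Rabs I / (16 * L ^ 2)) * L ^ 2) with (Rabs I / 2) in B by (field; lra);
      assert (0 < Rabs I / (16 * L ^ 2)) by (apply Rdiv_lt_0_compat; lra); specialize (B ltac:(easy)); lra). }
  intros eps Heps.
  set (P := fun x y M => X <= x -> x + M <= X + L -> Y <= y -> y + M <= Y + L ->
    Rabs (RInt (square_boundary G x y M) 0 M) <= 8 * eps * M ^ 2).
  enough (HP : P X Y L) by (apply HP; lra).
  apply square_cousin; [easy| |].
  - intros x y M HM P1 P2 P3 P4 Hx1 Hx2 Hy1 Hy2. unfold P in *.
    rewrite square_boundary_subdivide; [|easy|intros; apply H; lra].
    specialize (P1 ltac:(lra) ltac:(lra) ltac:(lra) ltac:(lra)).
    specialize (P2 ltac:(lra) ltac:(lra) ltac:(lra) ltac:(lra)).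
    specialize (P3 ltac:(lra) ltac:(lra) ltac:(lra) ltac:(lra)).
    specialize (P4 ltac:(lra) ltac:(lra) ltac:(lra) ltac:(lra)).
    eapply Rle_trans; [apply Rabs_triang|].
    eapply Rle_trans; [apply Rplus_le_compat; apply Rabs_triang|].
    replace (8 * eps * (2 * M) ^ 2) with (4 * (8 * eps * M ^ 2)) by ring. lra.
  - intros a b Ha Hb. destruct (H a b Ha Hb) as [l Hl].
    destruct (Hl eps Heps) as [d [Hd Hh]].
    exists (d / 2). split; [lra|].
    intros x y M HM Hxa Hyb Hx1 Hx2 Hy1 Hy2.
    assert (Hex : ex_RInt (square_boundary G x y M) 0 M).
    { apply ex_RInt_square_boundary; [easy|]. intros; apply H; lra. }
    replace (8 * eps * M ^ 2) with ((M - 0) * (8 * eps * M)) by ring.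
    apply (norm_RInt_le_const (square_boundary G x y M) 0 M _ (8 * eps * M)); [lra| |
      now apply (@RInt_correct R_CompleteNormedModule)].
    intros t Ht.
    (* The affine part of [G] at [(a, b)] contributes nothing to the integrand. *)
    set (r := fun p : C => (G p - G (a, b) - l * (p - (a, b)))%C).
    assert (Hr : forall u v, Rabs (u - a) <= M -> Rabs (v - b) <= M ->
       Cmod (r (u, v)) <= eps * (2 * M)).
    { intros u v Hu Hv.
      assert (Hm : Cmod ((u, v) - (a, b))%C <= 2 * M).
      { eapply Rle_trans; [apply Cmod_le_abs|]. simpl. unfold Rminus in *. lra. }
      specialize (Hh ((u, v) - (a, b))%C ltac:(lra)).
      rewrite Cplus_minus in Hh.
      unfold r. eapply Rle_trans; [exact Hh|]. apply Rmult_le_compat_l; lra. }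
    assert (Hre : forall u v, Rabs (u - a) <= M -> Rabs (v - b) <= M ->
       Rabs (Re (r (u, v))) <= eps * (2 * M) /\ Rabs (Im (r (u, v))) <= eps * (2 * M)).
    { intros u v Hu Hv. specialize (Hr u v Hu Hv).
      pose proof (re_le_Cmod (r (u, v))). pose proof (im_le_Cmod (r (u, v))). lra. }
    assert (E : square_boundary G x y M t =
      Re (r (x + t, y)) - Re (r (x + t, y + M)) - Im (r (x + M, y + t)) + Im (r (x, y + t))).
    { unfold square_boundary, r, Re, Im. destruct l as [p q]. simpl. ring. }
    rewrite E.
    destruct (Hre (x + t) y) as [R1 _]; try (apply Rabs_le_between; lra).
    destruct (Hre (x + t) (y + M)) as [R2 _]; try (apply Rabs_le_between; lra).
    destruct (Hre (x + M) (y + t)) as [_ R3]; try (apply Rabs_le_between; lra).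
    destruct (Hre x (y + t)) as [_ R4]; try (apply Rabs_le_between; lra).
    change (Rabs (Re (r (x + t, y)) - Re (r (x + t, y + M)) - Im (r (x + M, y + t))
      + Im (r (x, y + t))) <= 8 * eps * M).
    apply Rabs_le_between in R1, R2, R3, R4. apply Rabs_le_between. lra.
Qed.

(** * The maximum principle *)

Lemma Cexp_2PI (s y : R) : Cexp (s, y + 2 * PI) = Cexp (s, y).
Proof. unfold Cexp; simpl. rewrite cos_plus, sin_plus, cos_2PI, sin_2PI. f_equal; ring. Qed.

Section MeanValue.
Variables (F : C -> C) (w : C) (r : R).
Hypothesis Hr : 0 < r.
Hypothesis HF : forall h, Cmod h <= r -> exists l, cderiv F (w + h)%C l.

(** Logarithmic polar coordinates about [w]: vertical segments of length 2 pi become circles, and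
    horizontal shifts rescale the radius. *)
Let polar (p : C) : C := F (w + Cexp p)%C.

Let polar_cderiv (p : C) : Re p <= ln r -> exists l, cderiv polar p l.
Proof.
  intros Hp. destruct (HF (Cexp p)) as [l Hl].
  - rewrite Cmod_Cexp. apply (Rle_trans _ (exp (ln r))); [now apply exp_le_compat|].
    rewrite exp_ln; lra.
  - exists (l * (0 + Cexp p))%C. apply (cderiv_comp F (fun p => w + Cexp p)%C); [exact Hl|].
    apply (cderiv_plus (fun _ => w) Cexp); [apply cderiv_const|apply cderiv_exp].
Qed.

Let ex_RInt_polar (s : R) : s <= ln r -> ex_RInt (fun y => Re (polar (s, y))) 0 (2 * PI).
Proof.
  intros Hs. apply @ex_RInt_continuous. intros y _.
  destruct (polar_cderiv (s, y) Hs) as [l Hl].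
  apply (continuous_along polar (fun y => (s, y)) y l 1); [|exact Hl].
  intros t'. rewrite Cmod_pair_r. lra.
Qed.

(** Goursat's lemma for [Ci * polar] on a square whose side is the period: the horizontal sides
    cancel and the vertical ones carry the two circle means. Hence the compared radii have ratio
    exp(2 pi). *)
Let circle_mean_step (s : R) : s + 2 * PI <= ln r ->
  RInt (fun y => Re (polar (s, y))) 0 (2 * PI) =
  RInt (fun y => Re (polar (s + 2 * PI, y))) 0 (2 * PI).
Proof.
  intros Hs. pose proof PI_RGT_0 as Hpi.
  assert (H := goursat_square (fun p => Ci * polar p)%C s 0 (2 * PI) ltac:(lra)).
  assert (E : RInt (square_boundary (fun p => Ci * polar p)%C s 0 (2 * PI)) 0 (2 * PI) =
    RInt (fun y => Re (polar (s, y))) 0 (2 * PI) - RInt (fun y => Re (polar (s + 2 * PI, y))) 0 (2 * PI)).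
  { apply is_RInt_unique.
    apply (is_RInt_ext (fun y => Re (polar (s, y)) - Re (polar (s + 2 * PI, y)))).
    - intros t _. unfold square_boundary.
      replace (polar (s + t, 0 + 2 * PI)) with (polar (s + t, 0)).
      2:{ unfold polar. now rewrite Cexp_2PI. }
      rewrite !Rplus_0_l. unfold Re, Im. simpl. ring.
    - apply (is_RInt_minus (fun y => Re (polar (s, y))) (fun y => Re (polar (s + 2 * PI, y))));
        apply (@RInt_correct R_CompleteNormedModule), ex_RInt_polar; lra. }
  rewrite E in H. apply Rminus_diag_uniq, H.
  intros x y Hx _. destruct (polar_cderiv (x, y)) as [l Hl]; [simpl; lra|].
  exists (0 * polar (x, y) + Ci * l)%C.
  apply (cderiv_mult (fun _ => Ci) polar); [apply cderiv_const|exact Hl].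
Qed.

Lemma circle_mean_le (c : R) :
  (forall h, Cmod h = r -> Re (F (w + h)%C) <= c) -> Re (F w) <= c.
Proof.
  intros Hc. pose proof PI_RGT_0 as Hpi.
  set (m := fun s => RInt (fun y => Re (polar (s, y))) 0 (2 * PI)).
  assert (Hm : m (ln r) <= 2 * PI * c).
  { replace (2 * PI * c) with (RInt (fun _ => c) 0 (2 * PI)).
    2:{ rewrite RInt_const. unfold scal; simpl; unfold mult; simpl. ring. }
    apply RInt_le; [lra|apply ex_RInt_polar; lra|apply ex_RInt_const|].
    intros y _. apply Hc. rewrite Cmod_Cexp. simpl. now apply exp_ln. }
  (* Shifts by whole periods reach arbitrarily small circles, where continuity makes the mean close
     to 2 pi times [Re (F w)]. *)
  assert (Hshift : forall n, m (ln r - INR n * (2 * PI)) = m (ln r)).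
  { induction n as [|n IH].
    - f_equal. simpl. ring.
    - rewrite <- IH. unfold m. rewrite circle_mean_step.
      + rewrite S_INR. now replace (ln r - (INR n + 1) * (2 * PI) + 2 * PI) with (ln r - INR n * (2 * PI)) by ring.
      + rewrite S_INR. pose proof (pos_INR n). nra. }
  apply Rnot_lt_le. intros Hlt.
  set (eps := (Re (F w) - c) / 2). assert (Heps : 0 < eps) by (unfold eps; lra).
  destruct (HF 0%C) as [l Hl]; [rewrite Cmod_0; lra|].
  rewrite Cplus_0_r in Hl.
  destruct (cderiv_continuous _ _ _ Hl eps Heps) as [d [Hd Hcont]].
  destruct (INR_unbounded ((ln r - ln d) / (2 * PI))) as [n Hn].
  assert (Hs : ln r - INR n * (2 * PI) < ln d).
  { apply Rlt_div_l in Hn; lra. }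
  assert (Hs' : ln r - INR n * (2 * PI) <= ln r).
  { pose proof (pos_INR n). nra. }
  assert (Hlow : 2 * PI * (Re (F w) - eps) <= m (ln r - INR n * (2 * PI))).
  { replace (2 * PI * (Re (F w) - eps)) with (RInt (fun _ => Re (F w) - eps) 0 (2 * PI)).
    2:{ rewrite RInt_const. unfold scal; simpl; unfold mult; simpl. ring. }
    apply RInt_le; [lra|apply ex_RInt_const|now apply ex_RInt_polar|].
    intros y _. set (p := (ln r - INR n * (2 * PI), y) : C).
    assert (Hp : Cmod (Cexp p) < d).
    { rewrite Cmod_Cexp. rewrite <- (exp_ln d) by easy. now apply exp_increasing. }
    specialize (Hcont _ Hp). unfold polar.
    pose proof (re_le_Cmod (F (w + Cexp p) - F w)%C) as H1.
    assert (H2 : Rabs (Re (F (w + Cexp p)%C) - Re (F w)) < eps).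
    { eapply Rle_lt_trans; [exact H1|exact Hcont]. }
    apply Rabs_lt_between in H2. lra. }
  rewrite Hshift in Hlow.
  assert (2 * PI * (Re (F w) - eps) <= 2 * PI * c) by lra.
  apply Rmult_le_reg_l in H; [|lra]. unfold eps in H. lra.
Qed.
End MeanValue.

Lemma Cmod_sqr_plus (w h : C) :
  Cmod (w + h)%C ^ 2 = Cmod w ^ 2 + 2 * Re (Cconj w * h)%C + Cmod h ^ 2.
Proof. rewrite !Cmod2_alt. unfold Re, Im. destruct w, h. simpl. ring. Qed.

(** No boundary of [U] is mentioned: each point of the plane is either interior to [U], with [F]
    differentiable around it, or satisfies a limsup bound, which is vacuous away from the closure of
    [U]. Adding eta |z|^2 to |F| makes it strictly subharmonic, so its supremum is not attained at
    an interior point. *)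
Lemma max_principle (U : C -> Prop) (F : C -> C) (M : R) :
  0 <= M -> (forall z, U z -> Cmod z <= 1) ->
  (forall w,
     (U w /\ exists r, 0 < r /\ forall h, Cmod h <= r ->
        U (w + h)%C /\ exists l, cderiv F (w + h)%C l) \/
     (forall eps, 0 < eps -> exists d, 0 < d /\ forall h, Cmod h < d ->
        U (w + h)%C -> Cmod (F (w + h)%C) <= M + eps)) ->
  forall z, U z -> Cmod (F z) <= M.
Proof.
  intros HM HU Hloc z0 Hz0. apply Rnot_lt_le. intros Hlt.
  (* One third of the excess: [g] is at most [M + 2 * eta] near points of the second kind, but at
     least [M + 3 * eta] at [z0]. *)
  set (eta := (Cmod (F z0) - M) / 3). assert (Heta : 0 < eta) by (unfold eta; lra).
  set (g := fun z => Cmod (F z) + eta * Cmod z ^ 2).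
  assert (Hsq : forall z, U z -> 0 <= Cmod z ^ 2 <= 1).
  { intros z Hz. specialize (HU z Hz). pose proof (Cmod_ge_0 z). nra. }
  (* Local bounds for [g] glue to a global one of the same kind. With every bound good, the supremum
     [S] is finite; with the bounds below [S] good, the definition of [S] is contradicted. *)
  assert (Hcousin : forall good : R -> Prop, (forall a b, good a -> good b -> good (Rmax a b)) ->
    (forall w, exists d B, 0 < d /\ good B /\ forall h, Cmod h < d -> U (w + h)%C -> g (w + h)%C <= B) ->
    exists B, good B /\ forall z, U z -> g z <= B).
  { intros good Hgood Hl.
    set (P := fun x y L => exists B, good B /\ forall z, U z -> x <= Re z <= x + L ->
      y <= Im z <= y + L -> g z <= B).
    assert (H : P (-1) (-1) 2).
    { apply (square_cousin P); [lra| |]; unfold P.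
      - intros x y L HL (B1 & G1 & H1) (B2 & G2 & H2) (B3 & G3 & H3) (B4 & G4 & H4).
        exists (Rmax (Rmax B1 B2) (Rmax B3 B4)). split; [auto|].
        intros z Hz Hx Hy.
        pose proof (Rmax_l (Rmax B1 B2) (Rmax B3 B4)).
        pose proof (Rmax_r (Rmax B1 B2) (Rmax B3 B4)).
        pose proof (Rmax_l B1 B2). pose proof (Rmax_r B1 B2).
        pose proof (Rmax_l B3 B4). pose proof (Rmax_r B3 B4).
        destruct (Rle_dec (Re z) (x + L)), (Rle_dec (Im z) (y + L)).
        + specialize (H1 z Hz ltac:(lra) ltac:(lra)). lra.
        + specialize (H3 z Hz ltac:(lra) ltac:(lra)). lra.
        + specialize (H2 z Hz ltac:(lra) ltac:(lra)). lra.
        + specialize (H4 z Hz ltac:(lra) ltac:(lra)). lra.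
      - intros a b _ _. destruct (Hl (a, b)) as (d & B & Hd & GB & HB).
        exists (d / 2). split; [lra|]. intros x y L HL Hx Hy. exists B. split; [easy|].
        intros z Hz Hzx Hzy. rewrite <- (Cplus_minus (a, b) z). apply HB.
        + eapply Rle_lt_trans; [apply Cmod_le_abs|]. unfold Re, Im in *. simpl.
          assert (Rabs (fst z + - a) <= L) by (apply Rabs_le_between; lra).
          assert (Rabs (snd z + - b) <= L) by (apply Rabs_le_between; lra). lra.
        + now rewrite Cplus_minus. }
    destruct H as (B & GB & HB). exists B. split; [easy|]. intros z Hz.
    specialize (HU z Hz). pose proof (re_le_Cmod z). pose proof (im_le_Cmod z).
    apply HB; [easy| |].
    - assert (H1 : Rabs (Re z) <= 1) by lra. apply Rabs_le_between in H1. lra.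
    - assert (H1 : Rabs (Im z) <= 1) by lra. apply Rabs_le_between in H1. lra. }
  assert (Hnear : forall w d, 0 < d -> (exists r, 0 < r /\ forall h, Cmod h <= r ->
        U (w + h)%C /\ exists l, cderiv F (w + h)%C l) ->
      exists e, 0 < e /\ forall h, Cmod h < e -> g (w + h)%C <= g w + d).
  { intros w d Hd (r & Hr & H).
    destruct (H 0%C) as [HUw [l Hl]]; [rewrite Cmod_0; lra|]. rewrite Cplus_0_r in Hl, HUw.
    destruct (cderiv_continuous _ _ _ Hl (d / 2)) as [e [He Hc]]; [lra|].
    exists (Rmin e (Rmin 1 (d / (6 * eta)))). split.
    { repeat apply Rmin_glb_lt; try lra. apply Rdiv_lt_0_compat; lra. }
    intros h Hh.
    pose proof (Rmin_l e (Rmin 1 (d / (6 * eta)))). pose proof (Rmin_r e (Rmin 1 (d / (6 * eta)))).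
    pose proof (Rmin_l 1 (d / (6 * eta))). pose proof (Rmin_r 1 (d / (6 * eta))).
    specialize (Hc h ltac:(lra)). unfold g.
    pose proof (Cmod_sub_ge (F (w + h)%C) (F w)).
    assert (Hw2 : Cmod (w + h)%C ^ 2 <= Cmod w ^ 2 + 3 * Cmod h).
    { specialize (HU w HUw). pose proof (Cmod_ge_0 w). pose proof (Cmod_ge_0 h).
      pose proof (Cmod_triangle w h). pose proof (Cmod_ge_0 (w + h)%C).
      apply (Rle_trans _ ((Cmod w + Cmod h) ^ 2)); [apply pow_incr; lra|nra]. }
    assert (eta * (3 * Cmod h) <= d / 2).
    { replace (d / 2) with (eta * (3 * (d / (6 * eta)))) by (field; lra).
      apply Rmult_le_compat_l; lra. }
    nra. }
  assert (Hfar : forall w, (forall eps, 0 < eps -> exists d, 0 < d /\ forall h, Cmod h < d ->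
        U (w + h)%C -> Cmod (F (w + h)%C) <= M + eps) ->
      exists d, 0 < d /\ forall h, Cmod h < d -> U (w + h)%C -> g (w + h)%C <= M + 2 * eta).
  { intros w H. destruct (H eta Heta) as (d & Hd & Hh). exists d. split; [easy|].
    intros h Hlt' Hu. specialize (Hh h Hlt' Hu). specialize (Hsq _ Hu). unfold g. nra. }
  destruct (Hcousin (fun _ => True)) as (B & _ & HB); [easy| |].
  { intros w. destruct (Hloc w) as [[Uw H]|H].
    - destruct (Hnear w 1 Rlt_0_1 H) as (e & He & Hg). exists e, (g w + 1). auto.
    - destruct (Hfar w H) as (d & Hd & Hg). exists d, (M + 2 * eta). auto. }
  destruct (completeness (fun x => exists z, U z /\ x = g z)) as [S [HS1 HS2]].
  { exists B. intros x (z & Hz & ->). auto. }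
  { exists (g z0), z0. auto. }
  assert (HgS : forall z, U z -> g z <= S) by (intros z Hz; apply HS1; now exists z).
  assert (HSz : M + 3 * eta <= S).
  { pose proof (HgS z0 Hz0). pose proof (Hsq z0 Hz0). unfold g in H.
    unfold eta in *. nra. }
  destruct (Hcousin (fun B => B < S)) as (B' & HB'1 & HB'2).
  { intros a b Ha Hb. now apply Rmax_lub_lt. }
  2:{ apply (Rlt_irrefl S), Rle_lt_trans with B'; [|easy].
      apply HS2. intros x (z & Hz & ->). auto. }
  intros w. destruct (Hloc w) as [[Uw H]|H].
  2:{ destruct (Hfar w H) as (d & Hd & Hg). exists d, (M + 2 * eta). repeat split; auto; lra. }
  destruct (Rle_lt_or_eq_dec _ _ (HgS w Uw)) as [Hlw|Heq].
  { destruct (Hnear w ((S - g w) / 2) ltac:(lra) H) as (e & He & Hg).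
    exists e, (g w + (S - g w) / 2). repeat split; auto; lra. }
  (* The remaining case: [S] is attained at an interior point [w]. *)
  exfalso. destruct H as (r & Hr & H).
  assert (Hw2 := Hsq w Uw).
  assert (HFw : Cmod (F w) = S - eta * Cmod w ^ 2) by (unfold g in Heq; lra).
  assert (HFpos : 0 < Cmod (F w)) by nra.
  set (c := (Cconj (F w) / Cmod (F w))%C).
  assert (HcF : (c * F w)%C = Cmod (F w)).
  { unfold c. replace (Cconj (F w) / Cmod (F w) * F w)%C with (F w * Cconj (F w) / Cmod (F w))%C.
    - rewrite <- Cmod2_conj. simpl. rewrite Rmult_1_r, RtoC_mult. field. intros E. apply RtoC_inj in E. lra.
    - field. intros E. apply RtoC_inj in E. lra. }
  assert (Hc1 : Cmod c = 1).
  { unfold c. rewrite Cmod_div, Cmod_conj, Cmod_R, Rabs_pos_eq; try lra.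
    - field. lra.
    - intros E. apply RtoC_inj in E. lra. }
  (* The linear term is the first-order part of eta |z|^2 at [w]. On the circle of radius [r],
     [g <= S] bounds the real part of [K] by S - eta |w|^2 - eta r^2, while at the centre it equals
     S - eta |w|^2. *)
  set (K := fun z => (c * F z + RtoC (2 * eta) * Cconj w * (z + - w))%C).
  assert (HK : Re (K w) <= S - eta * Cmod w ^ 2 - eta * r ^ 2).
  { apply (circle_mean_le K w r Hr).
    - intros h Hh. destruct (H h Hh) as [_ [l Hl]].
      exists ((0 * F (w + h) + c * l) + (0 * ((w + h) + - w) + RtoC (2 * eta) * Cconj w * (1 + 0)))%C.
      apply (cderiv_plus (fun z => c * F z)%C (fun z => RtoC (2 * eta) * Cconj w * (z + - w))%C).
      + apply (cderiv_mult (fun _ => c) F); [apply cderiv_const|exact Hl].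
      + apply (cderiv_mult (fun _ => RtoC (2 * eta) * Cconj w)%C (fun z => z + - w)%C);
          [apply cderiv_const|].
        apply cderiv_plus; [apply cderiv_id|apply cderiv_const].
    - intros h Hh. destruct (H h ltac:(lra)) as [Hu _].
      pose proof (HgS _ Hu) as Hg. unfold g in Hg. rewrite Cmod_sqr_plus, Hh in Hg.
      assert (E : Re (K (w + h)%C) = Re (c * F (w + h))%C + 2 * eta * Re (Cconj w * h)%C).
      { unfold K. replace (w + h + - w)%C with h by ring.
        rewrite <- Cmult_assoc. unfold Re. destruct (Cconj w * h)%C as [p q].
        simpl. ring. }
      rewrite E.
      pose proof (re_le_Cmod (c * F (w + h))%C) as H1. rewrite Cmod_mult, Hc1 in H1.
      pose proof (RRle_abs (Re (c * F (w + h))%C)). nra. }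
  assert (E : Re (K w) = Cmod (F w)).
  { unfold K. replace (w + - w)%C with (RtoC 0) by ring. rewrite HcF. unfold Re. simpl. ring. }
  assert (0 < r ^ 2) by now apply pow_lt. nra.
Qed.

(** * Blaschke products *)

Definition cdiff (F : C -> C) (z : C) : Prop := exists l, cderiv F z l.

Lemma cdiff_const (c z : C) : cdiff (fun _ => c) z.
Proof. eexists. apply cderiv_const. Qed.

Lemma cdiff_id (z : C) : cdiff (fun x => x) z.
Proof. eexists. apply cderiv_id. Qed.

Lemma cdiff_plus (F G : C -> C) (z : C) :
  cdiff F z -> cdiff G z -> cdiff (fun x => F x + G x)%C z.
Proof. intros [l Hl] [m Hm]. eexists. apply cderiv_plus; eassumption. Qed.

Lemma cdiff_mult (F G : C -> C) (z : C) :
  cdiff F z -> cdiff G z -> cdiff (fun x => F x * G x)%C z.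
Proof. intros [l Hl] [m Hm]. eexists. apply cderiv_mult; eassumption. Qed.

Lemma cdiff_comp (F G : C -> C) (z : C) :
  cdiff F (G z) -> cdiff G z -> cdiff (fun x => F (G x)) z.
Proof. intros [l Hl] [m Hm]. eexists. apply cderiv_comp; eassumption. Qed.

Lemma cdiff_opp (F : C -> C) (z : C) : cdiff F z -> cdiff (fun x => - F x)%C z.
Proof.
  intros H. destruct (cdiff_mult (fun _ => (- (1))%C) F z (cdiff_const _ _) H) as [l Hl].
  exists l. revert Hl. apply cderiv_ext. intros x. ring.
Qed.

Lemma cdiff_minus (F G : C -> C) (z : C) :
  cdiff F z -> cdiff G z -> cdiff (fun x => F x - G x)%C z.
Proof. intros HF HG. apply (cdiff_plus F (fun x => - G x)%C z HF). now apply cdiff_opp. Qed.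

Lemma cdiff_div (F G : C -> C) (z : C) :
  cdiff F z -> cdiff G z -> G z <> 0%C -> cdiff (fun x => F x / G x)%C z.
Proof.
  intros HF HG Hz. apply (cdiff_mult F (fun x => / G x)%C z HF).
  apply (cdiff_comp Cinv G); [|exact HG]. eexists. now apply cderiv_inv.
Qed.

Lemma cdiff_lower (F : C -> C) (z : C) (c : R) : cdiff F z -> c < Cmod (F z) ->
  exists d, 0 < d /\ forall h, Cmod h < d -> c < Cmod (F (z + h)%C).
Proof.
  intros [l Hl] Hc.
  destruct (cderiv_continuous _ _ _ Hl (Cmod (F z) - c)) as [d [Hd H]]; [lra|].
  exists d; split; [easy|]. intros h Hh. specialize (H h Hh).
  rewrite Cmod_sub_sym in H. pose proof (Cmod_sub_ge (F z) (F (z + h)%C)). lra.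
Qed.

Definition mob (a z : C) : C := ((z - a) / (1 - Cconj a * z))%C.

(** This is 1 - |mob a z|^2 by [Cmod_mob_sqr]; its sums control Blaschke products from both sides in
    [blaschke_prod_lower] and [blaschke_prod_upper]. *)
Definition mob_ker (a z : C) : R :=
  (1 - Cmod a ^ 2) * (1 - Cmod z ^ 2) / Cmod (1 - Cconj a * z)%C ^ 2.

Lemma Cmod_mob_denom (a z : C) : 1 - Cmod a * Cmod z <= Cmod (1 - Cconj a * z)%C.
Proof.
  pose proof (Cmod_sub_ge 1 (Cconj a * z)%C) as H.
  now rewrite Cmod_1, Cmod_mult, Cmod_conj in H.
Qed.

Lemma Cmod_mob_denom_le (a z : C) : Cmod (1 - Cconj a * z)%C <= 1 + Cmod a * Cmod z.
Proof.
  pose proof (Cmod_triang_sub 1 (Cconj a * z)%C) as H.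
  now rewrite Cmod_1, Cmod_mult, Cmod_conj in H.
Qed.

Lemma Cmod_mob_denom_ge (a z : C) : Cmod a < 1 -> Cmod z <= 1 ->
  1 - Cmod a <= Cmod (1 - Cconj a * z)%C.
Proof.
  intros Ha Hz. eapply Rle_trans; [|apply Cmod_mob_denom].
  pose proof (Cmod_ge_0 a). nra.
Qed.

Lemma mob_denom_neq_0 (a z : C) : Cmod a < 1 -> Cmod z <= 1 -> (1 - Cconj a * z)%C <> 0%C.
Proof.
  intros Ha Hz. apply Cmod_gt_0. pose proof (Cmod_mob_denom_ge a z Ha Hz). lra.
Qed.

Lemma mob_denom_sym (a z : C) : Cmod (1 - Cconj a * z)%C = Cmod (1 - Cconj z * a)%C.
Proof.
  rewrite <- (Cmod_conj (1 - Cconj z * a)%C). f_equal.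
  destruct a, z. unfold Cconj, Cminus, Cmult, Cplus, Copp, RtoC; simpl. f_equal; ring.
Qed.

Lemma Cmod_mob_sqr (a z : C) : Cmod a < 1 -> Cmod z <= 1 ->
  Cmod (mob a z) ^ 2 = 1 - mob_ker a z.
Proof.
  intros Ha Hz. unfold mob, mob_ker.
  pose proof (mob_denom_neq_0 a z Ha Hz) as Hn.
  rewrite Cmod_div by easy. apply Cmod_gt_0 in Hn.
  assert (E : Cmod (z - a)%C ^ 2 = Cmod (1 - Cconj a * z)%C ^ 2 - (1 - Cmod a ^ 2) * (1 - Cmod z ^ 2)).
  { rewrite !Cmod2_alt. unfold Re, Im. destruct a, z. simpl. ring. }
  unfold Rdiv at 1. rewrite Rpow_mult_distr, pow_inv, E. field. lra.
Qed.

Lemma mob_ker_bound (a z : C) : Cmod a < 1 -> Cmod z < 1 -> 0 < mob_ker a z <= 1.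
Proof.
  intros Ha Hz. split.
  - pose proof (Cmod_mob_denom_ge a z Ha ltac:(lra)).
    pose proof (Cmod_ge_0 a). pose proof (Cmod_ge_0 z).
    apply Rdiv_lt_0_compat; [|apply pow_lt; lra]. apply Rmult_lt_0_compat; nra.
  - pose proof (Cmod_mob_sqr a z Ha ltac:(lra)). pose proof (pow2_ge_0 (Cmod (mob a z))). lra.
Qed.

Lemma Cmod_mob_le_1 (a z : C) : Cmod a < 1 -> Cmod z < 1 -> Cmod (mob a z) <= 1.
Proof.
  intros Ha Hz. pose proof (Cmod_mob_sqr a z Ha ltac:(lra)).
  pose proof (mob_ker_bound a z Ha Hz). pose proof (Cmod_ge_0 (mob a z)). nra.
Qed.

Lemma Cmod_mob_circle (a z : C) : Cmod a < 1 -> Cmod z = 1 -> Cmod (mob a z) = 1.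
Proof.
  intros Ha Hz. pose proof (Cmod_mob_sqr a z Ha ltac:(lra)) as H.
  unfold mob_ker in H. rewrite Hz in H.
  replace ((1 - Cmod a ^ 2) * (1 - 1 ^ 2)) with 0 in H by ring.
  unfold Rdiv in H. rewrite Rmult_0_l in H.
  pose proof (Cmod_ge_0 (mob a z)). nra.
Qed.

Lemma Cmod_mob_ge (a z : C) : Cmod a < 1 -> Cmod z <= 1 ->
  Cmod (z - a)%C / 2 <= Cmod (mob a z).
Proof.
  intros Ha Hz. pose proof (mob_denom_neq_0 a z Ha Hz) as Hn. unfold mob.
  rewrite Cmod_div by easy. apply Cmod_gt_0 in Hn.
  apply Rmult_le_compat_l; [apply Cmod_ge_0|]. apply Rinv_le_contravar; [easy|].
  pose proof (Cmod_mob_denom_le a z). pose proof (Cmod_ge_0 a). pose proof (Cmod_ge_0 z). nra.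
Qed.

Lemma cdiff_mob (a z : C) : Cmod a < 1 -> Cmod z <= 1 -> cdiff (mob a) z.
Proof.
  intros Ha Hz. apply cdiff_div.
  - apply cdiff_minus; [apply cdiff_id|apply cdiff_const].
  - apply cdiff_minus; [apply cdiff_const|].
    apply cdiff_mult; [apply cdiff_const|apply cdiff_id].
  - now apply mob_denom_neq_0.
Qed.

Definition blaschke_prod (l : list C) (z : C) : C :=
  fold_right (fun a p => (mob a z * p)%C) 1%C l.

Lemma blaschke_prod_cdiff (l : list C) (z : C) :
  (forall a, In a l -> Cmod a < 1) -> Cmod z <= 1 -> cdiff (blaschke_prod l) z.
Proof.
  intros Hl Hz. induction l as [|a l IH].
  - apply (cdiff_const 1 z).
  - apply (cdiff_mult (mob a) (blaschke_prod l)).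
    + apply cdiff_mob; [apply Hl; now left|easy].
    + apply IH. intros b Hb. apply Hl. now right.
Qed.

Lemma blaschke_prod_app (l1 l2 : list C) (z : C) :
  blaschke_prod (l1 ++ l2) z = (blaschke_prod l1 z * blaschke_prod l2 z)%C.
Proof.
  induction l1 as [|a l1 IH]; simpl.
  - ring.
  - rewrite IH. ring.
Qed.

Lemma blaschke_prod_neq_0 (l : list C) (z : C) :
  (forall a, In a l -> Cmod a < 1) -> Cmod z <= 1 -> ~ In z l -> blaschke_prod l z <> 0%C.
Proof.
  intros Hl Hz Hn. induction l as [|a l IH]; simpl.
  - intros E. apply RtoC_inj in E. lra.
  - apply Cmult_neq_0.
    + apply Cmod_gt_0. eapply Rlt_le_trans; [|apply Cmod_mob_ge; [apply Hl; now left|easy]].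
      apply Rdiv_lt_0_compat; [|lra]. apply Cmod_gt_0. intros E. apply Hn. left.
      symmetry. rewrite <- (Cplus_minus a z), E. ring.
    + apply IH; [intros b Hb; apply Hl; now right|]. intros H. apply Hn. now right.
Qed.

Lemma blaschke_prod_circle (l : list C) (z : C) :
  (forall a, In a l -> Cmod a < 1) -> Cmod z = 1 -> Cmod (blaschke_prod l z) = 1.
Proof.
  intros Hl Hz. induction l as [|a l IH]; simpl.
  - apply Cmod_1.
  - rewrite Cmod_mult, Cmod_mob_circle, IH; [ring| |apply Hl; now left|easy].
    intros b Hb. apply Hl. now right.
Qed.

Lemma not_in_nearby (l : list C) (w : C) : ~ In w l ->
  exists r, 0 < r /\ forall h, Cmod h <= r -> ~ In (w + h)%C l.
Proof.
  induction l as [|a l IH]; intros Hn.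
  - exists 1. split; [lra|]. intros h _ [].
  - destruct IH as (r & Hr & H); [intros H; apply Hn; now right|].
    assert (Hd : 0 < Cmod (a - w)%C).
    { apply Cmod_gt_0. intros E. apply Hn. left. rewrite <- (Cplus_minus w a), E. ring. }
    exists (Rmin r (Cmod (a - w)%C / 2)). split; [apply Rmin_glb_lt; lra|].
    intros h Hh [E|E].
    + assert (E' : (a - w)%C = h) by (rewrite E; ring).
      rewrite E' in *. pose proof (Rmin_r r (Cmod h / 2)). lra.
    + apply (H h); [|easy]. eapply Rle_trans; [exact Hh|apply Rmin_l].
Qed.

(* Applying the maximum principle to [h ^ 2 / B] rather than [h / B] costs a square
   root but makes the quotient tend to 0 at the zeros, so that no removable
   singularity has to be filled. *)
Lemma blaschke_bound (h : C -> C) (l : list C) (M : R) :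
  NoDup l -> (forall a, In a l -> Cmod a < 1) ->
  (forall z, Cmod z < 1 -> cdiff h z) -> (forall z, Cmod z < 1 -> Cmod (h z) <= M) ->
  (forall a, In a l -> h a = 0%C) ->
  forall z, Cmod z < 1 -> Cmod (h z) ^ 2 <= M ^ 2 * Cmod (blaschke_prod l z).
Proof.
  intros Hnd Hl Hh HM Hzero z Hz.
  assert (HM0 : 0 <= M).
  { eapply Rle_trans; [apply Cmod_ge_0|apply (HM 0%C)]. rewrite Cmod_0. lra. }
  destruct (excluded_middle_informative (In z l)) as [Hin|Hin].
  { rewrite (Hzero z Hin), Cmod_0. simpl. pose proof (Cmod_ge_0 (blaschke_prod l z)). nra. }
  set (U := fun z => Cmod z < 1 /\ ~ In z l).
  set (F := fun z => (h z * h z / blaschke_prod l z)%C).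
  assert (HF : forall x, U x -> Cmod (F x) = Cmod (h x) ^ 2 / Cmod (blaschke_prod l x)).
  { intros x [Hx1 Hx2]. unfold F. rewrite Cmod_div, Cmod_mult; [f_equal; ring|].
    apply blaschke_prod_neq_0; auto; lra. }
  assert (Hpos : forall x, U x -> 0 < Cmod (blaschke_prod l x)).
  { intros x [Hx1 Hx2]. apply Cmod_gt_0, blaschke_prod_neq_0; auto; lra. }
  assert (Hsq : forall x, U x -> Cmod (h x) ^ 2 <= M ^ 2).
  { intros x [Hx1 Hx2]. apply pow_incr. split; [apply Cmod_ge_0|auto]. }
  assert (HM2 : 0 <= M ^ 2) by apply pow2_ge_0.
  enough (H : Cmod (F z) <= M ^ 2).
  { rewrite HF in H by easy. now apply (Rle_div_l _ _ _ (Hpos z (conj Hz Hin))). }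
  apply (max_principle U F (M ^ 2)); [easy|intros x [Hx _]; lra| |easy].
  intros w. destruct (Rlt_le_dec (Cmod w) 1) as [Hw|Hw].
  - destruct (excluded_middle_informative (In w l)) as [Hwl|Hwl].
    + right. intros eps Heps.
      destruct (in_split _ _ Hwl) as (l1 & l2 & El).
      assert (Hsub : forall a, In a (l1 ++ l2) -> In a l).
      { intros a Ha. rewrite El. apply in_app_iff in Ha. apply in_app_iff. simpl. tauto. }
      assert (Hw2 : ~ In w (l1 ++ l2)) by (rewrite El in Hnd; now apply NoDup_remove_2 in Hnd).
      assert (HB : 0 < Cmod (blaschke_prod (l1 ++ l2) w)).
      { apply Cmod_gt_0, blaschke_prod_neq_0; auto; lra. }
      set (c := Cmod (blaschke_prod (l1 ++ l2) w) / 2) in *.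
      destruct (cdiff_lower (blaschke_prod (l1 ++ l2)) w c) as (d1 & Hd1 & H1).
      { apply blaschke_prod_cdiff; auto; lra. }
      { unfold c; lra. }
      destruct (Hh w Hw) as [m Hm]. destruct (cderiv_lip _ _ _ Hm) as (d2 & Hd2 & H2).
      rewrite (Hzero w Hwl) in H2.
      assert (Hc : 0 < c) by (unfold c; lra).
      set (K := Cmod m + 1) in *. assert (HK : 0 < K) by (pose proof (Cmod_ge_0 m); unfold K; lra).
      (* Near a zero, |h|^2 <= K^2 |k|^2 while the product is at least c |k| / 2, so the quotient is
         at most 2 K^2 |k| / c. *)
      exists (Rmin (Rmin d1 d2) (eps * c / (2 * K ^ 2))).
      assert (HK2 : 0 < K ^ 2) by now apply pow_lt.
      split. { repeat apply Rmin_glb_lt; auto. apply Rdiv_lt_0_compat; nra. }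
      intros k Hk Uk.
      pose proof (Rmin_l (Rmin d1 d2) (eps * c / (2 * K ^ 2))).
      pose proof (Rmin_r (Rmin d1 d2) (eps * c / (2 * K ^ 2))).
      pose proof (Rmin_l d1 d2). pose proof (Rmin_r d1 d2).
      specialize (H1 k ltac:(lra)). specialize (H2 k ltac:(lra)).
      rewrite HF by easy. apply Rle_div_l; [now apply Hpos|].
      replace (h (w + k) - 0)%C with (h (w + k)%C) in H2 by ring.
      assert (EB : Cmod (blaschke_prod l (w + k)%C) =
        Cmod (mob w (w + k)%C) * Cmod (blaschke_prod (l1 ++ l2) (w + k)%C)).
      { rewrite El, !blaschke_prod_app, <- Cmod_mult. simpl. f_equal. ring. }
      destruct Uk as [Uk1 Uk2].
      pose proof (Cmod_mob_ge w (w + k)%C Hw ltac:(lra)) as Hge.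
      replace (w + k - w)%C with k in Hge by ring.
      pose proof (Cmod_ge_0 k) as Hk0.
      apply (Rle_trans _ (eps * (Cmod k / 2 * c))).
      * apply (Rle_trans _ ((K * Cmod k) ^ 2)).
        { apply pow_incr. split; [apply Cmod_ge_0|easy]. }
        assert (HkK : Cmod k * (2 * K ^ 2) <= eps * c) by (apply Rle_div_r; lra).
        nra.
      * rewrite EB. apply (Rle_trans _ (eps * (Cmod (mob w (w + k)%C) * Cmod (blaschke_prod (l1 ++ l2) (w + k)%C)))).
        { apply Rmult_le_compat_l; [lra|]. apply Rmult_le_compat; lra. }
        { apply Rmult_le_compat_r; [|lra]. apply Rmult_le_pos; apply Cmod_ge_0. }
    + left. split; [easy|].
      destruct (not_in_nearby l w Hwl) as (r & Hr & Hn).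
      exists (Rmin r ((1 - Cmod w) / 2)). split; [apply Rmin_glb_lt; lra|].
      intros k Hk. pose proof (Rmin_l r ((1 - Cmod w) / 2)). pose proof (Rmin_r r ((1 - Cmod w) / 2)).
      assert (Uk : U (w + k)%C).
      { split; [|apply Hn; lra]. pose proof (Cmod_triangle w k). lra. }
      split; [easy|]. destruct Uk as [Uk1 Uk2].
      apply cdiff_div.
      * apply cdiff_mult; auto.
      * apply blaschke_prod_cdiff; auto; lra.
      * apply blaschke_prod_neq_0; auto; lra.
  - destruct (Rle_lt_or_eq_dec _ _ Hw) as [Hw1|Hw1].
    + right. intros eps Heps. exists (Cmod w - 1). split; [lra|].
      intros k Hk [Uk _]. pose proof (Cmod_sub_ge w (- k)%C) as H. rewrite Cmod_opp in H.
      replace (w - - k)%C with (w + k)%C in H by ring. lra.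
    + right. intros eps Heps.
      (* On the circle |B| = 1, so nearby |B| exceeds this threshold, which is what makes M^2 / |B|
         at most M^2 + eps. *)
      destruct (cdiff_lower (blaschke_prod l) w (M ^ 2 / (M ^ 2 + eps))) as (d & Hd & H).
      * apply blaschke_prod_cdiff; auto; lra.
      * rewrite blaschke_prod_circle by auto. apply Rlt_div_l; lra.
      * exists d. split; [easy|]. intros k Hk Uk. specialize (H k Hk).
        rewrite HF by easy. apply Rle_div_l; [now apply Hpos|].
        eapply Rle_trans; [now apply Hsq|]. apply Rlt_div_l in H; lra.
Qed.

(** * Finite sums *)

Definition lsum {A : Type} (f : A -> R) (l : list A) : R :=
  fold_right (fun a s => f a + s) 0 l.

Lemma lsum_le {A : Type} (f g : A -> R) (l : list A) :
  (forall a, In a l -> f a <= g a) -> lsum f l <= lsum g l.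
Proof.
  induction l as [|a l IH]; simpl; intros H; [lra|].
  apply Rplus_le_compat; auto.
Qed.

Lemma lsum_ext {A : Type} (f g : A -> R) (l : list A) :
  (forall a, In a l -> f a = g a) -> lsum f l = lsum g l.
Proof. intros H. apply Rle_antisym; apply lsum_le; intros a Ha; rewrite H; auto; lra. Qed.

Lemma lsum_pos {A : Type} (f : A -> R) (l : list A) :
  (forall a, In a l -> 0 <= f a) -> 0 <= lsum f l.
Proof.
  induction l as [|a l IH]; simpl; intros H; [lra|].
  apply Rplus_le_le_0_compat; auto.
Qed.

Lemma lsum_plus {A : Type} (f g : A -> R) (l : list A) :
  lsum (fun a => f a + g a) l = lsum f l + lsum g l.
Proof. induction l as [|a l IH]; simpl; [ring|]. rewrite IH. ring. Qed.

Lemma lsum_scal {A : Type} (c : R) (f : A -> R) (l : list A) :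
  lsum (fun a => c * f a) l = c * lsum f l.
Proof. induction l as [|a l IH]; simpl; [ring|]. rewrite IH. ring. Qed.

Lemma lsum_const {A : Type} (c : R) (l : list A) :
  lsum (fun _ => c) l = INR (length l) * c.
Proof.
  induction l as [|a l IH]; [simpl; ring|].
  change (length (a :: l)) with (S (length l)). rewrite S_INR. simpl. rewrite IH. ring.
Qed.

Lemma lsum_app {A : Type} (f : A -> R) (l1 l2 : list A) :
  lsum f (l1 ++ l2) = lsum f l1 + lsum f l2.
Proof. induction l1 as [|a l1 IH]; simpl; [ring|]. rewrite IH. ring. Qed.

Lemma lsum_map {A B : Type} (f : B -> R) (g : A -> B) (l : list A) :
  lsum f (map g l) = lsum (fun a => f (g a)) l.
Proof. induction l as [|a l IH]; simpl; [easy|]. now rewrite IH. Qed.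

Lemma lsum_swap {A B : Type} (f : A -> B -> R) (l : list A) (l' : list B) :
  lsum (fun a => lsum (f a) l') l = lsum (fun b => lsum (fun a => f a b) l) l'.
Proof.
  induction l as [|a l IH]; simpl.
  - induction l' as [|b l' IH']; simpl; [easy|]. rewrite <- IH'. ring.
  - rewrite IH, <- lsum_plus. now apply lsum_ext.
Qed.

Lemma lsum_filter {A : Type} (f : A -> R) (p : A -> bool) (l : list A) :
  lsum f l = lsum f (filter p l) + lsum f (filter (fun a => negb (p a)) l).
Proof.
  induction l as [|a l IH]; simpl; [ring|]. destruct (p a); simpl; rewrite IH; ring.
Qed.

Lemma lsum_fibers {A : Type} (f : A -> R) (code : A -> nat) (N : nat) (l : list A) :
  (forall a, In a l -> (code a < N)%nat) ->
  lsum f l = lsum (fun n => lsum f (filter (fun a => Nat.eqb (code a) n) l)) (seq 0 N).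
Proof.
  revert l. induction N as [|N IH]; intros l H.
  - destruct l as [|a l]; [easy|]. specialize (H a (or_introl eq_refl)). lia.
  - rewrite seq_S, lsum_app. simpl. rewrite Rplus_0_r.
    rewrite (lsum_filter f (fun a => Nat.eqb (code a) N) l), Rplus_comm. f_equal.
    rewrite IH.
    + apply lsum_ext. intros n Hn. apply in_seq in Hn. f_equal. clear IH H.
      induction l as [|a l IH]; simpl; [easy|].
      destruct (Nat.eqb_spec (code a) N); simpl; destruct (Nat.eqb_spec (code a) n); simpl; auto; try lia.
      now rewrite IH.
    + intros a Ha. apply filter_In in Ha. destruct Ha as [Ha Hc].
      specialize (H a Ha). destruct (Nat.eqb_spec (code a) N); [easy|lia].
Qed.

Lemma lsum_incl {A : Type} (f : A -> R) (l l' : list A) :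
  NoDup l -> incl l l' -> (forall a, In a l' -> 0 <= f a) -> lsum f l <= lsum f l'.
Proof.
  revert l'. induction l as [|a l IH]; intros l' Hnd Hincl Hf.
  - simpl. now apply lsum_pos.
  - inversion Hnd as [|? ? Hna Hnd']; subst.
    destruct (in_split a l' (Hincl a (or_introl eq_refl))) as (l1 & l2 & ->).
    rewrite lsum_app. simpl.
    assert (H : lsum f l <= lsum f (l1 ++ l2)).
    { apply IH; [easy| |].
      - intros b Hb. specialize (Hincl b (or_intror Hb)).
        apply in_app_iff in Hincl. apply in_app_iff. destruct Hincl as [?|[->|?]]; tauto.
      - intros b Hb. apply Hf. apply in_app_iff in Hb. apply in_app_iff. simpl. tauto. }
    rewrite lsum_app in H. lra.
Qed.

Lemma lsum_telescope (u : nat -> R) (n : nat) :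
  lsum (fun i => u (S i) - u i) (seq 0 n) = u n - u O.
Proof.
  induction n as [|n IH]; [simpl; ring|].
  rewrite seq_S, lsum_app, IH. simpl. ring.
Qed.

(** The function x / (1 + |x|) is bounded and increasing, and four times its unit increment
    dominates the summand; telescoping then bounds sums over integers uniformly in the shift. The
    cases are the signs of [x] and [x + 1]. *)
Lemma inv_1_sqr_telescope (x : R) :
  / (1 + x ^ 2) <= 4 * ((x + 1) / (1 + Rabs (x + 1)) - x / (1 + Rabs x)).
Proof.
  assert (Hx : 0 < 1 + x ^ 2) by (pose proof (pow2_ge_0 x); lra).
  destruct (Rle_lt_dec 0 x) as [H|H]; [|destruct (Rle_lt_dec x (-1)) as [H1|H1]].
  - rewrite !Rabs_pos_eq by lra.
    replace (4 * ((x + 1) / (1 + (x + 1)) - x / (1 + x))) with (/ ((1 + x) * (2 + x) / 4))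
      by (field; lra).
    apply Rinv_le_contravar; nra.
  - rewrite !Rabs_left1 by lra.
    replace (4 * ((x + 1) / (1 + - (x + 1)) - x / (1 + - x))) with (/ (- x * (1 - x) / 4))
      by (field; lra).
    apply Rinv_le_contravar; nra.
  - rewrite (Rabs_left1 x), (Rabs_pos_eq (x + 1)) by lra.
    replace (4 * ((x + 1) / (1 + (x + 1)) - x / (1 + - x))) with
      (4 * (1 - 2 * x - 2 * x ^ 2) / ((2 + x) * (1 - x))) by (field; lra).
    apply Rle_trans with 1.
    + rewrite <- Rinv_1. apply Rinv_le_contravar; nra.
    + apply Rle_div_r; nra.
Qed.

Lemma lsum_inv_1_sqr (s : R) (l : list Z) : NoDup l ->
  lsum (fun m => / (1 + (IZR m - s) ^ 2)) l <= 8.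
Proof.
  intros Hnd.
  assert (HN : exists N : nat, forall m, In m l -> (- Z.of_nat N <= m < Z.of_nat N)%Z).
  { clear Hnd. induction l as [|m l [N HN]]; [now exists O|].
    exists (N + S (Z.abs_nat m))%nat. intros k [->|Hk]; [lia|]. specialize (HN k Hk). lia. }
  destruct HN as [N HN].
  set (z := fun i => (Z.of_nat i - Z.of_nat N)%Z).
  apply Rle_trans with (lsum (fun m => / (1 + (IZR m - s) ^ 2)) (map z (seq 0 (2 * N)))).
  - apply lsum_incl; [easy| |].
    + intros m Hm. specialize (HN m Hm). apply in_map_iff.
      exists (Z.to_nat (m + Z.of_nat N)). unfold z. split; [lia|]. apply in_seq. lia.
    + intros m _. apply Rlt_le, Rinv_0_lt_compat. pose proof (pow2_ge_0 (IZR m - s)). lra.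
  - rewrite lsum_map.
    set (u := fun i => 4 * ((IZR (z i) - s) / (1 + Rabs (IZR (z i) - s)))).
    apply Rle_trans with (lsum (fun i => u (S i) - u i) (seq 0 (2 * N))).
    + apply lsum_le. intros i _. unfold u.
      replace (IZR (z (S i)) - s) with ((IZR (z i) - s) + 1).
      * pose proof (inv_1_sqr_telescope (IZR (z i) - s)). lra.
      * unfold z. rewrite Nat2Z.inj_succ, !minus_IZR, succ_IZR. ring.
    + rewrite lsum_telescope.
      assert (Hu : forall i, Rabs (u i) <= 4).
      { intros i. unfold u. set (x := IZR (z i) - s). pose proof (Rabs_pos x).
        rewrite Rabs_mult, Rabs_div, (Rabs_pos_eq (1 + Rabs x)), Rabs_pos_eq by lra.
        assert (Rabs x / (1 + Rabs x) <= 1) by (apply (Rdiv_le_1 (Rabs x)); lra). lra. }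
      pose proof (Hu (2 * N)%nat) as H1. pose proof (Hu O) as H2.
      apply Rabs_le_between in H1, H2. lra.
Qed.

(** In a right-angled sector, imaginary part and modulus determine the point with Lipschitz control:
    Re z - Re w is recovered from the difference of the squares, after division by Re z + Re w. *)
Lemma sector_close (z w : C) (h : R) : 0 <= h ->
  Rabs (Im z) <= Re z -> Rabs (Im w) <= Re w ->
  Rabs (Im z - Im w) <= h -> Rabs (Cmod z - Cmod w) <= h -> Cmod (z - w)%C <= 4 * h.
Proof.
  intros Hh Hz Hw Him Hmod.
  pose proof (Rabs_pos (Im z)) as Pz. pose proof (Rabs_pos (Im w)) as Pw.
  assert (Bz : Cmod z <= 2 * Re z) by (pose proof (Cmod_le_abs z); rewrite (Rabs_pos_eq (Re z)) in H; lra).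
  assert (Bw : Cmod w <= 2 * Re w) by (pose proof (Cmod_le_abs w); rewrite (Rabs_pos_eq (Re w)) in H; lra).
  assert (E : (Re z - Re w) * (Re z + Re w) =
    (Cmod z - Cmod w) * (Cmod z + Cmod w) - (Im z - Im w) * (Im z + Im w)).
  { pose proof (Cmod2_alt z). pose proof (Cmod2_alt w). nra. }
  assert (Hre : Rabs (Re z - Re w) <= 3 * h).
  { destruct (Req_dec (Re z + Re w) 0) as [H0|H0].
    - replace (Re z - Re w) with 0 by lra. rewrite Rabs_R0. lra.
    - apply (Rmult_le_reg_r (Re z + Re w)); [lra|].
      rewrite <- (Rabs_pos_eq (Re z + Re w)) at 1 by lra.
      rewrite <- Rabs_mult, E. unfold Rminus at 1.
      eapply Rle_trans; [apply Rabs_triang|]. rewrite Rabs_Ropp, !Rabs_mult.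
      pose proof (Cmod_ge_0 z). pose proof (Cmod_ge_0 w).
      rewrite (Rabs_pos_eq (Cmod z + Cmod w)) by lra.
      pose proof (Rabs_triang (Im z) (Im w)).
      assert (A : Rabs (Cmod z - Cmod w) * (Cmod z + Cmod w) <= h * (2 * (Re z + Re w))).
      { apply Rmult_le_compat; try lra. apply Rabs_pos. }
      assert (B : Rabs (Im z - Im w) * Rabs (Im z + Im w) <= h * (Re z + Re w)).
      { apply Rmult_le_compat; try lra; apply Rabs_pos. }
      lra. }
  pose proof (Cmod_le_abs (z - w)%C) as H.
  change (Re (z - w)%C) with (Re z - Re w) in H. change (Im (z - w)%C) with (Im z - Im w) in H.
  lra.
Qed.

(** * Separated points in an annulus *)

(* The centre [y0] is the imaginary part of [u / Cconj a], the rotated pole. *)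
Lemma mob_denom_ge_Im (a u : C) : Cmod u = 1 -> exists y0 : R, forall z : C, Cmod a < 1 ->
  Cmod z <= 1 -> Rabs (Im (u * z)%C - y0) <= 2 * Cmod (1 - Cconj a * z)%C.
Proof.
  intros Hu. destruct (Rle_lt_dec (1 / 2) (Cmod a)) as [Ha|Ha].
  - assert (Ha0 : Cconj a <> 0%C) by (apply Cmod_gt_0; rewrite Cmod_conj; lra).
    exists (Im (u * / Cconj a)%C). intros z _ _.
    replace (1 - Cconj a * z)%C with (Cconj a * (/ Cconj a - z))%C by (field; easy).
    rewrite Cmod_mult, Cmod_conj.
    apply Rle_trans with (Cmod (u * z - u * / Cconj a)%C).
    + apply (im_le_Cmod (u * z - u * / Cconj a)%C).
    + replace (u * z - u * / Cconj a)%C with (u * - (/ Cconj a - z))%C by ring.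
      rewrite Cmod_mult, Cmod_opp, Hu. pose proof (Cmod_ge_0 (/ Cconj a - z)%C). nra.
  - exists 0. intros z _ Hz. rewrite Rminus_0_r.
    pose proof (im_le_Cmod (u * z)%C) as H1. rewrite Cmod_mult, Hu in H1.
    pose proof (Cmod_mob_denom a z) as H2. pose proof (Cmod_ge_0 a). nra.
Qed.

Definition near_circle (t : R) (z : C) : Prop := t / 2 < 1 - Cmod z <= t.

(** Obtained from [mob_ker] by replacing 1 - |a|^2 with 1 - |z|^2. It is also the modulus of the
    squared kernel in [interp], so one estimate serves both the interpolant and the local masses. *)
Definition square_ker (a z : C) : R := (1 - Cmod z ^ 2) ^ 2 / Cmod (1 - Cconj a * z)%C ^ 2.

Lemma square_ker_pos (a z : C) : 0 <= square_ker a z.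
Proof.
  unfold square_ker, Rdiv. apply Rmult_le_pos; [apply pow2_ge_0|].
  rewrite <- pow_inv. apply pow2_ge_0.
Qed.

(** The denominator D is at least t / 2 and |y - y0| / 2, so D^2 >= (t^2 + (y - y0)^2) / 8. Rounding
    y / (eta t) to the integer [m] costs a factor 3 and the numerator a factor 4, whence 96. *)
Lemma square_ker_le (a z : C) (t eta y0 y m : R) : 0 < eta <= 1 -> 0 < t ->
  near_circle t z -> Cmod a < 1 ->
  Rabs (y - y0) <= 2 * Cmod (1 - Cconj a * z)%C -> m <= y / (eta * t) < m + 1 ->
  square_ker a z <= 96 / eta ^ 2 * / (1 + (m - y0 / (eta * t)) ^ 2).
Proof.
  intros Heta Ht [Hz1 Hz2] Ha Hy Hm.
  pose proof (Cmod_ge_0 z) as Hz0. pose proof (Cmod_ge_0 a) as Ha0.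
  set (D := Cmod (1 - Cconj a * z)%C) in *.
  assert (HD : t / 2 <= D).
  { pose proof (Cmod_mob_denom a z). unfold D. nra. }
  set (x := (y - y0) / (eta * t)).
  assert (Ex : y - y0 = x * (eta * t)) by (unfold x; field; lra).
  assert (HD2 : (t ^ 2 + (y - y0) ^ 2) / 8 <= D ^ 2).
  { rewrite <- (pow2_abs (y - y0)). pose proof (Rabs_pos (y - y0)). nra. }
  assert (Hx : 1 + (m - y0 / (eta * t)) ^ 2 <= 3 * (1 + x ^ 2)).
  { set (v := y / (eta * t)) in *.
    replace x with (v - y0 / (eta * t)) by (unfold x, v; field; lra).
    generalize (y0 / (eta * t)). intros s.
    assert (H1 : 0 <= (v - s + (v - m)) ^ 2) by apply pow2_ge_0.
    assert (H2 : (v - m) ^ 2 <= 1) by (rewrite <- (pow1 2); apply pow_incr; lra).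
    nra. }
  assert (Ht2 : 0 < t ^ 2) by nra. assert (He2 : 0 < eta ^ 2 <= 1) by nra.
  assert (Hlow : t ^ 2 * eta ^ 2 * (1 + (m - y0 / (eta * t)) ^ 2) <= 24 * D ^ 2).
  { set (W := (m - y0 / (eta * t)) ^ 2) in *.
    apply Rle_trans with (t ^ 2 * eta ^ 2 * (3 * (1 + x ^ 2))).
    - apply Rmult_le_compat_l; [|exact Hx]. nra.
    - rewrite Ex in HD2. replace ((x * (eta * t)) ^ 2) with (x ^ 2 * eta ^ 2 * t ^ 2) in HD2 by ring.
      assert (eta ^ 2 * t ^ 2 <= t ^ 2) by nra.
      replace (t ^ 2 * eta ^ 2 * (3 * (1 + x ^ 2))) with (3 * (eta ^ 2 * t ^ 2) + 3 * (x ^ 2 * eta ^ 2 * t ^ 2)) by ring. lra. }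
  assert (Hnum : (1 - Cmod z ^ 2) ^ 2 <= 4 * t ^ 2).
  { assert (0 <= 1 - Cmod z ^ 2 <= 2 * t) by (split; nra). nra. }
  set (W := 1 + (m - y0 / (eta * t)) ^ 2) in *.
  assert (HW : 0 < W) by (unfold W; pose proof (pow2_ge_0 (m - y0 / (eta * t))); lra).
  unfold square_ker. fold D. apply Rle_div_l; [nra|].
  replace (96 / eta ^ 2 * / W * D ^ 2) with (4 * (24 * D ^ 2) / (eta ^ 2 * W)) by (field; split; nra).
  apply (Rle_div_r _ _ (eta ^ 2 * W)); [nra|].
  apply Rle_trans with (4 * t ^ 2 * (eta ^ 2 * W)).
  2:{ replace (4 * t ^ 2 * (eta ^ 2 * W)) with (4 * (t ^ 2 * eta ^ 2 * W)) by ring. lra. }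
  apply Rmult_le_compat_r; [nra|easy].
Qed.

Definition pairwise_separated (delta : R) (l : list C) : Prop :=
  forall z w, In z l -> In w l -> z <> w -> delta <= Cmod (mob z w).

Lemma Int_part_bounds (x : R) : IZR (Int_part x) <= x < IZR (Int_part x) + 1.
Proof. pose proof (base_Int_part x). lra. Qed.

(** Within one sector and one radial cell, the cells of the imaginary part are distinct: two points
    in the same cell have |z - w| <= 4 (delta / 8) t, while |1 - conj(z) w| > t / 2, against
    separation. The sum is thus dominated by a sum over distinct integers, at most 8, and 768 = 96 *
    8. *)
Lemma square_ker_cell_sum (delta t : R) (a u : C) (r : Z) (l : list C) :
  0 < delta <= 1 -> 0 < t -> Cmod a < 1 -> Cmod u = 1 -> NoDup l ->
  pairwise_separated delta l ->
  (forall z, In z l -> near_circle t z /\ Rabs (Im (u * z)%C) <= Re (u * z)%C /\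
     Int_part ((1 - Cmod z) / (delta / 8 * t)) = r) ->
  lsum (square_ker a) l <= 768 / (delta / 8) ^ 2.
Proof.
  intros Hdelta Ht Ha Hu Hnd Hsep Hl.
  destruct (mob_denom_ge_Im a u Hu) as [y0 Hy0].
  set (eta := delta / 8) in *. assert (Heta : 0 < eta <= 1) by (unfold eta; lra).
  set (m := fun z => Int_part (Im (u * z)%C / (eta * t))).
  set (s := y0 / (eta * t)).
  apply Rle_trans with (lsum (fun z => 96 / eta ^ 2 * / (1 + (IZR (m z) - s) ^ 2)) l).
  { apply lsum_le. intros z Hz. destruct (Hl z Hz) as ([H1 H2] & _ & _).
    apply (square_ker_le a z t eta y0 (Im (u * z)%C)); auto.
    - now split.
    - apply Hy0; [easy|lra].
    - apply Int_part_bounds. }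
  rewrite lsum_scal, <- (lsum_map (fun k => / (1 + (IZR k - s) ^ 2)) m).
  replace (768 / eta ^ 2) with (96 / eta ^ 2 * 8) by (field; lra).
  apply Rmult_le_compat_l.
  { apply Rlt_le, Rdiv_lt_0_compat; [lra|]. apply pow_lt; lra. }
  apply lsum_inv_1_sqr, NoDup_map_NoDup_ForallPairs; [|easy].
  intros z w Hz Hw Em.
  destruct (Hl z Hz) as ([Hz1 Hz2] & Sz & Rz). destruct (Hl w Hw) as ([Hw1 Hw2] & Sw & Rw).
  apply NNPP. intros Hne. specialize (Hsep z w Hz Hw Hne).
  assert (Hh : 0 < eta * t) by nra.
  assert (Hcell : forall p q, Int_part (p / (eta * t)) = Int_part (q / (eta * t)) ->
    Rabs (p - q) <= eta * t).
  { intros p q E. pose proof (Int_part_bounds (p / (eta * t))) as B1.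
    pose proof (Int_part_bounds (q / (eta * t))) as B2. rewrite E in B1.
    replace (p - q) with ((p / (eta * t) - q / (eta * t)) * (eta * t)) by (field; lra).
    rewrite Rabs_mult, (Rabs_pos_eq (eta * t)) by lra.
    apply Rle_trans with (1 * (eta * t)); [|lra]. apply Rmult_le_compat_r; [lra|].
    apply Rabs_le_between. lra. }
  assert (Hclose : Cmod (u * z - u * w)%C <= 4 * (eta * t)).
  { apply sector_close; try lra.
    - now apply Hcell.
    - rewrite !Cmod_mult, Hu.
      assert (H := Hcell (1 - Cmod z) (1 - Cmod w) ltac:(congruence)).
      rewrite <- Rabs_Ropp. replace (- (1 * Cmod z - 1 * Cmod w)) with (1 - Cmod z - (1 - Cmod w)) by ring.
      exact H. }
  replace (u * z - u * w)%C with (u * (z - w))%C in Hclose by ring.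
  rewrite Cmod_mult, Hu, Rmult_1_l in Hclose.
  pose proof (Cmod_mob_denom_ge z w ltac:(lra) ltac:(lra)) as HD.
  unfold mob in Hsep. rewrite Cmod_div in Hsep by (apply mob_denom_neq_0; lra).
  rewrite Cmod_sub_sym in Hsep. apply Rle_div_r in Hsep; [|lra].
  unfold eta in Hclose. nra.
Qed.

(** The four sectors between the diagonals; [sector_rotation] turns each into the one of
    [sector_close]. *)
Definition sector (z : C) : nat :=
  if Rle_dec (Rabs (Im z)) (Re z) then 0%nat
  else if Rle_dec (Rabs (Re z)) (Im z) then 1%nat
  else if Rle_dec (Rabs (Im z)) (- Re z) then 2%nat
  else 3%nat.

Lemma sector_rotation (k : nat) : exists u : C, Cmod u = 1 /\
  forall z, sector z = k -> Rabs (Im (u * z)%C) <= Re (u * z)%C.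
Proof.
  unfold sector.
  destruct k as [|[|[|k]]].
  - exists 1%C. split; [apply Cmod_1|]. intros z. rewrite Cmult_1_l.
    repeat destruct (Rle_dec _ _); easy.
  - exists (- Ci)%C. split; [rewrite Cmod_opp; apply Cmod_Ci|]. intros z.
    replace (Im (- Ci * z)%C) with (- Re z) by (unfold Re, Im; simpl; ring).
    replace (Re (- Ci * z)%C) with (Im z) by (unfold Re, Im; simpl; ring).
    rewrite Rabs_Ropp. repeat destruct (Rle_dec _ _); easy.
  - exists (- (1))%C. split; [rewrite Cmod_opp; apply Cmod_1|]. intros z.
    replace (Im (- (1) * z)%C) with (- Im z) by (unfold Re, Im; simpl; ring).
    replace (Re (- (1) * z)%C) with (- Re z) by (unfold Re, Im; simpl; ring).
    rewrite Rabs_Ropp. repeat destruct (Rle_dec _ _); easy.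
  - exists Ci. split; [apply Cmod_Ci|]. intros z.
    replace (Im (Ci * z)%C) with (Re z) by (unfold Re, Im; simpl; ring).
    replace (Re (Ci * z)%C) with (- Im z) by (unfold Re, Im; simpl; ring).
    repeat destruct (Rle_dec _ _); try easy. intros _. revert n n0 n1.
    unfold Rabs. repeat destruct (Rcase_abs _); lra.
Qed.

Lemma filter_sublist {A : Type} (p : A -> bool) (l : list A) (a : A) :
  In a (filter p l) -> In a l.
Proof. intros H. now apply filter_In in H. Qed.

(** Four sectors times [N] radial cells, with [N] just a natural number above 8 / delta: the cells
    scale with [t], so their number depends on neither [t] nor [a]. *)
Lemma square_ker_sum (delta : R) : 0 < delta <= 1 -> exists K : R, 0 < K /\
  forall (t : R) (a : C) (l : list C), 0 < t -> Cmod a < 1 -> NoDup l ->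
  pairwise_separated delta l -> (forall z, In z l -> near_circle t z) ->
  lsum (square_ker a) l <= K.
Proof.
  intros Hdelta. set (eta := delta / 8).
  destruct (INR_unbounded (/ eta)) as [N HN].
  assert (HN0 : 0 < INR N).
  { eapply Rlt_trans; [|exact HN]. apply Rinv_0_lt_compat. unfold eta; lra. }
  assert (Hc : 0 < 768 / (delta / 8) ^ 2).
  { apply Rdiv_lt_0_compat; [lra|]. apply pow_lt; lra. }
  exists (4 * (INR N * (768 / (delta / 8) ^ 2))). split; [nra|].
  intros t a l Ht Ha Hnd Hsep Hl.
  rewrite (lsum_fibers _ sector 4).
  2:{ intros z _. unfold sector. repeat destruct (Rle_dec _ _); lia. }
  apply Rle_trans with (lsum (fun _ => INR N * (768 / (delta / 8) ^ 2)) (seq 0 4)).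
  2:{ rewrite lsum_const, length_seq. simpl INR. right. ring. }
  apply lsum_le. intros k _. destruct (sector_rotation k) as (u & Hu & Hk).
  set (l1 := filter _ l).
  set (code := fun z : C => Z.to_nat (Int_part ((1 - Cmod z) / (eta * t)))).
  assert (Hpos : forall z, In z l -> 0 <= (1 - Cmod z) / (eta * t) <= / eta).
  { intros z Hz. destruct (Hl z Hz). unfold eta. split.
    - apply Rdiv_le_0_compat; nra.
    - apply Rle_div_l; [nra|]. replace (/ (delta / 8) * (delta / 8 * t)) with t by (field; lra). lra. }
  assert (Hint : forall z, In z l -> (0 <= Int_part ((1 - Cmod z) / (eta * t)))%Z).
  { intros z Hz. specialize (Hpos z Hz). pose proof (Int_part_bounds ((1 - Cmod z) / (eta * t))).
    assert (H1 : IZR (-1) < IZR (Int_part ((1 - Cmod z) / (eta * t)))) by (simpl; lra).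
    apply lt_IZR in H1. lia. }
  rewrite (lsum_fibers _ code N).
  2:{ intros z Hz. apply filter_sublist in Hz. specialize (Hint z Hz). specialize (Hpos z Hz).
      pose proof (Int_part_bounds ((1 - Cmod z) / (eta * t))).
      assert (H1 : IZR (Int_part ((1 - Cmod z) / (eta * t))) < IZR (Z.of_nat N)).
      { rewrite <- INR_IZR_INZ. lra. }
      apply lt_IZR in H1. unfold code. lia. }
  apply Rle_trans with (lsum (fun _ => 768 / (delta / 8) ^ 2) (seq 0 N)).
  2:{ rewrite lsum_const, length_seq. lra. }
  apply lsum_le. intros i _.
  apply (square_ker_cell_sum delta t a u (Z.of_nat i)); auto.
  - now apply NoDup_filter, NoDup_filter.
  - intros z w Hz Hw. apply filter_sublist, filter_sublist in Hz, Hw. now apply Hsep.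
  - intros z Hz. apply filter_In in Hz. destruct Hz as [Hz Hi].
    apply filter_In in Hz. destruct Hz as [Hz Hs].
    apply Nat.eqb_eq in Hi, Hs. repeat split; try (now apply Hl); [now apply Hk|].
    specialize (Hint z Hz). unfold code in Hi. change (delta / 8) with eta. lia.
Qed.

(** * Small values of a bounded function *)

Definition csum {A : Type} (F : A -> C) (l : list A) : C :=
  fold_right (fun a s => (F a + s)%C) 0%C l.

Lemma Cmod_csum {A : Type} (F : A -> C) (l : list A) :
  Cmod (csum F l) <= lsum (fun a => Cmod (F a)) l.
Proof.
  induction l as [|a l IH]; simpl.
  - rewrite Cmod_0. lra.
  - eapply Rle_trans; [apply Cmod_triangle|]. lra.
Qed.

Lemma csum_zero {A : Type} (F : A -> C) (l : list A) :
  (forall b, In b l -> F b = 0%C) -> csum F l = 0%C.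
Proof.
  induction l as [|a l IH]; simpl; intros H; [easy|].
  rewrite H, IH; auto. ring.
Qed.

Lemma csum_single {A : Type} (F : A -> C) (l : list A) (a : A) :
  NoDup l -> In a l -> (forall b, In b l -> b <> a -> F b = 0%C) -> csum F l = F a.
Proof.
  induction l as [|b l IH]; intros Hnd Ha H; [easy|].
  inversion Hnd as [|? ? Hnb Hnd']; subst. simpl. destruct Ha as [->|Ha].
  - rewrite csum_zero; [ring|]. intros c Hc. apply H; [now right|]. congruence.
  - rewrite IH; auto.
    + rewrite (H b); [ring|now left|congruence].
    + intros c Hc. apply H. now right.
Qed.

Lemma cdiff_csum {A : Type} (F : A -> C -> C) (l : list A) (z : C) :
  (forall a, In a l -> cdiff (F a) z) -> cdiff (fun x => csum (fun a => F a x) l) z.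
Proof.
  induction l as [|a l IH]; intros H.
  - apply (cdiff_const 0 z).
  - apply (cdiff_plus (F a) (fun x => csum (fun a => F a x) l)); [apply H; now left|].
    apply IH. intros b Hb. apply H. now right.
Qed.

(** Factor by factor: with |mob a z|^2 = 1 - k >= delta^2, one has 1 / (1 - k) = 1 + k / (1 - k) <=
    1 + k / delta^2 <= exp(k / delta^2). *)
Lemma blaschke_prod_lower (delta : R) (l : list C) (z : C) : 0 < delta -> Cmod z < 1 ->
  (forall a, In a l -> Cmod a < 1 /\ delta <= Cmod (mob a z)) ->
  exp (- (lsum (fun a => mob_ker a z) l / delta ^ 2)) <= Cmod (blaschke_prod l z) ^ 2.
Proof.
  intros Hd Hz. assert (Hd2 : 0 < delta ^ 2) by now apply pow_lt.
  induction l as [|a l IH]; intros H; simpl lsum; simpl blaschke_prod.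
  - rewrite Cmod_1. unfold Rdiv. rewrite Rmult_0_l, Ropp_0, exp_0. simpl. lra.
  - destruct (H a (or_introl eq_refl)) as [Ha Hda].
    rewrite Cmod_mult, Rpow_mult_distr.
    replace (- ((mob_ker a z + lsum (fun a => mob_ker a z) l) / delta ^ 2)) with
      (- (mob_ker a z / delta ^ 2) + - (lsum (fun a => mob_ker a z) l / delta ^ 2)) by (field; lra).
    rewrite exp_plus. apply Rmult_le_compat; try (apply Rlt_le, exp_pos).
    2:{ apply IH. intros b Hb. apply H. now right. }
    pose proof (Cmod_mob_sqr a z Ha ltac:(lra)) as E.
    pose proof (mob_ker_bound a z Ha Hz) as Hk.
    assert (Hge : delta ^ 2 <= Cmod (mob a z) ^ 2) by (apply pow_incr; lra).
    rewrite E in Hge |- *. set (k := mob_ker a z) in *.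
    rewrite exp_Ropp. apply Rle_trans with (/ (/ (1 - k))); [|rewrite Rinv_inv; lra].
    apply Rinv_le_contravar; [apply Rinv_0_lt_compat; lra|].
    pose proof (exp_ineq1_le (k / delta ^ 2)).
    apply Rle_trans with (1 + k / delta ^ 2); [|lra].
    replace (/ (1 - k)) with (1 + k / (1 - k)) by (field; lra).
    apply Rplus_le_compat_l, Rmult_le_compat_l; [lra|].
    apply Rinv_le_contravar; lra.
Qed.

Lemma blaschke_prod_upper (l : list C) (z : C) : Cmod z < 1 ->
  (forall a, In a l -> Cmod a < 1) ->
  Cmod (blaschke_prod l z) ^ 2 <= exp (- lsum (fun a => mob_ker a z) l).
Proof.
  intros Hz. induction l as [|a l IH]; intros H; simpl lsum; simpl blaschke_prod.
  - rewrite Cmod_1, Ropp_0, exp_0. simpl. lra.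
  - pose proof (H a (or_introl eq_refl)) as Ha.
    rewrite Cmod_mult, Rpow_mult_distr, Ropp_plus_distr, exp_plus.
    apply Rmult_le_compat; try apply pow2_ge_0.
    + rewrite Cmod_mob_sqr by lra. pose proof (exp_ineq1_le (- mob_ker a z)). lra.
    + apply IH. intros b Hb. apply H. now right.
Qed.

(** The denominator is at most 4. Through this, a bound for the mass seen from one fixed point [z]
    becomes a bound for the sum of the 1 - |a|. *)
Lemma mob_ker_lower (a z : C) : Cmod a < 1 -> Cmod z < 1 ->
  (1 - Cmod a) * ((1 - Cmod z ^ 2) / 4) <= mob_ker a z.
Proof.
  intros Ha Hz. unfold mob_ker. pose proof (Cmod_ge_0 a). pose proof (Cmod_ge_0 z).
  pose proof (Cmod_mob_denom_ge a z Ha ltac:(lra)) as H1.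
  pose proof (Cmod_mob_denom_le a z) as H2.
  set (D := Cmod (1 - Cconj a * z)%C) in *.
  assert (HD : 0 < D ^ 2 <= 4) by (split; [apply pow_lt; lra|]; assert (D <= 2) by nra; nra).
  replace ((1 - Cmod a) * ((1 - Cmod z ^ 2) / 4)) with ((1 - Cmod a) * (1 - Cmod z ^ 2) * / 4) by field.
  apply Rmult_le_compat.
  - apply Rmult_le_pos; nra.
  - lra.
  - apply Rmult_le_compat_r; nra.
  - apply Rinv_le_contravar; lra.
Qed.

(** * Interpolation by Blaschke products *)

Definition eqb_C (a b : C) : bool := if excluded_middle_informative (a = b) then true else false.

Definition others (l : list C) (a : C) : list C := filter (fun b => negb (eqb_C b a)) l.

Lemma in_others (l : list C) (a b : C) : In b (others l a) <-> In b l /\ b <> a.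
Proof.
  unfold others. rewrite filter_In. unfold eqb_C.
  destruct (excluded_middle_informative (b = a)); simpl; intuition congruence.
Qed.

(* Lagrange interpolation by Blaschke products; the squared kernels, equal to 1 at the nodes,
   keep the sum bounded on the disc. *)
Definition interp (l : list C) (f : C -> C) (z : C) : C :=
  csum (fun a => f a / blaschke_prod (others l a) a * blaschke_prod (others l a) z *
    ((1 - Cconj a * a) / (1 - Cconj a * z) * ((1 - Cconj a * a) / (1 - Cconj a * z))))%C l.

Section Interpolation.
Variables (l : list C) (f : C -> C).
Hypothesis Hnd : NoDup l.
Hypothesis Hdisc : forall a, In a l -> Cmod a < 1.

Let Hothers (a b : C) : In b (others l a) -> Cmod b < 1.
Proof. intros H. apply in_others in H. now apply Hdisc. Qed.

Let others_neq_0 (a : C) : In a l -> blaschke_prod (others l a) a <> 0%C.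
Proof.
  intros Ha. apply blaschke_prod_neq_0.
  - apply Hothers.
  - now apply Rlt_le, Hdisc.
  - intros H. now apply in_others in H.
Qed.

Lemma blaschke_prod_zero (m : list C) (a : C) : In a m -> blaschke_prod m a = 0%C.
Proof.
  intros H. induction m as [|b m IH]; simpl; [easy|]. destruct H as [->|H].
  - unfold mob. replace (a - a)%C with (RtoC 0) by ring. unfold Cdiv. ring.
  - rewrite IH by easy. ring.
Qed.

Lemma interp_eq (a : C) : In a l -> interp l f a = f a.
Proof.
  intros Ha. unfold interp. rewrite (csum_single _ l a Hnd Ha).
  - pose proof (others_neq_0 a Ha).
    pose proof (mob_denom_neq_0 a a (Hdisc a Ha) (Rlt_le _ _ (Hdisc a Ha))).
    field. auto.
  - intros b Hb Hne. rewrite (blaschke_prod_zero (others l b) a); [ring|].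
    apply in_others. auto.
Qed.

Lemma interp_cdiff (z : C) : Cmod z < 1 -> cdiff (interp l f) z.
Proof.
  intros Hz.
  apply (cdiff_csum (fun a z => f a / blaschke_prod (others l a) a * blaschke_prod (others l a) z *
    ((1 - Cconj a * a) / (1 - Cconj a * z) * ((1 - Cconj a * a) / (1 - Cconj a * z))))%C).
  intros a Ha. apply cdiff_mult.
  - apply cdiff_mult; [apply cdiff_const|]. apply blaschke_prod_cdiff; [apply Hothers|lra].
  - assert (H : cdiff (fun x => (1 - Cconj a * a) / (1 - Cconj a * x))%C z).
    { apply cdiff_div; [apply cdiff_const| |].
      - apply cdiff_minus; [apply cdiff_const|].
        apply cdiff_mult; [apply cdiff_const|apply cdiff_id].
      - apply mob_denom_neq_0; [now apply Hdisc|lra]. }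
    now apply cdiff_mult.
Qed.

Lemma blaschke_prod_le_1 (m : list C) (z : C) : Cmod z < 1 ->
  (forall a, In a m -> Cmod a < 1) -> Cmod (blaschke_prod m z) <= 1.
Proof.
  intros Hz Hm. induction m as [|a m IH]; simpl.
  - rewrite Cmod_1. lra.
  - rewrite Cmod_mult.
    pose proof (Cmod_mob_le_1 a z (Hm a (or_introl eq_refl)) Hz).
    specialize (IH (fun b Hb => Hm b (or_intror Hb))).
    pose proof (Cmod_ge_0 (mob a z)). pose proof (Cmod_ge_0 (blaschke_prod m z)). nra.
Qed.

(** The coefficient at [a] is at most [q a], the Blaschke product at most 1, and the squared kernel
    has modulus [square_ker z a]: the evaluation point takes the place of the pole in the separated
    sums. *)
Lemma interp_bound (q : C -> R) (z : C) : Cmod z < 1 ->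
  (forall a, In a l -> Cmod (f a) <= q a * Cmod (blaschke_prod (others l a) a)) ->
  Cmod (interp l f z) <= lsum (fun a => q a * square_ker z a) l.
Proof.
  intros Hz Hq. unfold interp. eapply Rle_trans; [apply Cmod_csum|].
  apply lsum_le. intros a Ha. pose proof (Hdisc a Ha) as Ha1.
  pose proof (mob_denom_neq_0 a z Ha1 ltac:(lra)) as Hn.
  pose proof (proj1 (Cmod_gt_0 _) (others_neq_0 a Ha)) as HB.
  rewrite !Cmod_mult, !Cmod_div by auto.
  assert (Ek : Cmod (1 - Cconj a * a)%C / Cmod (1 - Cconj a * z)%C *
    (Cmod (1 - Cconj a * a)%C / Cmod (1 - Cconj a * z)%C) = square_ker z a).
  { unfold square_ker. rewrite (mob_denom_sym z a).
    replace (Cmod (1 - Cconj a * a)%C) with (1 - Cmod a ^ 2).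
    - apply Cmod_gt_0 in Hn. field. lra.
    - rewrite Cmult_comm, <- Cmod2_conj, <- RtoC_minus, Cmod_R, Rabs_pos_eq; [easy|].
      pose proof (Cmod_ge_0 a). nra. }
  rewrite Ek. apply Rmult_le_compat_r; [apply square_ker_pos|].
  specialize (Hq a Ha).
  assert (H1 : Cmod (f a) / Cmod (blaschke_prod (others l a) a) <= q a) by (apply Rle_div_l; lra).
  assert (H0 : 0 <= Cmod (f a) / Cmod (blaschke_prod (others l a) a)).
  { apply Rdiv_le_0_compat; [apply Cmod_ge_0|easy]. }
  pose proof (blaschke_prod_le_1 (others l a) z Hz (Hothers a)).
  pose proof (Cmod_ge_0 (blaschke_prod (others l a) z)). nra.
Qed.
End Interpolation.

Lemma NoDup_others (l : list C) (a : C) : NoDup l -> NoDup (others l a).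
Proof. apply NoDup_filter. Qed.

Section SmallValues.
Variables (f : C -> C) (M delta sigma : R) (w : C) (theta : C -> R).
Hypothesis Hf : forall z, Cmod z < 1 -> cdiff f z.
Hypothesis HM : forall z, Cmod z < 1 -> Cmod (f z) <= M.
Hypothesis Hw : Cmod w < 1.
Hypothesis Hfw : f w <> 0%C.
Hypothesis Hdelta : 0 < delta.
(** The first bound leaves at most half of the mass to the points of large local mass; the second
    keeps the interpolant below [Cmod (f w) / 2]. *)
Hypothesis Hsigma1 : sigma <= delta ^ 2 / 4.
Hypothesis Hsigma2 : sigma <= Cmod (f w) / 4.

Let ker_sum (l : list C) (z : C) : R := lsum (fun a => mob_ker a z) l.

(* If the local masses [ker_sum l] are dominated by [theta], Lagrange interpolation of
   the small values of [f] on [l] costs little, and subtracting the interpolant turns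
   the points of [l] into zeros. *)
Lemma small_values_sparse (l : list C) :
  NoDup l -> pairwise_separated delta l ->
  (forall a, In a l -> Cmod a < 1 /\ 0 < theta a /\ Cmod (f a) <= exp (- theta a) /\
     ker_sum l a <= delta ^ 2 * theta a) ->
  (forall z, Cmod z < 1 -> lsum (fun a => square_ker z a / theta a) l <= sigma) ->
  lsum (fun a => 1 - Cmod a) l <=
    4 / (1 - Cmod w ^ 2) * ln (256 * M ^ 4 / Cmod (f w) ^ 4).
Proof.
  intros Hnd Hsep Hl Hs.
  assert (Hdisc : forall a, In a l -> Cmod a < 1) by (intros a Ha; now apply Hl).
  (* Half of the decay of [f a] pays for the Blaschke product of the other nodes, which is at least
     exp(-theta a / 2) at [a]; the other half is at most 2 / theta a. *)
  assert (Hlow : forall a, In a l ->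
    Cmod (f a) <= 2 / theta a * Cmod (blaschke_prod (others l a) a)).
  { intros a Ha. destruct (Hl a Ha) as (Ha1 & Hth & Hfa & Hka).
    assert (H1 : exp (- theta a) <= Cmod (blaschke_prod (others l a) a) ^ 2).
    { eapply Rle_trans; [|apply (blaschke_prod_lower delta (others l a) a Hdelta Ha1)].
      - apply exp_le_compat, Ropp_le_contravar. apply Rle_div_l; [now apply pow_lt|].
        apply Rle_trans with (ker_sum l a); [|lra].
        apply lsum_incl; [now apply NoDup_others| |].
        + intros b Hb. now apply in_others in Hb.
        + intros b Hb. apply Rlt_le, mob_ker_bound; auto.
      - intros b Hb. apply in_others in Hb. destruct Hb as [Hb Hne]. auto. }
    assert (H2 : exp (- theta a / 2) <= Cmod (blaschke_prod (others l a) a)).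
    { apply Rsqr_incr_0_var; [|apply Cmod_ge_0]. unfold Rsqr. rewrite <- exp_plus.
      replace (- theta a / 2 + - theta a / 2) with (- theta a) by field.
      eapply Rle_trans; [exact H1|]. right. ring. }
    assert (H3 : exp (- theta a / 2) <= 2 / theta a).
    { replace (- theta a / 2) with (- (theta a / 2)) by field.
      rewrite exp_Ropp. replace (2 / theta a) with (/ (theta a / 2)) by (field; lra).
      apply Rinv_le_contravar; [lra|]. pose proof (exp_ineq1_le (theta a / 2)). lra. }
    eapply Rle_trans; [exact Hfa|].
    replace (- theta a) with (- theta a / 2 + - theta a / 2) by field. rewrite exp_plus.
    apply Rmult_le_compat; auto; apply Rlt_le, exp_pos. }
  set (g := interp l f).
  assert (Hg : forall z, Cmod z < 1 -> Cmod (g z) <= Cmod (f w) / 2).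
  { intros z Hz. eapply Rle_trans.
    - apply (interp_bound l f Hdisc (fun a => 2 / theta a) z Hz Hlow).
    - rewrite (lsum_ext _ (fun a => 2 * (square_ker z a / theta a))).
      + rewrite lsum_scal. specialize (Hs z Hz). lra.
      + intros a _. unfold Rdiv. ring. }
  pose proof (proj1 (Cmod_gt_0 _) Hfw) as HA. set (A := Cmod (f w)) in *.
  assert (HAM : A <= M) by now apply HM.
  pose proof (blaschke_bound (fun z => f z - g z)%C l (2 * M) Hnd Hdisc) as HB.
  specialize (HB ltac:(intros z Hz; apply cdiff_minus; [auto|now apply interp_cdiff])).
  assert (HB1 : forall z, Cmod z < 1 -> Cmod (f z - g z)%C <= 2 * M).
  { intros z Hz. eapply Rle_trans; [apply Cmod_triang_sub|].
    specialize (HM z Hz). specialize (Hg z Hz). lra. }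
  specialize (HB HB1).
  specialize (HB ltac:(intros a Ha; unfold g; rewrite interp_eq by easy; ring) w Hw).
  assert (Hhw : A / 2 <= Cmod (f w - g w)%C).
  { pose proof (Cmod_sub_ge (f w) (g w)). specialize (Hg w Hw). fold A in H. lra. }
  pose proof (blaschke_prod_upper l w Hw Hdisc) as Hup.
  set (B := Cmod (blaschke_prod l w)) in *.
  assert (HB0 : 0 <= B) by apply Cmod_ge_0.
  (* [blaschke_bound] for f - g, bounded by 2 M and at least A / 2 at [w], gives A^2 <= 16 M^2 B; it
     is squared because [blaschke_prod_upper] concerns B^2. *)
  assert (H4 : A ^ 4 <= 256 * M ^ 4 * B ^ 2).
  { assert (H2 : A ^ 2 <= 16 * (M ^ 2 * B)).
    { assert ((A / 2) ^ 2 <= Cmod (f w - g w)%C ^ 2) by (apply pow_incr; lra). nra. }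
    replace (A ^ 4) with ((A ^ 2) ^ 2) by ring.
    replace (256 * M ^ 4 * B ^ 2) with ((16 * (M ^ 2 * B)) ^ 2) by ring.
    apply pow_incr. split; [apply pow2_ge_0|easy]. }
  set (S := lsum (fun a => mob_ker a w) l) in *.
  assert (HM4 : 0 < M ^ 4) by (apply pow_lt; lra).
  assert (HA4 : 0 < A ^ 4) by (apply pow_lt; lra).
  assert (HS : S <= ln (256 * M ^ 4 / A ^ 4)).
  { rewrite <- (ln_exp S). apply ln_le; [apply exp_pos|].
    apply Rle_div_r; [easy|].
    replace (256 * M ^ 4) with (256 * M ^ 4 * (exp (- S) * exp S)).
    - pose proof (exp_pos S).
      assert (H5 : A ^ 4 <= 256 * M ^ 4 * exp (- S)).
      { eapply Rle_trans; [exact H4|]. apply Rmult_le_compat_l; lra. }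
      rewrite <- Rmult_assoc, Rmult_comm. apply Rmult_le_compat_r; lra.
    - rewrite <- exp_plus, Rplus_opp_l, exp_0. ring. }
  assert (Hwsq : 0 < 1 - Cmod w ^ 2) by (pose proof (Cmod_ge_0 w); nra).
  apply Rle_trans with (4 / (1 - Cmod w ^ 2) * S).
  - unfold S. rewrite <- lsum_scal. apply lsum_le. intros a Ha.
    pose proof (mob_ker_lower a w (Hdisc a Ha) Hw).
    replace (1 - Cmod a) with (4 / (1 - Cmod w ^ 2) * ((1 - Cmod a) * ((1 - Cmod w ^ 2) / 4)))
      by (field; lra).
    apply Rmult_le_compat_l; [|easy]. apply Rlt_le, Rdiv_lt_0_compat; lra.
  - apply Rmult_le_compat_l; [|easy]. apply Rlt_le, Rdiv_lt_0_compat; lra.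
Qed.

(* By Fubini, the points of large local mass carry at most half of the total mass. *)
Lemma small_values_sum (l : list C) :
  NoDup l -> pairwise_separated delta l ->
  (forall a, In a l -> Cmod a < 1 /\ 0 < theta a /\ Cmod (f a) <= exp (- theta a)) ->
  (forall z, Cmod z < 1 -> lsum (fun a => square_ker z a / theta a) l <= sigma) ->
  lsum (fun a => 1 - Cmod a) l <=
    2 * (4 / (1 - Cmod w ^ 2) * ln (256 * M ^ 4 / Cmod (f w) ^ 4)).
Proof.
  intros Hnd Hsep Hl Hs. set (c := delta ^ 2) in *. assert (Hc : 0 < c) by now apply pow_lt.
  set (p := fun a => if Rle_dec (ker_sum l a) (c * theta a) then true else false).
  set (T := lsum (fun a => 1 - Cmod a) l).
  (* The weight moves from [b] to [a] by 1 - |a|^2 <= 2 (1 - |a|) and 1 - |b| <= 1 - |b|^2. *)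
  assert (Hterm : forall a b, In a l -> In b l ->
    0 <= (1 - Cmod b) * mob_ker a b / (c * theta b) <=
      2 / c * ((1 - Cmod a) * (square_ker a b / theta b))).
  { intros a b Ha Hb. destruct (Hl a Ha) as (Ha1 & _ & _). destruct (Hl b Hb) as (Hb1 & Htb & _).
    pose proof (mob_ker_bound a b Ha1 Hb1). pose proof (Cmod_ge_0 a). pose proof (Cmod_ge_0 b).
    split.
    { apply Rmult_le_pos; [apply Rmult_le_pos; lra|]. apply Rlt_le, Rinv_0_lt_compat. nra. }
    replace (2 / c * ((1 - Cmod a) * (square_ker a b / theta b))) with
      (2 * (1 - Cmod a) * square_ker a b / (c * theta b)) by (field; lra).
    apply Rmult_le_compat_r; [apply Rlt_le, Rinv_0_lt_compat; nra|].
    unfold mob_ker, square_ker, Rdiv.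
    pose proof (Cmod_mob_denom_ge a b Ha1 ltac:(lra)).
    set (D := / Cmod (1 - Cconj a * b)%C ^ 2).
    assert (HD : 0 < D) by (apply Rinv_0_lt_compat, pow_lt; lra).
    replace ((1 - Cmod b) * ((1 - Cmod a ^ 2) * (1 - Cmod b ^ 2) * D)) with
      ((1 - Cmod a ^ 2) * ((1 - Cmod b) * (1 - Cmod b ^ 2)) * D) by ring.
    replace (2 * (1 - Cmod a) * ((1 - Cmod b ^ 2) ^ 2 * D)) with
      (2 * (1 - Cmod a) * ((1 - Cmod b ^ 2) ^ 2) * D) by ring.
    apply Rmult_le_compat_r; [lra|].
    assert (0 <= 1 - Cmod b ^ 2) by nra. assert (0 <= 1 - Cmod a ^ 2) by nra.
    apply Rmult_le_compat; [lra|apply Rmult_le_pos; lra|nra|].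
    replace ((1 - Cmod b ^ 2) ^ 2) with ((1 - Cmod b ^ 2) * (1 - Cmod b ^ 2)) by ring.
    apply Rmult_le_compat_r; nra. }
  (* Chebyshev: where the local mass exceeds [c * theta b], the terms of [Hterm] summed over [a]
     exceed 1 - |b|. After the exchange each [a] is charged at most (2 / c) sigma <= 1/2 of its own
     1 - |a|. *)
  assert (Hheavy : lsum (fun a => 1 - Cmod a) (filter (fun a => negb (p a)) l) <= T / 2).
  { apply Rle_trans with
      (lsum (fun b => lsum (fun a => (1 - Cmod b) * mob_ker a b / (c * theta b)) l) l).
    - apply Rle_trans with
        (lsum (fun b => lsum (fun a => (1 - Cmod b) * mob_ker a b / (c * theta b)) l)
          (filter (fun a => negb (p a)) l)).
      + apply lsum_le. intros b Hb. apply filter_In in Hb. destruct Hb as [Hb Hpb].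
        destruct (Hl b Hb) as (Hb1 & Htb & _).
        rewrite (lsum_ext _ (fun a => (1 - Cmod b) / (c * theta b) * mob_ker a b)).
        2:{ intros a _. unfold Rdiv. ring. }
        rewrite lsum_scal. fold (ker_sum l b). unfold p in Hpb.
        destruct (Rle_dec (ker_sum l b) (c * theta b)) as [|Hgt]; [easy|].
        apply Rnot_le_lt in Hgt.
        replace (1 - Cmod b) with ((1 - Cmod b) / (c * theta b) * (c * theta b)) at 1 by (field; lra).
        apply Rmult_le_compat_l; [|lra]. apply Rdiv_le_0_compat; nra.
      + apply lsum_incl.
        * now apply NoDup_filter.
        * intros b Hb. now apply filter_In in Hb.
        * intros b Hb. apply lsum_pos. intros a Ha. now apply Hterm.
    - rewrite lsum_swap.
      apply Rle_trans with (lsum (fun a => 2 / c * sigma * (1 - Cmod a)) l).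
      + apply lsum_le. intros a Ha. destruct (Hl a Ha) as (Ha1 & _ & _).
        apply Rle_trans with (lsum (fun b => 2 / c * (1 - Cmod a) * (square_ker a b / theta b)) l).
        * apply lsum_le. intros b Hb. destruct (Hterm a b Ha Hb) as [_ H]. lra.
        * rewrite lsum_scal. specialize (Hs a Ha1).
          assert (0 <= 2 / c * (1 - Cmod a)).
          { apply Rmult_le_pos; [|lra]. apply Rlt_le, Rdiv_lt_0_compat; lra. }
          nra.
      + rewrite lsum_scal. fold T.
        assert (HT : 0 <= T). { apply lsum_pos. intros a Ha. destruct (Hl a Ha). lra. }
        assert (2 / c * sigma <= 1 / 2).
        { replace (1 / 2) with (2 / c * (c / 4)) by (field; lra).
          apply Rmult_le_compat_l; [|easy]. apply Rlt_le, Rdiv_lt_0_compat; lra. }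
        nra. }
  assert (Hlight := small_values_sparse (filter p l)).
  assert (ET : T = lsum (fun a => 1 - Cmod a) (filter p l) +
    lsum (fun a => 1 - Cmod a) (filter (fun a => negb (p a)) l)) by apply lsum_filter.
  enough (lsum (fun a => 1 - Cmod a) (filter p l) <=
    4 / (1 - Cmod w ^ 2) * ln (256 * M ^ 4 / Cmod (f w) ^ 4)) by lra.
  apply Hlight.
  - now apply NoDup_filter.
  - intros a b Ha Hb. apply filter_sublist in Ha, Hb. now apply Hsep.
  - intros a Ha. apply filter_In in Ha. destruct Ha as [Ha Hpa].
    destruct (Hl a Ha) as (H1 & H2 & H3). repeat split; auto.
    unfold p in Hpa. destruct (Rle_dec (ker_sum l a) (c * theta a)) as [Hle|]; [|easy].
    eapply Rle_trans; [|exact Hle]. apply lsum_incl.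
    + now apply NoDup_filter.
    + intros b Hb. now apply filter_sublist in Hb.
    + intros b Hb. apply Rlt_le, mob_ker_bound; [now apply Hl|easy].
  - intros z Hz. eapply Rle_trans; [|apply (Hs z Hz)]. apply lsum_incl.
    + now apply NoDup_filter.
    + intros b Hb. now apply filter_sublist in Hb.
    + intros b Hb. apply Rdiv_le_0_compat; [apply square_ker_pos|now apply Hl].
Qed.
End SmallValues.

(** * Necessity *)

Lemma lsum_sum_n (a : nat -> R) (N : nat) : lsum a (seq 0 (S N)) = sum_n a N.
Proof.
  induction N as [|N IH].
  - rewrite sum_O. simpl. ring.
  - rewrite seq_S, lsum_app, IH, sum_Sn. simpl. unfold plus; simpl. ring.
Qed.

Lemma ex_series_bounded (a : nat -> R) (B : R) :
  (forall n, 0 <= a n) -> (forall N, lsum a (seq 0 N) <= B) -> ex_series a.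
Proof.
  intros Ha HB.
  destruct (ex_finite_lim_seq_incr (sum_n a) B) as [s Hs].
  - intros n. rewrite sum_Sn. unfold plus; simpl. specialize (Ha (S n)). lra.
  - intros n. rewrite <- lsum_sum_n. apply HB.
  - now exists s.
Qed.

Lemma ex_series_lsum_bounded (a : nat -> R) :
  (forall n, 0 <= a n) -> ex_series a -> exists B, forall N, lsum a (seq 0 N) <= B.
Proof.
  intros Ha [s Hs]. exists s.
  assert (H : forall n, sum_n a n <= s).
  { apply (is_lim_seq_incr_compare _ _ Hs). intros n. rewrite sum_Sn.
    unfold plus; simpl. specialize (Ha (S n)). lra. }
  intros N. specialize (H N). rewrite <- lsum_sum_n, seq_S, lsum_app in H. simpl in H.
  specialize (Ha N). lra.
Qed.

Lemma lsum_bounded_tail (a : nat -> R) (B : R) :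
  (forall n, 0 <= a n) -> (forall N, lsum a (seq 0 N) <= B) ->
  forall eps, 0 < eps -> exists n0, forall N, lsum (fun i => a (n0 + i)%nat) (seq 0 N) <= eps.
Proof.
  intros Ha HB eps Heps.
  destruct (completeness (fun x => exists N, x = lsum a (seq 0 N))) as [s [Hs1 Hs2]].
  { exists B. intros x [N ->]. apply HB. }
  { exists 0, O. easy. }
  assert (H : exists n0, s - eps < lsum a (seq 0 n0)).
  { apply NNPP. intros H. assert (s <= s - eps); [|lra].
    apply Hs2. intros x [N ->]. apply Rnot_lt_le. intros Hlt. apply H. now exists N. }
  destruct H as [n0 Hn0]. exists n0. intros N.
  assert (H1 : lsum a (seq 0 (n0 + N)) <= s) by (apply Hs1; now exists (n0 + N)%nat).
  rewrite seq_app, lsum_app in H1. simpl in H1.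
  assert (E : lsum a (seq n0 N) = lsum (fun i => a (n0 + i)%nat) (seq 0 N)).
  { clear. revert n0. induction N as [|N IH]; intros n0; [easy|].
    rewrite !seq_S, !lsum_app, IH. simpl. ring. }
  lra.
Qed.

Lemma half_pow_pos (n : nat) : 0 < / 2 ^ n.
Proof. apply Rinv_0_lt_compat, pow_lt. lra. Qed.

Lemma half_pow_S (n : nat) : / 2 ^ S n = / 2 ^ n / 2.
Proof. simpl. field. apply pow_nonzero. lra. Qed.

Lemma half_pow_le (n m : nat) : (n <= m)%nat -> / 2 ^ m <= / 2 ^ n.
Proof.
  intros H. apply Rinv_le_contravar; [apply pow_lt; lra|]. apply Rle_pow; [lra|easy].
Qed.

Lemma half_pow_lt_1 (n : nat) : (1 <= n)%nat -> / 2 ^ n < 1.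
Proof. intros H. pose proof (half_pow_le 1 n H). simpl in H0. lra. Qed.

Lemma half_pow_small (x : R) : 0 < x -> exists n, forall m, (n <= m)%nat -> / 2 ^ m < x.
Proof.
  intros Hx. destruct (pow_lt_1_zero (/ 2) ltac:(rewrite Rabs_pos_eq; lra) x Hx) as [N HN].
  exists N. intros m Hm. specialize (HN m Hm). rewrite pow_inv, Rabs_pos_eq in HN; [easy|].
  apply Rlt_le, half_pow_pos.
Qed.

Lemma dyadic_level (x : R) : 0 < x <= 1 -> exists n, / 2 ^ n / 2 < x <= / 2 ^ n.
Proof.
  intros [Hx Hx1]. destruct (half_pow_small x Hx) as [m Hm].
  specialize (Hm m (Nat.le_refl m)). induction m as [|m IH].
  - simpl in Hm. lra.
  - destruct (Rlt_le_dec (/ 2 ^ m) x) as [H|H]; [auto|].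
    exists m. rewrite half_pow_S in Hm. lra.
Qed.

Section Necessity.
Variable theta : R -> R.
Hypothesis theta_pos : forall t, 0 < t < 1 -> 0 < theta t.
Hypothesis theta_nonincr : forall s t, 0 < s -> s <= t -> t < 1 -> theta t <= theta s.

Let level (z : C) : nat := epsilon (inhabits O) (fun n => near_circle (/ 2 ^ n) z).

Let level_spec (z : C) : Cmod z < 1 -> near_circle (/ 2 ^ level z) z.
Proof.
  intros Hz. unfold level. apply epsilon_spec.
  pose proof (Cmod_ge_0 z). destruct (dyadic_level (1 - Cmod z)) as [n Hn]; [lra|].
  now exists n.
Qed.

Lemma list_nat_bound {A : Type} (f : A -> nat) (l : list A) :
  exists N, forall a, In a l -> (f a < N)%nat.
Proof.
  induction l as [|a l [N HN]]; [now exists O|].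
  exists (N + S (f a))%nat. intros b [->|Hb]; [lia|]. specialize (HN b Hb). lia.
Qed.

(** In the annulus of level n, theta(1 - |z|) >= theta(2^-n) by monotonicity and the kernels sum to
    at most [K]; the smallness comes from the tail of the series of 1/theta. *)
Lemma weighted_ker_sum (delta K eps : R) (n0 : nat) (l : list C) (a : C) :
  (forall (t : R) (a : C) (l : list C), 0 < t -> Cmod a < 1 -> NoDup l ->
    pairwise_separated delta l -> (forall z, In z l -> near_circle t z) ->
    lsum (square_ker a) l <= K) ->
  (1 <= n0)%nat ->
  (forall N, lsum (fun i => / theta (/ 2 ^ (n0 + i))) (seq 0 N) <= eps) -> 0 <= K ->
  Cmod a < 1 -> NoDup l -> pairwise_separated delta l ->
  (forall z, In z l -> 0 < 1 - Cmod z <= / 2 ^ n0) ->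
  lsum (fun z => square_ker a z / theta (1 - Cmod z)) l <= K * eps.
Proof.
  intros HK Hn0 Htail HK0 Ha Hnd Hsep Hl.
  (* Levels of points of [l] are at least [n0], as shown below, so the truncated subtraction loses
     nothing. *)
  destruct (list_nat_bound (fun z => level z - n0)%nat l) as [N HN].
  rewrite (lsum_fibers _ _ N l HN).
  apply Rle_trans with (lsum (fun i => K * / theta (/ 2 ^ (n0 + i))) (seq 0 N)).
  2:{ rewrite lsum_scal. now apply Rmult_le_compat_l. }
  apply lsum_le. intros i _. set (l1 := filter _ l). set (n := (n0 + i)%nat).
  assert (Hl1 : forall z, In z l1 -> In z l /\ near_circle (/ 2 ^ n) z).
  { intros z Hz. apply filter_In in Hz. destruct Hz as [Hz Hi]. split; [easy|].
    apply Nat.eqb_eq in Hi. destruct (Hl z Hz) as [Hz1 Hz2].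
    pose proof (level_spec z ltac:(lra)) as Hlev.
    assert (n0 <= level z)%nat.
    { apply Nat.nlt_ge. intros Hlt. pose proof (half_pow_le (S (level z)) n0 ltac:(lia)) as H.
      rewrite half_pow_S in H. destruct Hlev. lra. }
    replace n with (level z) by (unfold n; lia). easy. }
  assert (Hn : 0 < / 2 ^ n < 1) by (split; [apply half_pow_pos|apply half_pow_lt_1; unfold n; lia]).
  pose proof (theta_pos _ Hn) as Ht.
  apply Rle_trans with (lsum (fun z => / theta (/ 2 ^ n) * square_ker a z) l1).
  - apply lsum_le. intros z Hz. destruct (Hl1 z Hz) as [Hz1 [Hz2 Hz3]].
    destruct (Hl z Hz1) as [Hz4 _]. unfold Rdiv. rewrite Rmult_comm.
    apply Rmult_le_compat_r; [apply square_ker_pos|].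
    apply Rinv_le_contravar; [easy|]. apply theta_nonincr; lra.
  - rewrite lsum_scal, Rmult_comm. apply Rmult_le_compat_r.
    + now apply Rlt_le, Rinv_0_lt_compat.
    + apply (HK (/ 2 ^ n)); try easy.
      * now apply NoDup_filter.
      * intros z w Hz Hw. apply filter_sublist in Hz, Hw. now apply Hsep.
      * intros z Hz. now apply Hl1.
Qed.

Lemma separated_delta (z : nat -> C) : separated z ->
  exists delta, 0 < delta <= 1 /\ forall n k, n <> k -> delta <= Cmod (mob (z n) (z k)).
Proof.
  unfold separated. destruct (Glb_Rbar_correct (fun r : R => exists n k : nat, n <> k /\
       r = Cmod ((z n - z k) / (1 - Cconj (z n) * z k))%C)) as [Hlb _].
  set (G := Glb_Rbar _) in *. intros HG.
  assert (H : forall n k, n <> k -> Rbar_le G (Cmod (mob (z k) (z n)))).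
  { intros n k Hnk. apply Hlb. exists k, n. split; [auto|].
    unfold mob, Cdiv. rewrite !Cmod_mult. f_equal. apply Cmod_sub_sym. }
  (* An infinite infimum is excluded by the finite quotient of the indices 0 and 1. *)
  destruct G as [g| |]; simpl in HG; [|exfalso|easy].
  - exists (Rmin g 1). split; [split; [apply Rmin_glb_lt; lra|apply Rmin_r]|].
    intros n k Hnk. eapply Rle_trans; [apply Rmin_l|]. apply (H k n). auto.
  - apply (H 0%nat 1%nat). lia.
Qed.

Lemma thin_separated_blaschke (z : nat -> C) (n1 : nat) (B : R) :
  disc_sequence z -> separated z -> thin theta z -> (1 <= n1)%nat ->
  (forall N, lsum (fun i => / theta (/ 2 ^ (n1 + i))) (seq 0 N) <= B) -> Blaschke z.
Proof.
  intros [Hdisc Hlim] Hsep (f & [Hhol [M HM]] & (w & Hw & Hfw) & Hthin) Hn1 HB.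
  unfold in_disc in *.
  destruct (separated_delta z Hsep) as (delta & Hdelta & Hd).
  destruct (square_ker_sum delta Hdelta) as (K & HK0 & HK).
  pose proof (proj1 (Cmod_gt_0 _) Hfw) as HA.
  set (sigma := Rmin (delta ^ 2 / 4) (Cmod (f w) / 4)).
  assert (Hd2 : 0 < delta ^ 2) by (apply pow_lt; lra).
  assert (Hsig : 0 < sigma) by (apply Rmin_glb_lt; lra).
  assert (Hinvpos : forall n, 0 <= / theta (/ 2 ^ (n1 + n))).
  { intros n. apply Rlt_le, Rinv_0_lt_compat, theta_pos. split; [apply half_pow_pos|].
    apply half_pow_lt_1. lia. }
  destruct (lsum_bounded_tail _ B Hinvpos HB (sigma / K)) as [m Hm].
  { now apply Rdiv_lt_0_compat. }
  set (n0 := (n1 + m)%nat).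
  assert (Htail : forall N, lsum (fun i => / theta (/ 2 ^ (n0 + i))) (seq 0 N) <= sigma / K).
  { intros N. eapply Rle_trans; [|apply (Hm N)]. right. apply lsum_ext. intros i _.
    unfold n0. now rewrite Nat.add_assoc. }
  assert (Hinj : forall n k, z n = z k -> n = k).
  { intros n k E. apply NNPP. intros Hne. specialize (Hd n k Hne). rewrite E in Hd.
    unfold mob in Hd. replace (z k - z k)%C with (RtoC 0) in Hd by ring.
    unfold Cdiv in Hd. rewrite Cmult_0_l, Cmod_0 in Hd. lra. }
  (* Besides reaching the annuli of the small tail, this discards a possible point 0, so that
     [thin_term] takes its second branch. *)
  assert (Hk0 : exists k0, forall k, 1 - Cmod (z (k0 + k)%nat) < / 2 ^ n0).
  { apply is_lim_seq_spec in Hlim. specialize (Hlim (mkposreal _ (half_pow_pos n0))).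
    destruct Hlim as [k0 Hk0]. exists k0. intros k. specialize (Hk0 (k0 + k)%nat ltac:(lia)).
    simpl in Hk0. apply Rabs_lt_between in Hk0. lra. }
  destruct Hk0 as [k0 Hk0].
  set (zz := fun k => z (k0 + k)%nat).
  set (th := fun a : C => theta (1 - Cmod a)).
  assert (Hn0 : / 2 ^ n0 < 1) by (apply half_pow_lt_1; unfold n0; lia).
  assert (Hterm : forall k, thin_term theta f (zz k) = (1 - Cmod (zz k)) * exp (th (zz k)) * Cmod (f (zz k))).
  { intros k. unfold thin_term. destruct (Req_EM_T (Cmod (zz k)) 0) as [E|E]; [|easy].
    specialize (Hk0 k). fold (zz k) in Hk0. lra. }
  assert (Hterm0 : forall k, 0 <= thin_term theta f (zz k)).
  { intros k. rewrite Hterm. pose proof (exp_pos (th (zz k))). pose proof (Cmod_ge_0 (f (zz k))).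
    specialize (Hdisc (k0 + k)%nat). fold (zz k) in Hdisc.
    apply Rmult_le_pos; [apply Rmult_le_pos; lra|easy]. }
  destruct (ex_series_lsum_bounded (fun k => thin_term theta f (zz k)) Hterm0) as [B1 HB1].
  { now apply (ex_series_incr_n (fun k => thin_term theta f (z k)) k0). }
  unfold Blaschke. apply (ex_series_incr_n _ k0).
  set (C2 := 2 * (4 / (1 - Cmod w ^ 2) * ln (256 * M ^ 4 / Cmod (f w) ^ 4))).
  apply (ex_series_bounded (fun k => 1 - Cmod (zz k)) (B1 + C2)).
  { intros k. specialize (Hdisc (k0 + k)%nat). fold (zz k) in Hdisc. lra. }
  intros N.
  (* [p] selects the points with |f| > exp(-theta), where 1 - |z| is at most the thin term; the
     others go to [small_values_sum], whose bound is independent of [N]. *)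
  set (p := fun k => if Rle_dec (Cmod (f (zz k))) (exp (- th (zz k))) then false else true).
  rewrite (lsum_filter _ p). apply Rplus_le_compat.
  - eapply Rle_trans; [|apply (HB1 N)].
    apply Rle_trans with (lsum (fun k => thin_term theta f (zz k)) (filter p (seq 0 N))).
    + apply lsum_le. intros k Hk. apply filter_In in Hk. destruct Hk as [_ Hk].
      unfold p in Hk. destruct (Rle_dec _ _) as [|Hgt]; [easy|]. apply Rnot_le_lt in Hgt.
      rewrite Hterm. specialize (Hdisc (k0 + k)%nat). fold (zz k) in Hdisc.
      assert (1 <= exp (th (zz k)) * Cmod (f (zz k))).
      { apply Rle_trans with (exp (th (zz k)) * exp (- th (zz k))).
        - rewrite <- exp_plus, Rplus_opp_r, exp_0. lra.
        - apply Rmult_le_compat_l; [apply Rlt_le, exp_pos|lra]. }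
      rewrite Rmult_assoc. nra.
    + apply lsum_incl; [apply NoDup_filter, seq_NoDup| |].
      * intros k Hk. now apply filter_sublist in Hk.
      * intros k _. apply Hterm0.
  - set (idx := filter (fun k => negb (p k)) (seq 0 N)).
    rewrite <- (lsum_map (fun a => 1 - Cmod a) zz idx).
    assert (Hin : forall a, In a (map zz idx) -> exists k, a = zz k /\ Cmod (f a) <= exp (- th a)).
    { intros a Ha. apply in_map_iff in Ha. destruct Ha as (k & <- & Hk). exists k. split; [easy|].
      apply filter_In in Hk. destruct Hk as [_ Hk]. unfold p in Hk.
      now destruct (Rle_dec _ _). }
    assert (Hnd : NoDup (map zz idx)).
    { apply NoDup_map_NoDup_ForallPairs; [|apply NoDup_filter, seq_NoDup].
      intros i j _ _ E. apply Hinj in E. lia. }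
    assert (Hps : pairwise_separated delta (map zz idx)).
    { intros a b Ha Hb Hne. destruct (Hin a Ha) as (i & -> & _). destruct (Hin b Hb) as (j & -> & _).
      apply Hd. intros E. apply Hne. unfold zz. now rewrite E. }
    apply (small_values_sum f M delta sigma w th); auto.
    + intros x Hx. now apply cderiv_ex_derive, Hhol.
    + lra.
    + apply Rmin_l.
    + apply Rmin_r.
    + intros a Ha. destruct (Hin a Ha) as (k & -> & Hfa). specialize (Hdisc (k0 + k)%nat).
      repeat split; try easy. unfold th. apply theta_pos. specialize (Hk0 k). fold (zz k) in *. lra.
    + intros x Hx. replace sigma with (K * (sigma / K)) by (field; lra).
      apply (weighted_ker_sum delta K (sigma / K) n0); auto; try lra; try (unfold n0; lia).
      intros a Ha. destruct (Hin a Ha) as (k & -> & _). specialize (Hdisc (k0 + k)%nat).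
      specialize (Hk0 k). fold (zz k) in *. lra.
Qed.
End Necessity.

(** * Comparison of the integral with the dyadic series *)

Section DyadicIntegral.
Variable theta : R -> R.
Hypothesis theta_pos : forall t, 0 < t < 1 -> 0 < theta t.
Hypothesis theta_cont : forall t, 0 < t < 1 -> continuous theta t.
Hypothesis theta_nonincr : forall s t, 0 < s -> s <= t -> t < 1 -> theta t <= theta s.

Let g (t : R) : R := / (t * theta t).

Let g_pos (t : R) : 0 < t < 1 -> 0 < g t.
Proof.
  intros Ht. apply Rinv_0_lt_compat, Rmult_lt_0_compat; [lra|auto].
Qed.

Lemma ex_RInt_integrand (a b : R) : 0 < a -> a <= b -> b < 1 -> ex_RInt g a b.
Proof.
  intros Ha Hab Hb. apply @ex_RInt_continuous. intros t Ht.
  rewrite Rmin_left, Rmax_right in Ht by lra.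
  apply (continuous_comp (fun t => t * theta t) Rinv).
  - apply (continuous_mult (fun t => t) theta); [apply continuous_id|apply theta_cont; lra].
  - apply continuous_Rinv. pose proof (theta_pos t ltac:(lra)). nra.
Qed.

Lemma RInt_integrand_mono (a b c d : R) : 0 < a -> a <= b -> b <= c -> c <= d -> d < 1 ->
  RInt g b c <= RInt g a d.
Proof.
  intros Ha Hab Hbc Hcd Hd.
  assert (Hpos : forall x y, 0 < x -> x <= y -> y < 1 -> 0 <= RInt g x y).
  { intros x y Hx Hxy Hy. apply RInt_ge_0; [easy|now apply ex_RInt_integrand|].
    intros t Ht. apply Rlt_le, g_pos. lra. }
  assert (E1 : RInt g a d = RInt g a b + RInt g b d).
  { symmetry. apply (RInt_Chasles g a b d); apply ex_RInt_integrand; lra. }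
  assert (E2 : RInt g b d = RInt g b c + RInt g c d).
  { symmetry. apply (RInt_Chasles g b c d); apply ex_RInt_integrand; lra. }
  pose proof (Hpos a b). pose proof (Hpos c d). lra.
Qed.

Lemma RInt_dyadic_block (t : R) : 0 < t < 1 ->
  / theta (t / 2) / 2 <= RInt g (t / 2) t <= / theta t.
Proof.
  intros Ht. pose proof (theta_pos t Ht) as H1. pose proof (theta_pos (t / 2) ltac:(lra)) as H2.
  split.
  - replace (/ theta (t / 2) / 2) with (RInt (fun _ => / (t * theta (t / 2))) (t / 2) t).
    2:{ rewrite RInt_const. unfold scal; simpl; unfold mult; simpl. field. lra. }
    apply RInt_le; [lra|apply ex_RInt_const|apply ex_RInt_integrand; lra|].
    intros x Hx. pose proof (theta_pos x ltac:(lra)).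
    pose proof (theta_nonincr (t / 2) x ltac:(lra) ltac:(lra) ltac:(lra)).
    apply Rinv_le_contravar; [nra|]. apply Rmult_le_compat; lra.
  - replace (/ theta t) with (RInt (fun _ => / (t / 2 * theta t)) (t / 2) t).
    2:{ rewrite RInt_const. unfold scal; simpl; unfold mult; simpl. field. lra. }
    apply RInt_le; [lra|apply ex_RInt_integrand; lra|apply ex_RInt_const|].
    intros x Hx. pose proof (theta_pos x ltac:(lra)).
    pose proof (theta_nonincr x t ltac:(lra) ltac:(lra) ltac:(lra)).
    apply Rinv_le_contravar; [nra|]. apply Rmult_le_compat; lra.
Qed.

(** The lower sum is shifted by one index: on a dyadic block theta is largest at the left end, which
    belongs to the next scale. *)
Lemma RInt_dyadic_sum (n N : nat) : (1 <= n)%nat ->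
  lsum (fun i => / theta (/ 2 ^ (S n + i))) (seq 0 N) / 2 <= RInt g (/ 2 ^ (n + N)) (/ 2 ^ n) /\
  RInt g (/ 2 ^ (n + N)) (/ 2 ^ n) <= lsum (fun i => / theta (/ 2 ^ (n + i))) (seq 0 N).
Proof.
  intros Hn. induction N as [|N IH].
  - rewrite Nat.add_0_r.
    assert (E : RInt g (/ 2 ^ n) (/ 2 ^ n) = 0) by apply (RInt_point (V := R_CompleteNormedModule)).
    rewrite E. unfold Rdiv. simpl. rewrite Rmult_0_l. split; apply Rle_refl.
  - rewrite !seq_S, !lsum_app. cbn [lsum fold_right Nat.add] in *. rewrite !Rplus_0_r.
    replace (n + S N)%nat with (S (n + N)) by lia.
    pose proof (half_pow_pos (n + N)) as H1.
    pose proof (half_pow_lt_1 (n + N) ltac:(lia)) as H2.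
    pose proof (half_pow_lt_1 n Hn) as H3.
    pose proof (half_pow_le n (n + N) ltac:(lia)) as H4.
    pose proof (RInt_dyadic_block (/ 2 ^ (n + N)) ltac:(lra)) as HB.
    rewrite <- half_pow_S in HB.
    assert (E : RInt g (/ 2 ^ S (n + N)) (/ 2 ^ n) =
      RInt g (/ 2 ^ S (n + N)) (/ 2 ^ (n + N)) + RInt g (/ 2 ^ (n + N)) (/ 2 ^ n)).
    { symmetry. pose proof (half_pow_pos (S (n + N))). rewrite half_pow_S in *.
      apply (RInt_Chasles g); apply ex_RInt_integrand; lra. }
    rewrite E. lra.
Qed.

Lemma int_0_diverges_unbounded : int_0_diverges g ->
  forall B, exists N, B < lsum (fun i => / theta (/ 2 ^ S i)) (seq 0 N).
Proof.
  intros (d & Hd & Hint) B.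
  destruct (half_pow_small d ltac:(lra)) as [m Hm].
  set (n := S m). specialize (Hm n ltac:(unfold n; lia)).
  destruct (Hint (/ 2 ^ n)) as [_ Hlim]; [split; [apply half_pow_pos|easy]|].
  specialize (Hlim (fun x => B < x) (ex_intro _ B (fun x H => H))).
  destruct Hlim as [e He].
  destruct (half_pow_small e (cond_pos e)) as [N HN].
  specialize (HN (n + N)%nat ltac:(lia)).
  assert (H : B < RInt g (/ 2 ^ (n + N)) (/ 2 ^ n)).
  { apply He; [|apply half_pow_pos]. pose proof (half_pow_pos (n + N)).
    change (Rabs (/ 2 ^ (n + N) - 0) < e). rewrite Rminus_0_r, Rabs_pos_eq; lra. }
  destruct (RInt_dyadic_sum n N ltac:(unfold n; lia)) as [_ H2].
  exists (m + N)%nat. eapply Rlt_le_trans; [exact H|]. eapply Rle_trans; [exact H2|].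
  rewrite <- (lsum_map (fun k => / theta (/ 2 ^ S k)) (fun i => m + i)%nat).
  apply lsum_incl.
  - apply NoDup_map_NoDup_ForallPairs; [|apply seq_NoDup]. intros i j _ _ E. lia.
  - intros k Hk. apply in_map_iff in Hk. destruct Hk as (i & <- & Hi).
    apply in_seq in Hi. apply in_seq. lia.
  - intros k _. apply Rlt_le, Rinv_0_lt_compat, theta_pos.
    split; [apply half_pow_pos|apply half_pow_lt_1; lia].
Qed.

Lemma not_int_0_diverges_bounded : ~ int_0_diverges g ->
  exists n B, (1 <= n)%nat /\
    forall N, lsum (fun i => / theta (/ 2 ^ (n + i))) (seq 0 N) <= B.
Proof.
  intros Hnot. apply NNPP. intros Hno. apply Hnot.
  exists (1 / 2). split; [lra|]. intros eps Heps. split.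
  { intros a Ha. apply ex_RInt_integrand; lra. }
  intros P [M HM].
  (* The integrand is positive, so once the integral exceeds [M] at some [a0] it does so for all
     smaller lower ends. *)
  assert (H : exists a0, 0 < a0 < eps /\ M < RInt g a0 eps).
  { apply NNPP. intros H. apply Hno.
    destruct (half_pow_small eps ltac:(lra)) as [m Hm].
    set (n := S m). exists (S n), (2 * M). split; [lia|]. intros N.
    destruct (RInt_dyadic_sum n N ltac:(unfold n; lia)) as [H1 _].
    enough (RInt g (/ 2 ^ (n + N)) (/ 2 ^ n) <= M) by lra.
    apply Rnot_lt_le. intros Hlt. apply H. exists (/ 2 ^ (n + N)).
    pose proof (half_pow_pos (n + N)). pose proof (Hm (n + N)%nat ltac:(unfold n; lia)).
    pose proof (Hm n ltac:(unfold n; lia)). pose proof (half_pow_le n (n + N) ltac:(lia)).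
    split; [lra|]. eapply Rlt_le_trans; [exact Hlt|]. apply RInt_integrand_mono; lra. }
  destruct H as (a0 & Ha0 & HMa).
  exists (mkposreal a0 (proj1 Ha0)). intros a Hball Ha.
  change (Rabs (a - 0) < a0) in Hball. rewrite Rminus_0_r, Rabs_pos_eq in Hball by lra.
  apply HM. eapply Rlt_le_trans; [exact HMa|]. apply RInt_integrand_mono; lra.
Qed.
End DyadicIntegral.

(** * A Cantor set of prescribed densities *)

Definition density (p : list nat) (n : nat) : R := INR (length p) / 2 ^ n.

Section CantorSet.
Variable th : nat -> R.
Hypothesis th_pos : forall n, 0 < th n.
Hypothesis th_incr : forall n, th n <= th (S n).

(* 600 exceeds 33 ^ 2 / 2, where 33 * / 2 ^ S n bounds the distance from a point at height
   / 2 ^ S n above an arc to the atoms in that arc. *)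
Definition density_cap (n : nat) (s : R) : R := / (1 + s) / (600 * (1 + th n + s)).

(* Stage [n] is a set of dyadic arcs [j / 2 ^ n, (j + 1) / 2 ^ n] of the circle, given
   with the sum of the densities of the earlier stages. The next stage keeps both
   halves of each arc if its density does not exceed the cap, and otherwise only the left one. *)
Fixpoint cantor_stage (n : nat) : list nat * R :=
  match n with
  | O => (0%nat :: nil, 0)
  | S m =>
    let p := fst (cantor_stage m) in
    let s := snd (cantor_stage m) + density p m in
    if Rle_dec (density p m) (density_cap (S m) s)
    then (flat_map (fun j => (2 * j)%nat :: (2 * j + 1)%nat :: nil) p, s)
    else (map (fun j => (2 * j)%nat) p, s)
  end.

Definition arcs (n : nat) : list nat := fst (cantor_stage n).
Definition dens (n : nat) : R := density (arcs n) n.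
Definition dens_sum (n : nat) : R := snd (cantor_stage n).
Definition cap (n : nat) : R := density_cap n (dens_sum n).

Lemma dens_sum_S (n : nat) : dens_sum (S n) = dens_sum n + dens n.
Proof.
  unfold dens_sum, dens, arcs. cbn [cantor_stage]. now destruct (Rle_dec _ _).
Qed.

Lemma arcs_S (n : nat) :
  (dens n <= cap (S n) /\ arcs (S n) = flat_map (fun j => (2 * j)%nat :: (2 * j + 1)%nat :: nil) (arcs n)) \/
  (cap (S n) < dens n /\ arcs (S n) = map (fun j => (2 * j)%nat) (arcs n)).
Proof.
  unfold cap. rewrite dens_sum_S. unfold dens, dens_sum, arcs. cbn [cantor_stage].
  destruct (Rle_dec _ _) as [H|H]; [left|right]; split; try easy. now apply Rnot_le_lt in H.
Qed.

Lemma length_children (p : list nat) :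
  length (flat_map (fun j => (2 * j)%nat :: (2 * j + 1)%nat :: nil) p) = (2 * length p)%nat.
Proof. induction p as [|j p IH]; cbn [flat_map app length]; lia. Qed.

Lemma dens_S (n : nat) :
  (dens n <= cap (S n) /\ dens (S n) = dens n) \/ (cap (S n) < dens n /\ dens (S n) = dens n / 2).
Proof.
  assert (H2 : 2 ^ n <> 0) by (apply pow_nonzero; lra).
  destruct (arcs_S n) as [[H E]|[H E]]; [left|right]; split; try easy;
    unfold dens at 1, density; rewrite E.
  - rewrite length_children, mult_INR. unfold dens, density. simpl. field. easy.
  - rewrite length_map. unfold dens, density. simpl. field. easy.
Qed.

Lemma dens_bounds (n : nat) : 0 < dens n <= 1.
Proof.
  induction n as [|n IH].
  - unfold dens, density. simpl. lra.
  - destruct (dens_S n) as [[_ ->]|[_ ->]]; lra.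
Qed.

Lemma dens_sum_nonneg (n : nat) : 0 <= dens_sum n.
Proof.
  induction n as [|n IH]; [unfold dens_sum; simpl; lra|].
  rewrite dens_sum_S. pose proof (dens_bounds n). lra.
Qed.

Lemma dens_sum_lsum (n : nat) : dens_sum n = lsum dens (seq 0 n).
Proof.
  induction n as [|n IH]; [easy|].
  rewrite seq_S, lsum_app, dens_sum_S, IH. simpl. ring.
Qed.

Lemma cap_S (n : nat) : cap (S n) <= cap n.
Proof.
  pose proof (dens_sum_nonneg n). pose proof (dens_bounds n). pose proof (dens_sum_S n) as E.
  pose proof (th_pos n). pose proof (th_incr n).
  unfold cap, density_cap, Rdiv. apply Rmult_le_compat.
  - apply Rlt_le, Rinv_0_lt_compat. lra.
  - apply Rlt_le, Rinv_0_lt_compat. lra.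
  - apply Rinv_le_contravar; lra.
  - apply Rinv_le_contravar; lra.
Qed.

(** A stage is halved only when its density exceeds the next cap, and caps do not increase. *)
Lemma dens_ge (n : nat) : cap n / 2 <= dens n.
Proof.
  induction n as [|n IH].
  - pose proof (th_pos 0).
    assert (E : dens 0 = 1) by (unfold dens, density; simpl; field).
    assert (E' : cap 0 = / (600 * (1 + th 0))).
    { unfold cap, density_cap, dens_sum. simpl. field. lra. }
    assert (/ (600 * (1 + th 0)) <= / 1) by (apply Rinv_le_contravar; lra).
    rewrite Rinv_1 in *. lra.
  - pose proof (cap_S n). destruct (dens_S n) as [[_ ->]|[H1 ->]]; lra.
Qed.

Hypothesis th_div : forall B, exists N, B < lsum (fun i => / th i) (seq 0 N).

Lemma th_ge_0 (n : nat) : th 0 <= th n.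
Proof. induction n as [|n IH]; [lra|]. specialize (th_incr n). lra. Qed.

Lemma dens_sum_unbounded (B : R) : exists N, B < dens_sum N.
Proof.
  apply NNPP. intros Hno.
  assert (HB : forall N, dens_sum N <= B).
  { intros N. apply Rnot_lt_le. intros H. apply Hno. now exists N. }
  assert (HB0 : 0 <= B) by (eapply Rle_trans; [apply (dens_sum_nonneg 0)|apply HB]).
  pose proof (th_pos 0) as H0.
  (* Here 1200 undoes the 600 of the cap and the half in [dens_ge]; the last factor comes from 1 +
     th n + B <= (1 + (1 + B) / th 0) * th n, valid as th n >= th 0. *)
  set (c := 1200 * (1 + B) * (1 + (1 + B) / th 0)).
  assert (Hq : 0 < (1 + B) / th 0) by (apply Rdiv_lt_0_compat; lra).
  assert (Hc : 0 < c) by (unfold c; apply Rmult_lt_0_compat; lra).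
  assert (H : forall n, / th n <= c * dens n).
  { intros n. pose proof (th_pos n). pose proof (th_ge_0 n). pose proof (dens_ge n) as Hd.
    pose proof (dens_sum_nonneg n). specialize (HB n).
    apply Rle_trans with (c * (cap n / 2)); [|apply Rmult_le_compat_l; lra].
    unfold cap, density_cap. set (s := dens_sum n) in *.
    assert (Hle : (1 + s) * (1 + th n + s) <= (1 + B) * ((1 + (1 + B) / th 0) * th n)).
    { apply Rmult_le_compat; try lra.
      replace ((1 + (1 + B) / th 0) * th n) with (th n + (1 + B) * (th n / th 0)) by (field; lra).
      assert (1 <= th n / th 0) by (apply Rle_div_r; lra). nra. }
    replace (c * (/ (1 + s) / (600 * (1 + th n + s)) / 2)) with
      ((1 + B) * ((1 + (1 + B) / th 0) * th n) / ((1 + s) * (1 + th n + s)) * / th n)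
      by (unfold c; field; repeat split; lra).
    rewrite <- (Rmult_1_l (/ th n)) at 1. apply Rmult_le_compat_r.
    - now apply Rlt_le, Rinv_0_lt_compat.
    - apply Rle_div_r; [apply Rmult_lt_0_compat; lra|]. lra. }
  destruct (th_div (c * B)) as [N HN].
  apply (Rlt_irrefl (c * B)), Rlt_le_trans with (1 := HN).
  apply Rle_trans with (lsum (fun n => c * dens n) (seq 0 N)).
  - apply lsum_le. auto.
  - rewrite lsum_scal, <- dens_sum_lsum. apply Rmult_le_compat_l; [lra|apply HB].
Qed.

Definition good (n : nat) : bool := if Rle_dec (dens n) (cap n) then true else false.

(** A stage above its cap has just been halved, since an unhalved one was compared with that very
    cap. So it costs at most half of its predecessor's density; the 1 pays for stage 0. *)
Lemma dens_sum_good (N : nat) :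
  dens_sum (S N) <= 1 + lsum dens (filter good (seq 0 (S N))) + dens_sum N / 2.
Proof.
  assert (Hgood : forall n, lsum dens (filter good (seq 0 (S n))) =
    lsum dens (filter good (seq 0 n)) + (if good n then dens n else 0)).
  { intros n. rewrite seq_S, filter_app, lsum_app. simpl. destruct (good n); simpl; ring. }
  induction N as [|N IH].
  - rewrite dens_sum_S, Hgood. pose proof (dens_bounds 0).
    unfold dens_sum. simpl. destruct (good 0); lra.
  - rewrite dens_sum_S, (dens_sum_S N) in *. rewrite Hgood.
    enough (dens (S N) <= (if good (S N) then dens (S N) else 0) + dens N / 2) by lra.
    pose proof (dens_bounds N). pose proof (dens_bounds (S N)). unfold good.
    destruct (dens_S N) as [[H1 E]|[H1 E]]; rewrite E; destruct (Rle_dec _ _); lra.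
Qed.

Lemma good_dens_unbounded (B : R) : exists N, B < lsum dens (filter good (seq 0 N)).
Proof.
  destruct (dens_sum_unbounded (2 * B + 2)) as [[|N] HN].
  - exists O. unfold dens_sum in HN. simpl in *. lra.
  - exists (S N). pose proof (dens_sum_good N) as H. rewrite dens_sum_S in *.
    pose proof (dens_bounds N). lra.
Qed.

(** Telescoping against exp(-S_n), because exp(-a) <= 1 / (1 + a) <= 1 - a / 2 for 0 <= a <= 1. *)
Lemma dens_exp_sum (N : nat) :
  lsum (fun n => dens n / 2 * exp (- dens_sum n)) (seq 0 N) <= 1.
Proof.
  apply Rle_trans with (lsum (fun n => - exp (- dens_sum (S n)) - - exp (- dens_sum n)) (seq 0 N)).
  - apply lsum_le. intros n _. rewrite dens_sum_S, Ropp_plus_distr, exp_plus.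
    pose proof (dens_bounds n). pose proof (exp_pos (- dens_sum n)).
    enough (exp (- dens n) <= 1 - dens n / 2) by nra.
    rewrite exp_Ropp. pose proof (exp_ineq1_le (dens n)).
    apply Rle_trans with (/ (1 + dens n)); [apply Rinv_le_contravar; lra|].
    apply (Rmult_le_reg_r (1 + dens n)); [lra|]. rewrite Rinv_l by lra. nra.
  - rewrite (lsum_telescope (fun n => - exp (- dens_sum n))).
    unfold dens_sum at 2. simpl. rewrite Ropp_0, exp_0. pose proof (exp_pos (- dens_sum N)). lra.
Qed.

Lemma length_arcs_pos (n : nat) : (0 < length (arcs n))%nat.
Proof.
  apply INR_lt. simpl. pose proof (dens_bounds n) as [H _]. unfold dens, density in H.
  assert (0 < 2 ^ n) by (apply pow_lt; lra).
  apply Rmult_lt_reg_r with (/ 2 ^ n); [now apply Rinv_0_lt_compat|]. lra.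
Qed.

Lemma arcs_lt (n j : nat) : In j (arcs n) -> (j < 2 ^ n)%nat.
Proof.
  revert j. induction n as [|n IH]; intros j Hj.
  - destruct Hj as [<-|[]]. simpl. lia.
  - rewrite Nat.pow_succ_r'. destruct (arcs_S n) as [[_ E]|[_ E]]; rewrite E in Hj.
    + apply in_flat_map in Hj. destruct Hj as (i & Hi & Hj). specialize (IH i Hi).
      simpl In in Hj. lia.
    + apply in_map_iff in Hj. destruct Hj as (i & <- & Hi). specialize (IH i Hi). lia.
Qed.

Lemma NoDup_arcs (n : nat) : NoDup (arcs n).
Proof.
  induction n as [|n IH].
  - repeat constructor. easy.
  - destruct (arcs_S n) as [[_ E]|[_ E]]; rewrite E; clear E.
    + induction (arcs n) as [|j p IHp]; [constructor|].
      inversion IH as [|? ? Hj Hp]; subst. cbn [flat_map app].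
      assert (Hno : forall k, In k (flat_map (fun j => (2 * j)%nat :: (2 * j + 1)%nat :: nil) p) ->
        k <> (2 * j)%nat /\ k <> (2 * j + 1)%nat).
      { intros k Hk. apply in_flat_map in Hk. destruct Hk as (i & Hi & Hk).
        assert (i <> j) by congruence. simpl In in Hk. lia. }
      constructor; [|constructor; [|auto]].
      * intros [H|H]; [lia|]. apply Hno in H. lia.
      * intros H. apply Hno in H. lia.
    + apply NoDup_map_NoDup_ForallPairs; [|easy]. intros i j _ _ H. lia.
Qed.

(** Arc [i] lies in the arc [j] of [k] stages earlier exactly when [j] is [i] without its last [k]
    binary digits. Real values let [lsum] count descendants. *)
Definition ancestor_ind (k j i : nat) : R := if Nat.eqb (i / 2 ^ k) j then 1 else 0.

(** Equidistribution: each step gives all arcs the same number of children, so the whole stage and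
    the descendants of [j] grow by the same factor. *)
Lemma arcs_descendants (n j k : nat) : In j (arcs n) ->
  INR (length (arcs (n + k))) <= INR (length (arcs n)) * lsum (ancestor_ind k j) (arcs (n + k)).
Proof.
  intros Hj. induction k as [|k IH].
  - rewrite Nat.add_0_r. rewrite <- (Rmult_1_r (INR (length (arcs n)))) at 1.
    apply Rmult_le_compat_l; [apply pos_INR|].
    apply Rle_trans with (lsum (ancestor_ind 0 j) (j :: nil)).
    + simpl. unfold ancestor_ind. rewrite Nat.pow_0_r, Nat.div_1_r, Nat.eqb_refl. lra.
    + apply lsum_incl.
      * repeat constructor. easy.
      * intros i [<-|[]]. easy.
      * intros i _. unfold ancestor_ind. destruct (Nat.eqb _ _); lra.
  - rewrite Nat.add_succ_r.
    assert (H0 : forall i, ancestor_ind (S k) j (2 * i) = ancestor_ind k j i).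
    { intros i. unfold ancestor_ind. rewrite Nat.pow_succ_r', <- Nat.Div0.div_div.
      now rewrite (Nat.mul_comm 2 i), Nat.div_mul. }
    assert (H1 : forall i, ancestor_ind (S k) j (2 * i + 1) = ancestor_ind k j i).
    { intros i. unfold ancestor_ind. rewrite Nat.pow_succ_r', <- Nat.Div0.div_div.
      replace ((2 * i + 1) / 2)%nat with i; [easy|].
      apply (Nat.div_unique _ 2 i 1); lia. }
    destruct (arcs_S (n + k)) as [[_ E]|[_ E]]; rewrite E.
    + rewrite length_children, mult_INR. simpl (INR 2).
      replace (lsum (ancestor_ind (S k) j) (flat_map _ (arcs (n + k)))) with
        (2 * lsum (ancestor_ind k j) (arcs (n + k))); [lra|].
      clear - H0 H1. induction (arcs (n + k)) as [|i p IHp]; [simpl; ring|].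
      cbn [flat_map app lsum fold_right] in *. rewrite H0, H1.
      fold (lsum (ancestor_ind (S k) j)). unfold lsum in *. lra.
    + rewrite length_map, lsum_map.
      rewrite (lsum_ext _ (ancestor_ind k j)); [easy|]. intros i _. apply H0.
Qed.
End CantorSet.

(** * Series of Herglotz kernels *)

Definition Cseries (u : nat -> C) : C := (Series (fun n => Re (u n)), Series (fun n => Im (u n))).

Section DominatedSeries.
Variable c : nat -> R.
Hypothesis Hex : ex_series c.

Let dominated (u : nat -> C) (K : R) : Prop := forall n, Cmod (u n) <= K * c n.

Let ex_series_parts (u : nat -> C) (K : R) : dominated u K ->
  (ex_series (fun n => Rabs (Re (u n))) /\ ex_series (fun n => Rabs (Im (u n)))) /\
  (ex_series (fun n => Re (u n)) /\ ex_series (fun n => Im (u n))).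
Proof.
  intros Hu.
  assert (H : ex_series (fun n => Rabs (Re (u n))) /\ ex_series (fun n => Rabs (Im (u n)))).
  { split; apply (@ex_series_le R_AbsRing R_CompleteNormedModule) with (fun n => K * c n);
      try (now apply (ex_series_scal_l K c)); intros n; specialize (Hu n);
      change (norm ?x) with (Rabs x); rewrite Rabs_Rabsolu.
    - pose proof (re_le_Cmod (u n)). lra.
    - pose proof (im_le_Cmod (u n)). lra. }
  split; [easy|]. split; now apply ex_series_Rabs.
Qed.

Lemma Cmod_Cseries_le (u : nat -> C) (K : R) :
  (forall n, Cmod (u n) <= K * c n) -> Cmod (Cseries u) <= 2 * (K * Series c).
Proof.
  intros Hu. destruct (ex_series_parts u K Hu) as [[H1 H2] _].
  assert (HK : ex_series (fun n => K * c n)) by now apply (ex_series_scal_l K c).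
  rewrite <- Series_scal_l.
  eapply Rle_trans; [apply Cmod_le_abs|]. unfold Cseries. simpl Re. simpl Im.
  assert (A : Rabs (Series (fun n => Re (u n))) <= Series (fun n => K * c n)).
  { eapply Rle_trans; [now apply Series_Rabs|]. apply Series_le; [|easy].
    intros n. split; [apply Rabs_pos|]. specialize (Hu n). pose proof (re_le_Cmod (u n)). lra. }
  assert (B : Rabs (Series (fun n => Im (u n))) <= Series (fun n => K * c n)).
  { eapply Rle_trans; [now apply Series_Rabs|]. apply Series_le; [|easy].
    intros n. split; [apply Rabs_pos|]. specialize (Hu n). pose proof (im_le_Cmod (u n)). lra. }
  lra.
Qed.

Lemma Cseries_minus (u v : nat -> C) (K L : R) :
  (forall n, Cmod (u n) <= K * c n) -> (forall n, Cmod (v n) <= L * c n) ->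
  Cseries (fun n => u n - v n)%C = (Cseries u - Cseries v)%C.
Proof.
  intros Hu Hv. destruct (ex_series_parts u K Hu) as [_ [H1 H2]].
  destruct (ex_series_parts v L Hv) as [_ [H3 H4]].
  unfold Cseries, Cminus, Cplus, Copp. simpl fst. simpl snd. f_equal.
  - change (Series (fun n => Re (u n) - Re (v n)) =
      Series (fun n => Re (u n)) - Series (fun n => Re (v n))).
    now apply Series_minus.
  - change (Series (fun n => Im (u n) - Im (v n)) =
      Series (fun n => Im (u n)) - Series (fun n => Im (v n))).
    now apply Series_minus.
Qed.

Lemma Cseries_scal_r (u : nat -> C) (K : R) (h : C) : (forall n, Cmod (u n) <= K * c n) ->
  Cseries (fun n => u n * h)%C = (Cseries u * h)%C.
Proof.
  intros Hu. destruct (ex_series_parts u K Hu) as [_ [H1 H2]].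
  unfold Cseries, Cmult. simpl fst. simpl snd. f_equal.
  - change (Series (fun n => Re (u n) * fst h - Im (u n) * snd h) =
      Series (fun n => Re (u n)) * fst h - Series (fun n => Im (u n)) * snd h).
    rewrite Series_minus, !Series_scal_r; [easy| |]; now apply ex_series_scal_r.
  - change (Series (fun n => Re (u n) * snd h + Im (u n) * fst h) =
      Series (fun n => Re (u n)) * snd h + Series (fun n => Im (u n)) * fst h).
    rewrite Series_plus, !Series_scal_r; [easy| |]; now apply ex_series_scal_r.
Qed.

Hypothesis Hc : forall n, 0 <= c n.

(** Termwise differentiation: the remainders are quadratic in [h] with a common constant, so after
    weighting by the summable [c] their sum is still quadratic. *)
Lemma cdiff_Cseries (F : nat -> C -> C) (l : nat -> C) (z : C) (K r : R) : 0 < r ->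
  (forall n h, Cmod h < r -> Cmod (F n (z + h)%C) <= K) -> (forall n, Cmod (l n) <= K) ->
  (forall n h, Cmod h < r -> Cmod (F n (z + h) - F n z - l n * h)%C <= K * Cmod h ^ 2) ->
  cdiff (fun x => Cseries (fun n => RtoC (c n) * F n x)%C) z.
Proof.
  intros Hr HF Hl Hrem. exists (Cseries (fun n => RtoC (c n) * l n)%C). intros eps Heps.
  assert (Hdom : forall (x : C) (k : R) n, Cmod x <= k -> Cmod (RtoC (c n) * x)%C <= k * c n).
  { intros x k n Hx. rewrite Cmod_mult, Cmod_R, Rabs_pos_eq by auto.
    rewrite Rmult_comm. apply Rmult_le_compat_r; auto. }
  assert (HF0 : forall n, Cmod (F n z) <= K).
  { intros n. specialize (HF n 0%C). rewrite Cplus_0_r, Cmod_0 in HF. auto. }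
  set (B := Rabs (2 * (K * Series c)) + 1).
  assert (HB : 0 < B) by (unfold B; pose proof (Rabs_pos (2 * (K * Series c))); lra).
  exists (Rmin r (eps / B)). split.
  { apply Rmin_glb_lt; [easy|]. now apply Rdiv_lt_0_compat. }
  intros h Hh. pose proof (Rmin_l r (eps / B)). pose proof (Rmin_r r (eps / B)).
  assert (Hhr : Cmod h < r) by lra. assert (Hhe : Cmod h < eps / B) by lra.
  rewrite <- (Cseries_minus _ _ K K) by (intros n; apply Hdom; auto).
  rewrite <- (Cseries_scal_r _ K) by (intros n; apply Hdom; auto).
  rewrite <- (Cseries_minus _ _ (2 * K) (K * Cmod h)).
  - apply Rle_trans with (2 * (K * Cmod h ^ 2 * Series c)).
    + apply Cmod_Cseries_le. intros n.
      replace (RtoC (c n) * F n (z + h) - RtoC (c n) * F n z - RtoC (c n) * l n * h)%C with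
        (RtoC (c n) * (F n (z + h) - F n z - l n * h))%C by ring.
      apply Hdom. now apply Hrem.
    + replace (2 * (K * Cmod h ^ 2 * Series c)) with (2 * (K * Series c) * Cmod h * Cmod h) by ring.
      pose proof (Cmod_ge_0 h). apply Rmult_le_compat_r; [easy|].
      apply Rle_trans with (B * (eps / B)); [|right; field; lra].
      pose proof (RRle_abs (2 * (K * Series c))). unfold B in *.
      apply Rle_trans with ((Rabs (2 * (K * Series c)) + 1) * Cmod h); [nra|].
      apply Rmult_le_compat_l; lra.
  - intros n. replace (RtoC (c n) * F n (z + h) - RtoC (c n) * F n z)%C with
      (RtoC (c n) * (F n (z + h) - F n z))%C by ring.
    apply Hdom. eapply Rle_trans; [apply Cmod_triang_sub|].
    specialize (HF n h Hhr). specialize (HF0 n). lra.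
  - intros n. rewrite <- Cmult_assoc. apply Hdom. rewrite Cmod_mult.
    apply Rmult_le_compat_r; [apply Cmod_ge_0|easy].
Qed.
End DominatedSeries.

Definition herglotz (zeta z : C) : C := ((zeta + z) / (zeta - z))%C.

Section Herglotz.
Variables (zeta z : C).
Hypothesis Hzeta : Cmod zeta = 1.
Hypothesis Hz : Cmod z < 1.

Lemma Cmod_pole_ge : 1 - Cmod z <= Cmod (zeta - z)%C.
Proof. rewrite <- Hzeta. apply Cmod_sub_ge. Qed.

Lemma pole_neq_0 : (zeta - z)%C <> 0%C.
Proof. apply Cmod_gt_0. pose proof Cmod_pole_ge. lra. Qed.

Lemma Cmod_herglotz_le : Cmod (herglotz zeta z) <= 2 / (1 - Cmod z).
Proof.
  unfold herglotz. rewrite Cmod_div by apply pole_neq_0.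
  pose proof Cmod_pole_ge. pose proof (Cmod_triangle zeta z).
  apply Rmult_le_compat; [apply Cmod_ge_0| |lra|].
  - apply Rlt_le, Rinv_0_lt_compat. lra.
  - apply Rinv_le_contravar; lra.
Qed.

(** The Poisson kernel: multiply by |zeta - z|^2, the product of zeta - z and its conjugate, and
    take real parts. *)
Lemma Re_herglotz : Re (herglotz zeta z) = (1 - Cmod z ^ 2) / Cmod (zeta - z)%C ^ 2.
Proof.
  pose proof pole_neq_0 as Hn.
  assert (Hpos : 0 < Cmod (zeta - z)%C ^ 2) by (apply pow_lt; now apply Cmod_gt_0).
  apply (Rmult_eq_reg_r (Cmod (zeta - z)%C ^ 2)); [|lra].
  replace ((1 - Cmod z ^ 2) / Cmod (zeta - z)%C ^ 2 * Cmod (zeta - z)%C ^ 2) with (1 - Cmod z ^ 2)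
    by (field; now apply Rgt_not_eq, Cmod_gt_0).
  rewrite <- (pow1 2). rewrite <- Hzeta at 1.
  assert (E : (herglotz zeta z * RtoC (Cmod (zeta - z) ^ 2))%C = ((zeta + z) * Cconj (zeta - z))%C).
  { rewrite Cmod2_conj. unfold herglotz. field. easy. }
  replace (Re (herglotz zeta z) * Cmod (zeta - z)%C ^ 2) with
    (Re (herglotz zeta z * RtoC (Cmod (zeta - z) ^ 2))%C).
  - rewrite E, !Cmod2_alt. unfold Re, Im. destruct zeta, z. simpl. ring.
  - unfold Re. destruct (herglotz zeta z) as [p q]. simpl. ring.
Qed.

Lemma Re_herglotz_nonneg : 0 <= Re (herglotz zeta z).
Proof.
  rewrite Re_herglotz. pose proof (Cmod_ge_0 z). pose proof Cmod_pole_ge.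
  apply Rdiv_le_0_compat; [nra|]. apply pow_lt. lra.
Qed.
End Herglotz.

Lemma herglotz_remainder (zeta z h : C) : Cmod zeta = 1 -> Cmod z < 1 ->
  Cmod h < (1 - Cmod z) / 2 ->
  Cmod (herglotz zeta (z + h) - herglotz zeta z - 2 * zeta / ((zeta - z) * (zeta - z)) * h)%C
    <= 4 / (1 - Cmod z) ^ 3 * Cmod h ^ 2.
Proof.
  intros Hzeta Hz Hh. pose proof (Cmod_triangle z h) as Htri.
  pose proof (Cmod_pole_ge zeta z Hzeta) as H1.
  pose proof (Cmod_pole_ge zeta (z + h)%C Hzeta) as H2.
  pose proof (pole_neq_0 zeta z Hzeta Hz) as N1.
  pose proof (pole_neq_0 zeta (z + h)%C Hzeta ltac:(lra)) as N2.
  replace (herglotz zeta (z + h) - herglotz zeta z - 2 * zeta / ((zeta - z) * (zeta - z)) * h)%C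
    with (2 * zeta * (h * h) / ((zeta - z) * (zeta - z) * (zeta - (z + h))))%C.
  2:{ unfold herglotz. field. auto. }
  rewrite Cmod_div by (repeat apply Cmult_neq_0; auto).
  rewrite !Cmod_mult, Hzeta, Cmod_R, (Rabs_pos_eq 2) by lra.
  set (d := 1 - Cmod z) in *. assert (Hd : 0 < d) by (unfold d; lra).
  replace (4 / d ^ 3 * Cmod h ^ 2) with (2 * 1 * (Cmod h * Cmod h) * / (d * d * (d / 2)))
    by (field; lra).
  apply Rmult_le_compat_l; [pose proof (Cmod_ge_0 h); nra|].
  assert (Hdd : 0 < d * d) by nra. assert (Ed : Cmod z = 1 - d) by (unfold d; ring).
  apply Rinv_le_contravar; [apply Rmult_lt_0_compat; lra|].
  apply Rmult_le_compat; [lra|lra| |lra]. apply Rmult_le_compat; lra.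
Qed.

Definition average (F : nat -> C) (p : list nat) : C := (/ RtoC (INR (length p)) * csum F p)%C.

Lemma Cmod_average_le (F : nat -> C) (p : list nat) (K : R) : (0 < length p)%nat ->
  (forall i, In i p -> Cmod (F i) <= K) -> Cmod (average F p) <= K.
Proof.
  intros Hp H. apply lt_INR in Hp. simpl in Hp. unfold average.
  rewrite Cmod_mult, Cmod_inv, Cmod_R, Rabs_pos_eq by (try intros E; try apply RtoC_inj in E; lra).
  rewrite Rmult_comm. apply Rle_div_l; [easy|].
  eapply Rle_trans; [apply Cmod_csum|].
  eapply Rle_trans; [apply (lsum_le _ (fun _ => K)); exact H|].
  rewrite lsum_const. lra.
Qed.

Lemma average_remainder (F G L : nat -> C) (h : C) (p : list nat) :
  (average F p - average G p - average L p * h)%C = average (fun i => F i - G i - L i * h)%C p.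
Proof.
  unfold average. set (k := (/ RtoC (INR (length p)))%C).
  assert (E : csum (fun i => F i - G i - L i * h)%C p = (csum F p - csum G p - csum L p * h)%C).
  { clear k. induction p as [|i p IH]; simpl; [ring|]. rewrite IH. ring. }
  rewrite E. ring.
Qed.

Lemma Re_average (F : nat -> C) (p : list nat) : (0 < length p)%nat ->
  Re (average F p) = lsum (fun i => Re (F i)) p / INR (length p).
Proof.
  intros Hp. apply lt_INR in Hp. simpl in Hp. unfold average. rewrite <- RtoC_inv by lra.
  assert (E : Re (csum F p) = lsum (fun i => Re (F i)) p).
  { clear Hp. induction p as [|i p IH]; [easy|].
    change (Re (F i) + Re (csum F p) = Re (F i) + lsum (fun i => Re (F i)) p). now rewrite IH. }
  rewrite <- E. unfold Re. destruct (csum F p) as [x y]. simpl. unfold Rdiv. ring.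
Qed.

Lemma lsum_le_Series (u : nat -> R) (N : nat) :
  (forall n, 0 <= u n) -> ex_series u -> lsum u (seq 0 N) <= Series u.
Proof.
  intros Hu Hex. destruct N as [|N].
  - change (0 <= Series u). rewrite <- (Rmult_0_l (Series (fun _ => 0))), <- Series_scal_l.
    apply Series_le; [|easy]. intros n. rewrite Rmult_0_l. split; [lra|auto].
  - rewrite lsum_sum_n. apply (is_lim_seq_incr_compare (sum_n u)).
    + now apply Series_correct.
    + intros n. rewrite sum_Sn. unfold plus; simpl. specialize (Hu (S n)). lra.
Qed.

(** * The Cantor function *)

Lemma INR_pow2 (n : nat) : INR (2 ^ n) = 2 ^ n.
Proof. now rewrite pow_INR. Qed.

Lemma sin_lipschitz (x y : R) : Rabs (sin x - sin y) <= Rabs (x - y).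
Proof.
  destruct (MVT_gen sin y x cos) as (c & _ & E).
  - intros t _. apply is_derive_sin.
  - intros t _. apply continuity_sin.
  - rewrite E, Rabs_mult. rewrite <- (Rmult_1_l (Rabs (x - y))) at 2.
    apply Rmult_le_compat_r; [apply Rabs_pos|]. apply Rabs_le_between. apply COS_bound.
Qed.

Lemma cos_lipschitz (x y : R) : Rabs (cos x - cos y) <= Rabs (x - y).
Proof.
  rewrite <- !sin_shift. eapply Rle_trans; [apply sin_lipschitz|].
  rewrite <- Rabs_Ropp. right. f_equal. ring.
Qed.

Definition circle_pt (x : R) : C := Cexp (0, x).

Lemma Cmod_circle_pt (x : R) : Cmod (circle_pt x) = 1.
Proof. unfold circle_pt. rewrite Cmod_Cexp. apply exp_0. Qed.

Lemma chord_upper (x y : R) : Cmod (circle_pt x - circle_pt y)%C <= 2 * Rabs (x - y).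
Proof.
  eapply Rle_trans; [apply Cmod_le_abs|]. unfold circle_pt, Cexp, Re, Im. simpl.
  rewrite exp_0, !Rmult_1_l.
  pose proof (cos_lipschitz x y). pose proof (sin_lipschitz x y). unfold Rminus in *. lra.
Qed.

Lemma chord_eq (x y : R) : Cmod (circle_pt x - circle_pt y)%C = 2 * Rabs (sin ((x - y) / 2)).
Proof.
  apply Rsqr_inj; [apply Cmod_ge_0|pose proof (Rabs_pos (sin ((x - y) / 2))); lra|].
  rewrite Rsqr_mult, <- Rsqr_abs.
  replace (Rsqr (Cmod (circle_pt x - circle_pt y)%C)) with (Cmod (circle_pt x - circle_pt y)%C ^ 2)
    by (unfold Rsqr; ring).
  rewrite Cmod2_alt. unfold circle_pt, Cexp, Re, Im. simpl fst. simpl snd.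
  rewrite exp_0, !Rmult_1_l.
  assert (E : cos (x - y) = 1 - 2 * (sin ((x - y) / 2) * sin ((x - y) / 2))).
  { replace (x - y) with (2 * ((x - y) / 2)) at 1 by field. rewrite cos_2a_sin. ring. }
  rewrite cos_minus in E. pose proof (sin2_cos2 x). pose proof (sin2_cos2 y). unfold Rsqr in *. nra.
Qed.

Lemma sin_ge_half (x : R) : 0 <= x <= PI / 4 -> x / 2 <= sin x.
Proof.
  intros Hx. pose proof PI_RGT_0 as Hpi.
  destruct (MVT_gen sin 0 x cos) as (c & Hc & E).
  - intros t _. apply is_derive_sin.
  - intros t _. apply continuity_sin.
  - rewrite Rmin_left, Rmax_right in Hc by lra. rewrite sin_0, !Rminus_0_r in E. rewrite E.
    assert (1 / 2 <= cos c) by (rewrite <- cos_PI3; apply cos_decr_1; lra).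
    nra.
Qed.

(** The least value is at l = 1, by monotonicity up to pi / 2 and reflection beyond. There
    [sin_ge_half] requires n >= 2, so n = 1 is separate, and pi / 2 > 1 absorbs the factor 1/2. *)
Lemma sin_dyadic (n l : nat) : (1 <= l < 2 ^ n)%nat -> / 2 ^ n <= sin (PI * INR l / 2 ^ n).
Proof.
  intros [H1 H2]. pose proof PI2_1 as Hpi.
  destruct n as [|n]; [simpl in H2; lia|].
  pose proof (half_pow_pos (S n)) as Hp. set (h := / 2 ^ S n) in *.
  assert (HN : 2 ^ S n * h = 1) by (unfold h; apply Rinv_r, pow_nonzero; lra).
  assert (Hl1 : 1 <= INR l) by (apply (le_INR 1); lia).
  assert (Hl2 : INR l <= 2 ^ S n - 1).
  { apply Nat.le_succ_l, le_INR in H2. rewrite S_INR, INR_pow2 in H2. lra. }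
  unfold Rdiv. fold h.
  assert (Hh : h <= / 2) by (pose proof (half_pow_le 1 (S n) ltac:(lia)); simpl (2 ^ 1) in *; fold h in H; lra).
  assert (Hmin : h <= sin (PI * h)).
  { destruct n as [|n].
    - replace (PI * h) with (PI / 2) by (unfold h; simpl; field). rewrite sin_PI2. lra.
    - assert (h <= / 4).
      { pose proof (half_pow_le 2 (S (S n)) ltac:(lia)) as H. fold h in H. simpl (2 ^ 2) in H. lra. }
      eapply Rle_trans; [|apply sin_ge_half; split; nra]. nra. }
  eapply Rle_trans; [exact Hmin|].
  set (x := PI * INR l * h).
  assert (Hx1 : PI * h <= x).
  { unfold x. apply Rmult_le_compat_r; [lra|]. rewrite <- (Rmult_1_r PI) at 1.
    apply Rmult_le_compat_l; lra. }
  assert (Hx2 : x <= PI - PI * h).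
  { replace (PI - PI * h) with (PI * (2 ^ S n - 1) * h).
    - unfold x. apply Rmult_le_compat_r; [lra|]. apply Rmult_le_compat_l; lra.
    - replace (PI * (2 ^ S n - 1) * h) with (PI * (2 ^ S n * h) - PI * h) by ring. rewrite HN. ring. }
  assert (HPh : 0 <= PI * h <= PI / 2) by (split; nra).
  destruct (Rle_dec x (PI / 2)) as [Hx|Hx].
  - apply sin_incr_1; lra.
  - rewrite <- (sin_PI_x x). apply sin_incr_1; lra.
Qed.

Definition node (m i : nat) : C := circle_pt (2 * PI * INR i / 2 ^ m).

Lemma node_chord_lower (n i j : nat) : (i < 2 ^ n)%nat -> (j < 2 ^ n)%nat -> i <> j ->
  2 / 2 ^ n <= Cmod (node n i - node n j)%C.
Proof.
  assert (H : forall i j, (i < 2 ^ n)%nat -> (j < i)%nat -> 2 / 2 ^ n <= Cmod (node n i - node n j)%C).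
  { clear. intros i j Hi Hj. unfold node. rewrite chord_eq.
    apply Rmult_le_compat_l; [lra|]. eapply Rle_trans; [|apply RRle_abs].
    replace ((2 * PI * INR i / 2 ^ n - 2 * PI * INR j / 2 ^ n) / 2) with (PI * INR (i - j) / 2 ^ n).
    - apply sin_dyadic. lia.
    - rewrite minus_INR by lia. field. apply pow_nonzero. lra. }
  intros Hi Hj Hne. destruct (Nat.lt_total i j) as [Hlt|[Heq|Hgt]]; [|easy|auto].
  rewrite Cmod_sub_sym. auto.
Qed.

(** The angles differ by at most 2 pi / 2^n, [chord_upper] doubles this, and pi <= 4. *)
Lemma node_descendant (n k i : nat) :
  Cmod (node (n + k) i - node n (i / 2 ^ k))%C <= 16 / 2 ^ n.
Proof.
  unfold node. eapply Rle_trans; [apply chord_upper|].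
  pose proof PI_RGT_0. pose proof PI_4.
  assert (Hk : (2 ^ k <> 0)%nat) by (apply Nat.pow_nonzero; lia).
  pose proof (Nat.div_mod_eq i (2 ^ k)) as Hdiv. pose proof (Nat.mod_upper_bound i (2 ^ k) Hk) as Hmod.
  set (q := (i / 2 ^ k)%nat) in *. set (r := (i mod 2 ^ k)%nat) in *.
  assert (Ei : INR i = 2 ^ k * INR q + INR r).
  { rewrite Hdiv at 1. now rewrite plus_INR, mult_INR, INR_pow2. }
  apply lt_INR in Hmod. rewrite INR_pow2 in Hmod.
  assert (Hpk : 0 < 2 ^ k) by (apply pow_lt; lra).
  assert (Hpn : 0 < 2 ^ n) by (apply pow_lt; lra).
  pose proof (pos_INR r).
  replace (2 * PI * INR i / 2 ^ (n + k) - 2 * PI * INR q / 2 ^ n) with (2 * PI * (INR r / 2 ^ k) / 2 ^ n).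
  2:{ rewrite Ei, pow_add. field. split; lra. }
  assert (Hr : 0 <= INR r / 2 ^ k <= 1).
  { split; [apply Rdiv_le_0_compat; lra|]. apply Rle_div_l; lra. }
  rewrite Rabs_pos_eq by (apply Rdiv_le_0_compat; nra).
  replace (2 * (2 * PI * (INR r / 2 ^ k) / 2 ^ n)) with (4 * (PI * (INR r / 2 ^ k)) / 2 ^ n) by (field; lra).
  apply Rmult_le_compat_r; [now apply Rlt_le, Rinv_0_lt_compat|]. nra.
Qed.

(** The exponent [S n] keeps stage 0 away from the origin and places all heights in (0, 1), where
    theta is given. *)
Definition disc_pt (n j : nat) : C := (RtoC (1 - / 2 ^ S n) * node n j)%C.

Lemma Cmod_disc_pt (n j : nat) : Cmod (disc_pt n j) = 1 - / 2 ^ S n.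
Proof.
  unfold disc_pt, node. rewrite Cmod_mult, Cmod_circle_pt, Cmod_R, Rabs_pos_eq; [ring|].
  pose proof (half_pow_lt_1 (S n) ltac:(lia)). lra.
Qed.

Lemma Cmod_mob_sym (z w : C) : Cmod z < 1 -> Cmod w < 1 -> Cmod (mob z w) = Cmod (mob w z).
Proof.
  intros Hz Hw. unfold mob. rewrite !Cmod_div by (apply mob_denom_neq_0; lra).
  now rewrite Cmod_sub_sym, mob_denom_sym.
Qed.

(** Let [t] be the larger height. Then |w - z| >= t / 2, by the chord within a stage and by the
    moduli between stages. As 1 - conj(z) w = (1 - |z|^2) - conj(z) (w - z), the denominator is at
    most 2 t + |w - z|, and the ratio at least 1/5. *)
Lemma disc_pt_separated (n j n' j' : nat) : (j < 2 ^ n)%nat -> (j' < 2 ^ n')%nat ->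
  (n, j) <> (n', j') -> 1 / 5 <= Cmod (mob (disc_pt n j) (disc_pt n' j')).
Proof.
  assert (Hd : forall n j, Cmod (disc_pt n j) < 1).
  { intros m i. rewrite Cmod_disc_pt. pose proof (half_pow_pos (S m)). lra. }
  assert (H : forall n j n' j', (n <= n')%nat -> (j < 2 ^ n)%nat -> (j' < 2 ^ n')%nat ->
    (n, j) <> (n', j') -> 1 / 5 <= Cmod (mob (disc_pt n j) (disc_pt n' j'))).
  { clear n j n' j'. intros n j n' j' Hn Hj Hj' Hne.
    pose proof (half_pow_pos (S n)) as Ht. pose proof (half_pow_lt_1 (S n) ltac:(lia)) as Ht1.
    pose proof (half_pow_le 1 (S n) ltac:(lia)) as Ht2. simpl (2 ^ 1) in Ht2.
    set (t := / 2 ^ S n) in *. set (z := disc_pt n j). set (w := disc_pt n' j').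
    assert (Hfar : t / 2 <= Cmod (w - z)%C).
    { destruct (Nat.eq_dec n n') as [<-|Hnn].
      - unfold z, w, disc_pt. fold t.
        replace (RtoC (1 - t) * node n j' - RtoC (1 - t) * node n j)%C with
          (RtoC (1 - t) * (node n j' - node n j))%C by ring.
        rewrite Cmod_mult, Cmod_R, Rabs_pos_eq by lra.
        assert (Hch : 2 / 2 ^ n <= Cmod (node n j' - node n j)%C).
        { apply node_chord_lower; auto. }
        replace (2 / 2 ^ n) with (4 * t) in Hch by (unfold t; simpl; field; apply pow_nonzero; lra).
        nra.
      - eapply Rle_trans; [|apply Cmod_sub_ge]. unfold z, w. rewrite !Cmod_disc_pt. fold t.
        pose proof (half_pow_le (S (S n)) (S n') ltac:(lia)) as H.
        rewrite (half_pow_S (S n)) in H. fold t in H. lra. }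
    unfold mob. rewrite Cmod_div by (apply mob_denom_neq_0; [apply Hd|apply Rlt_le, Hd]).
    assert (Hz : Cmod z = 1 - t) by apply Cmod_disc_pt.
    assert (Hden : Cmod (1 - Cconj z * w)%C <= 2 * t + Cmod (w - z)%C).
    { replace (1 - Cconj z * w)%C with (RtoC (1 - Cmod z ^ 2) - Cconj z * (w - z))%C.
      - eapply Rle_trans; [apply Cmod_triang_sub|].
        rewrite Cmod_mult, Cmod_conj, Cmod_R, Rabs_pos_eq, Hz by (rewrite Hz; nra).
        pose proof (Cmod_ge_0 (w - z)%C). nra.
      - rewrite RtoC_minus, Cmod2_conj. ring. }
    assert (Hpos : 0 < Cmod (1 - Cconj z * w)%C).
    { apply Cmod_gt_0, mob_denom_neq_0; [apply Hd|apply Rlt_le, Hd]. }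
    apply (Rle_div_r (1 / 5) _ _ Hpos). lra. }
  intros Hj Hj' Hne. destruct (Nat.le_ge_cases n n') as [Hn|Hn]; [auto|].
  rewrite Cmod_mob_sym by auto. apply H; auto.
Qed.

Lemma Re_scal_l (a : R) (x : C) : Re (RtoC a * x)%C = a * Re x.
Proof. destruct x. unfold Re. simpl. ring. Qed.

(** * The Herglotz integral of the masses on the stages *)

Section CantorFunction.
Variable th : nat -> R.
Hypothesis th_pos : forall n, 0 < th n.
Hypothesis th_incr : forall n, th n <= th (S n).
Hypothesis th_div : forall B, exists N, B < lsum (fun i => / th i) (seq 0 N).

(** The mass of all stages from [n] on: the weights telescope, and this quantity tends to 0 as
    [dens_sum] grows. *)
Let tail_mass (n : nat) : R := / (1 + dens_sum th n).

Let weight (n : nat) : R := tail_mass n - tail_mass (S n).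

Let tail_mass_pos (n : nat) : 0 < tail_mass n <= 1.
Proof.
  unfold tail_mass. pose proof (dens_sum_nonneg th n). split.
  - apply Rinv_0_lt_compat. lra.
  - rewrite <- Rinv_1. apply Rinv_le_contravar; lra.
Qed.

Let weight_nonneg (n : nat) : 0 <= weight n.
Proof.
  unfold weight, tail_mass. rewrite dens_sum_S.
  pose proof (dens_sum_nonneg th n). pose proof (dens_bounds th n).
  assert (/ (1 + (dens_sum th n + dens th n)) <= / (1 + dens_sum th n)) by (apply Rinv_le_contravar; lra).
  lra.
Qed.

Let weight_sum (n N : nat) : lsum (fun k => weight (n + k)) (seq 0 N) = tail_mass n - tail_mass (n + N).
Proof.
  induction N as [|N IH].
  - rewrite Nat.add_0_r. simpl. ring.
  - rewrite seq_S, lsum_app, IH. cbn [lsum fold_right Nat.add]. unfold weight.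
    rewrite Nat.add_succ_r. ring.
Qed.

Let ex_series_weight : ex_series weight.
Proof.
  apply (ex_series_bounded weight 1 weight_nonneg). intros N.
  change (lsum (fun k => weight (0 + k)) (seq 0 N) <= 1). rewrite weight_sum. simpl Nat.add.
  pose proof (tail_mass_pos 0). pose proof (tail_mass_pos N). lra.
Qed.

Definition cantor_herglotz (z : C) : C :=
  Cseries (fun m => RtoC (weight m) * average (fun i => herglotz (node m i) z) (arcs th m))%C.

Let node_unit (m i : nat) : Cmod (node m i) = 1.
Proof. apply Cmod_circle_pt. Qed.

Lemma cantor_herglotz_cdiff (z : C) : Cmod z < 1 -> cdiff cantor_herglotz z.
Proof.
  intros Hz. set (d := 1 - Cmod z). assert (Hd : 0 < d) by (unfold d; lra).
  assert (K1 : 0 < 4 / d) by (apply Rdiv_lt_0_compat; lra).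
  assert (K2 : 0 < 2 / d ^ 2) by (apply Rdiv_lt_0_compat; [lra|now apply pow_lt]).
  assert (K3 : 0 < 4 / d ^ 3) by (apply Rdiv_lt_0_compat; [lra|now apply pow_lt]).
  (* The three summands of the constant bound the kernels within distance d / 2 of [z], their
     derivatives at [z], and their quadratic remainders. *)
  apply (cdiff_Cseries weight ex_series_weight weight_nonneg
    (fun m z => average (fun i => herglotz (node m i) z) (arcs th m))
    (fun m => average (fun i => 2 * node m i / ((node m i - z) * (node m i - z)))%C (arcs th m))
    z (4 / d + 2 / d ^ 2 + 4 / d ^ 3) (d / 2)); [lra| | |].
  - intros m h Hh. apply Cmod_average_le; [apply length_arcs_pos|]. intros i _.
    pose proof (Cmod_triangle z h).
    assert (Hzh : Cmod (z + h)%C < 1) by (unfold d in Hh; lra).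
    eapply Rle_trans; [now apply Cmod_herglotz_le|].
    apply Rle_trans with (4 / d); [|lra].
    replace (4 / d) with (2 * / (d / 2)) by (field; lra).
    apply Rmult_le_compat_l; [lra|]. apply Rinv_le_contravar; [lra|]. unfold d in *. lra.
  - intros m. apply Cmod_average_le; [apply length_arcs_pos|]. intros i _.
    pose proof (pole_neq_0 (node m i) z (node_unit m i) Hz).
    pose proof (Cmod_pole_ge (node m i) z (node_unit m i)) as Hp.
    rewrite Cmod_div by (apply Cmult_neq_0; auto).
    rewrite !Cmod_mult, node_unit, Cmod_R, Rabs_pos_eq by lra.
    apply Rle_trans with (2 / d ^ 2); [|lra]. rewrite Rmult_1_r.
    apply Rmult_le_compat_l; [lra|]. apply Rinv_le_contravar; [now apply pow_lt|].
    fold d in Hp. simpl. rewrite Rmult_1_r. apply Rmult_le_compat; lra.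
  - intros m h Hh. rewrite average_remainder. apply Cmod_average_le; [apply length_arcs_pos|].
    intros i _. eapply Rle_trans; [now apply herglotz_remainder|]. fold d.
    apply Rmult_le_compat_r; [apply pow2_ge_0|lra].
Qed.

Let re_term (z : C) (m : nat) : R :=
  weight m * (lsum (fun i => Re (herglotz (node m i) z)) (arcs th m) / INR (length (arcs th m))).

Let Re_cantor_herglotz (z : C) : Re (cantor_herglotz z) = Series (re_term z).
Proof.
  change (Re (cantor_herglotz z)) with (Series (fun m => Re (RtoC (weight m) *
    average (fun i => herglotz (node m i) z) (arcs th m))%C)).
  apply Series_ext. intros m.
  unfold re_term. rewrite <- (Re_average (fun i => herglotz (node m i) z)) by apply length_arcs_pos.
  apply Re_scal_l.
Qed.

Let re_term_nonneg (z : C) (m : nat) : Cmod z < 1 -> 0 <= re_term z m.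
Proof.
  intros Hz. apply Rmult_le_pos; [apply weight_nonneg|].
  apply Rdiv_le_0_compat; [|apply (lt_INR 0), length_arcs_pos].
  apply lsum_pos. intros i _. now apply Re_herglotz_nonneg.
Qed.

Let ex_series_re_term (z : C) : Cmod z < 1 -> ex_series (re_term z).
Proof.
  intros Hz. apply (@ex_series_le R_AbsRing R_CompleteNormedModule) with
    (fun m => 2 / (1 - Cmod z) * weight m).
  - intros m. change (norm ?x) with (Rabs x). rewrite Rabs_pos_eq by now apply re_term_nonneg.
    unfold re_term. rewrite Rmult_comm. apply Rmult_le_compat_r; [apply weight_nonneg|].
    rewrite <- (Re_average (fun i => herglotz (node m i) z)) by apply length_arcs_pos.
    eapply Rle_trans; [apply RRle_abs|]. eapply Rle_trans; [apply re_le_Cmod|].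
    apply Cmod_average_le; [apply length_arcs_pos|]. intros i _. now apply Cmod_herglotz_le.
  - now apply (ex_series_scal_l (2 / (1 - Cmod z)) weight).
Qed.

Lemma Re_cantor_herglotz_nonneg (z : C) : Cmod z < 1 -> 0 <= Re (cantor_herglotz z).
Proof.
  intros Hz. rewrite Re_cantor_herglotz.
  apply (lsum_le_Series (re_term z) 0); [|now apply ex_series_re_term]. intros m. now apply re_term_nonneg.
Qed.

Let Cmod_disc_pt_lt (n j : nat) : Cmod (disc_pt n j) < 1.
Proof. rewrite Cmod_disc_pt. pose proof (half_pow_pos (S n)). lra. Qed.

(** With t the height, the numerator 2 t - t^2 of the Poisson kernel is at least t, and the distance
    to the atom at most 32 t along the circle plus t radially; 1089 = 33^2. *)
Let Re_herglotz_descendant (n j k i : nat) : (i / 2 ^ k)%nat = j ->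
  / (1089 * / 2 ^ S n) <= Re (herglotz (node (n + k) i) (disc_pt n j)).
Proof.
  intros Hi. rewrite Re_herglotz by auto.
  pose proof (half_pow_pos (S n)) as Ht. pose proof (half_pow_lt_1 (S n) ltac:(lia)) as Ht1.
  rewrite Cmod_disc_pt.
  assert (Hdist : Cmod (node (n + k) i - disc_pt n j)%C <= 33 * / 2 ^ S n).
  { replace (node (n + k) i - disc_pt n j)%C with
      ((node (n + k) i - node n j) + RtoC (/ 2 ^ S n) * node n j)%C.
    2:{ unfold disc_pt. rewrite RtoC_minus. ring. }
    eapply Rle_trans; [apply Cmod_triangle|].
    rewrite Cmod_mult, node_unit, Cmod_R, Rabs_pos_eq by lra.
    pose proof (node_descendant n k i) as H. rewrite Hi in H.
    replace (16 / 2 ^ n) with (32 * / 2 ^ S n) in H by (simpl; field; apply pow_nonzero; lra).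
    lra. }
  pose proof (pole_neq_0 (node (n + k) i) (disc_pt n j) (node_unit _ _) (Cmod_disc_pt_lt n j)) as Hn.
  apply Cmod_gt_0 in Hn.
  set (t := / 2 ^ S n) in *. set (D := Cmod (node (n + k) i - disc_pt n j)%C) in *.
  replace (/ (1089 * t)) with (t / (33 * t) ^ 2) by (field; lra).
  apply Rmult_le_compat; [lra| |nra|].
  - apply Rlt_le, Rinv_0_lt_compat, pow_lt. lra.
  - apply Rinv_le_contravar; [now apply pow_lt|]. apply pow_incr. lra.
Qed.

(** By equidistribution a fraction of at least 1 / [length (arcs th n)] of the atoms of stage n + k
    descends from [j]; the other kernels are nonnegative. The bound is the same for all [k]. *)
Let stage_lower (n j k : nat) : In j (arcs th n) ->
  / (600 * dens th n) <=
    lsum (fun i => Re (herglotz (node (n + k) i) (disc_pt n j))) (arcs th (n + k)) /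
      INR (length (arcs th (n + k))).
Proof.
  intros Hj. pose proof (arcs_descendants th n j k Hj) as Hdesc.
  pose proof (lt_INR 0 _ (length_arcs_pos th n)) as Hn.
  pose proof (lt_INR 0 _ (length_arcs_pos th (n + k))) as Hm.
  simpl (INR 0) in Hn, Hm. pose proof (half_pow_pos (S n)) as Ht.
  assert (Ed : dens th n = 2 * (INR (length (arcs th n)) * / 2 ^ S n)).
  { unfold dens, density. simpl. field. apply pow_nonzero. lra. }
  set (t := / 2 ^ S n) in *. set (Kn := INR (length (arcs th n))) in *.
  set (Km := INR (length (arcs th (n + k)))) in *.
  set (cnt := lsum (ancestor_ind k j) (arcs th (n + k))) in *.
  apply Rle_div_r; [easy|].
  apply Rle_trans with (/ (1089 * t) * cnt).
  - rewrite Ed. apply Rle_trans with (/ (600 * (2 * (Kn * t))) * (Kn * cnt)).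
    + apply Rmult_le_compat_l; [|easy]. apply Rlt_le, Rinv_0_lt_compat. nra.
    + replace (/ (600 * (2 * (Kn * t))) * (Kn * cnt)) with (/ (1200 * t) * cnt) by (field; lra).
      apply Rmult_le_compat_r.
      * apply lsum_pos. intros i _. unfold ancestor_ind. destruct (Nat.eqb _ _); lra.
      * apply Rinv_le_contravar; lra.
  - unfold cnt. rewrite <- lsum_scal. apply lsum_le. intros i _.
    unfold ancestor_ind. destruct (Nat.eqb_spec (i / 2 ^ k) j) as [Hi|Hi].
    + rewrite Rmult_1_r. now apply Re_herglotz_descendant.
    + rewrite Rmult_0_r. now apply Re_herglotz_nonneg.
Qed.

Lemma cantor_herglotz_lower (n j : nat) : good th n = true -> In j (arcs th n) ->
  th n + dens_sum th n <= Re (cantor_herglotz (disc_pt n j)).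
Proof.
  intros Hgood Hj. unfold good in Hgood.
  destruct (Rle_dec (dens th n) (cap th n)) as [Hcap|]; [clear Hgood|easy].
  pose proof (dens_bounds th n) as Hd. pose proof (dens_sum_nonneg th n) as Hs. pose proof (th_pos n) as Hth.
  set (a := dens th n) in *.
  assert (Hlow : 1 + th n + dens_sum th n <= tail_mass n / (600 * a)).
  { unfold cap, density_cap in Hcap. fold (tail_mass n) in Hcap.
    apply Rle_div_r in Hcap; [|lra]. apply Rle_div_r; lra. }
  (* Only the stages from n to n + N - 1 are kept. The mass cut off beyond them costs at most 1 for
     large [N], which the summand 1 in the cap provides. *)
  assert (HN : forall N, (tail_mass n - tail_mass (n + N)) * / (600 * a) <= Re (cantor_herglotz (disc_pt n j))).
  { intros N. rewrite Re_cantor_herglotz, <- weight_sum, Rmult_comm, <- lsum_scal.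
    apply Rle_trans with (lsum (re_term (disc_pt n j)) (seq 0 (n + N))).
    2:{ apply lsum_le_Series; [|now apply ex_series_re_term]. intros m. now apply re_term_nonneg. }
    apply Rle_trans with (lsum (fun k => re_term (disc_pt n j) (n + k)) (seq 0 N)).
    - apply lsum_le. intros k _. unfold re_term. rewrite Rmult_comm.
      apply Rmult_le_compat_l; [apply weight_nonneg|]. now apply stage_lower.
    - rewrite <- (lsum_map (re_term (disc_pt n j)) (fun k => n + k)%nat). apply lsum_incl.
      + apply NoDup_map_NoDup_ForallPairs; [|apply seq_NoDup]. intros x y _ _ E. lia.
      + intros m Hm. apply in_map_iff in Hm. destruct Hm as (k & <- & Hk).
        apply in_seq in Hk. apply in_seq. lia.
      + intros m _. now apply re_term_nonneg. }
  destruct (dens_sum_unbounded th th_pos th_incr th_div (/ (600 * a))) as [N HNs].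
  specialize (HN N).
  assert (Hmono : dens_sum th N <= dens_sum th (n + N)).
  { clear. induction n as [|n IH]; [simpl; lra|]. simpl Nat.add. rewrite dens_sum_S.
    pose proof (dens_bounds th (n + N)). lra. }
  assert (Hsmall : tail_mass (n + N) * / (600 * a) <= 1).
  { pose proof (tail_mass_pos (n + N)) as HT. unfold tail_mass in HT |- *.
    assert (0 < / (600 * a)) by (apply Rinv_0_lt_compat; lra).
    rewrite Rmult_comm. apply Rle_div_l; lra. }
  unfold Rdiv in Hlow. lra.
Qed.
End CantorFunction.

(** * Sufficiency *)

Section Enumeration.
Variables (A : Type) (d : A) (L : nat -> list A).

Fixpoint concat_blocks (N : nat) : list A :=
  match N with O => nil | S N => concat_blocks N ++ L N end.

Hypothesis blocks_infinite : forall k, exists N, (k < length (concat_blocks N))%nat.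

(** Blocks may be empty and vary in length, so the position is read in any long enough
    concatenation; these are prefixes of one another, and [enum_nth] shows independence of the
    choice. *)
Definition enum (k : nat) : A :=
  nth k (concat_blocks (epsilon (inhabits O) (fun N => (k < length (concat_blocks N))%nat))) d.

Lemma concat_blocks_prefix (N M : nat) : (N <= M)%nat ->
  exists t, concat_blocks M = concat_blocks N ++ t.
Proof.
  intros H. induction H as [|M _ [t IH]].
  - exists nil. now rewrite app_nil_r.
  - exists (t ++ L M). simpl. now rewrite IH, app_assoc.
Qed.

Lemma enum_nth (k N : nat) : (k < length (concat_blocks N))%nat -> enum k = nth k (concat_blocks N) d.
Proof.
  intros H. unfold enum.
  pose proof (epsilon_spec (inhabits O) (fun N => (k < length (concat_blocks N))%nat)
    (blocks_infinite k)) as HM.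
  set (M := epsilon _ _) in *. simpl in HM.
  destruct (Nat.le_ge_cases N M) as [Hle|Hle]; destruct (concat_blocks_prefix _ _ Hle) as [t E].
  - rewrite E. now apply app_nth1.
  - rewrite E. symmetry. now apply app_nth1.
Qed.

Lemma map_enum (N : nat) : map enum (seq 0 (length (concat_blocks N))) = concat_blocks N.
Proof.
  apply (nth_ext _ _ d d); rewrite length_map, length_seq; [easy|].
  intros k Hk. rewrite (nth_indep _ d (enum 0)) by now rewrite length_map, length_seq.
  rewrite map_nth, seq_nth by easy. now apply enum_nth.
Qed.

Lemma in_concat_blocks (x : A) (N : nat) : In x (concat_blocks N) <->
  exists n, (n < N)%nat /\ In x (L n).
Proof.
  induction N as [|N IH]; simpl.
  - split; [easy|]. intros (n & H & _). lia.
  - rewrite in_app_iff, IH. split.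
    + intros [(n & H1 & H2)|H]; [exists n; split; [lia|easy]|exists N; split; [lia|easy]].
    + intros (n & H1 & H2). destruct (Nat.eq_dec n N) as [->|Hne]; [now right|].
      left. exists n. split; [lia|easy].
Qed.

Lemma enum_in_block (k : nat) : exists n, In (enum k) (L n).
Proof.
  destruct (blocks_infinite k) as [N HN].
  assert (H : In (enum k) (concat_blocks N)) by (rewrite (enum_nth k N HN); now apply nth_In).
  apply in_concat_blocks in H. destruct H as (n & _ & H). now exists n.
Qed.

Lemma enum_injective : (forall N, NoDup (concat_blocks N)) ->
  forall i k, enum i = enum k -> i = k.
Proof.
  intros Hnd i k E.
  assert (Hw : forall i k, enum i = enum k -> (i <= k)%nat -> i = k).
  { clear i k E. intros i k E Hik. destruct (blocks_infinite k) as [N HN].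
    rewrite (enum_nth k N HN), (enum_nth i N) in E by lia.
    apply (proj1 (NoDup_nth (concat_blocks N) d) (Hnd N)) in E; lia. }
  destruct (Nat.le_ge_cases i k) as [H|H]; [auto|]. symmetry. auto.
Qed.

(** The entries of the first [N] blocks are used up by smaller indices, and [enum] is injective.
    This gives |z_k| -> 1. *)
Lemma enum_far : (forall n m x, In x (L n) -> In x (L m) -> n = m) ->
  (forall N, NoDup (concat_blocks N)) ->
  forall N k, (length (concat_blocks N) <= k)%nat -> exists n, (N <= n)%nat /\ In (enum k) (L n).
Proof.
  intros Hdisj Hnd N k Hk. destruct (enum_in_block k) as [n Hn]. exists n. split; [|easy].
  apply Nat.nlt_ge. intros Hlt.
  assert (Hin : In (enum k) (concat_blocks N)) by (apply in_concat_blocks; now exists n).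
  rewrite <- map_enum in Hin. apply in_map_iff in Hin. destruct Hin as (i & E & Hi).
  apply in_seq in Hi. apply (enum_injective Hnd) in E. lia.
Qed.

Lemma lsum_concat_blocks (f : A -> R) (N : nat) :
  lsum f (concat_blocks N) = lsum (fun n => lsum f (L n)) (seq 0 N).
Proof.
  induction N as [|N IH]; [easy|]. cbn [concat_blocks].
  rewrite seq_S, !lsum_app, IH. simpl. ring.
Qed.

Lemma lsum_enum (f : A -> R) (N : nat) :
  lsum (fun k => f (enum k)) (seq 0 (length (concat_blocks N))) =
  lsum (fun n => lsum f (L n)) (seq 0 N).
Proof. rewrite <- lsum_concat_blocks, <- (lsum_map f enum). now rewrite map_enum. Qed.
End Enumeration.

(** * The sequence of points above the good stages *)

Section Sufficiency.
Variable theta : R -> R.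
Hypothesis theta_pos : forall t, 0 < t < 1 -> 0 < theta t.
Hypothesis theta_nonincr : forall s t, 0 < s -> s <= t -> t < 1 -> theta t <= theta s.

Let th (n : nat) : R := theta (/ 2 ^ S n).
Hypothesis th_div : forall B, exists N, B < lsum (fun i => / th i) (seq 0 N).

Let half_pow_in (n : nat) : 0 < / 2 ^ S n < 1.
Proof. split; [apply half_pow_pos|apply half_pow_lt_1; lia]. Qed.

Let th_pos (n : nat) : 0 < th n.
Proof. now apply theta_pos. Qed.

Let th_incr (n : nat) : th n <= th (S n).
Proof.
  unfold th. apply theta_nonincr; try apply half_pow_pos; try apply half_pow_in.
  apply half_pow_le. lia.
Qed.

Let block (n : nat) : list (nat * nat) :=
  if good th n then map (fun j => (n, j)) (arcs th n) else nil.

Let in_block (n : nat) (p : nat * nat) : In p (block n) ->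
  fst p = n /\ good th n = true /\ In (snd p) (arcs th n).
Proof.
  unfold block. destruct (good th n); [|easy].
  intros H. apply in_map_iff in H. now destruct H as (j & <- & Hj).
Qed.

Let lsum_block (f : nat * nat -> R) (n : nat) :
  lsum f (block n) = if good th n then lsum (fun j => f (n, j)) (arcs th n) else 0.
Proof. unfold block. destruct (good th n); [apply lsum_map|easy]. Qed.

Let lsum_good (u : nat -> R) (l : list nat) :
  lsum (fun n => if good th n then u n else 0) l = lsum u (filter (good th) l).
Proof.
  induction l as [|n l IH]; [easy|]. cbn [filter]. simpl. rewrite IH.
  destruct (good th n); simpl; lra.
Qed.

Let length_lsum {A : Type} (l : list A) : INR (length l) = lsum (fun _ => 1) l.
Proof. rewrite lsum_const. ring. Qed.

(** A good stage has density at most 1 and at least one arc, so divergence of the good densities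
    forces infinitely many points. *)
Let blocks_infinite (k : nat) : exists N, (k < length (concat_blocks _ block N))%nat.
Proof.
  destruct (good_dens_unbounded th th_pos th_incr th_div (INR k)) as [N HN]. exists N.
  apply INR_lt. eapply Rlt_le_trans; [exact HN|].
  rewrite length_lsum, lsum_concat_blocks, <- lsum_good. apply lsum_le. intros n _.
  rewrite lsum_block. destruct (good th n); [|lra].
  rewrite lsum_const, Rmult_1_r. apply Rle_trans with 1; [apply dens_bounds|].
  apply (le_INR 1), length_arcs_pos.
Qed.

Let blocks_disjoint (n m : nat) (p : nat * nat) : In p (block n) -> In p (block m) -> n = m.
Proof. intros Hn Hm. apply in_block in Hn, Hm. destruct Hn, Hm. congruence. Qed.

Let NoDup_blocks (N : nat) : NoDup (concat_blocks _ block N).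
Proof.
  induction N as [|N IH]; [constructor|]. simpl. apply NoDup_app; [easy| |].
  - unfold block. destruct (good th N); [|constructor].
    apply NoDup_map_NoDup_ForallPairs; [|apply NoDup_arcs]. intros i j _ _ E. congruence.
  - intros p Hp HN. apply in_concat_blocks in Hp. destruct Hp as (n & Hlt & Hn).
    pose proof (blocks_disjoint _ _ _ Hn HN). lia.
Qed.

Let pt (p : nat * nat) : C := disc_pt (fst p) (snd p).

Let code (k : nat) : nat * nat := enum _ (0%nat, 0%nat) block k.

Definition cantor_seq (k : nat) : C := pt (code k).

Let Cmod_pt (p : nat * nat) : 1 - Cmod (pt p) = / 2 ^ S (fst p).
Proof. unfold pt. rewrite Cmod_disc_pt. ring. Qed.

Lemma cantor_seq_disc : disc_sequence cantor_seq.
Proof.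
  split.
  - intros k. unfold in_disc, cantor_seq. pose proof (Cmod_pt (code k)).
    pose proof (half_pow_pos (S (fst (code k)))). lra.
  - apply is_lim_seq_spec. intros eps.
    destruct (half_pow_small eps (cond_pos eps)) as [N HN].
    exists (length (concat_blocks _ block N)). intros k Hk.
    destruct (enum_far _ (0%nat, 0%nat) block blocks_infinite blocks_disjoint NoDup_blocks N k Hk)
      as (n & Hn & Hin).
    apply in_block in Hin. destruct Hin as [Hin _].
    unfold cantor_seq. pose proof (Cmod_pt (code k)) as E. unfold code in *. rewrite Hin in E.
    specialize (HN (S n) ltac:(lia)). pose proof (half_pow_pos (S n)).
    rewrite <- Rabs_Ropp, Rabs_pos_eq; lra.
Qed.

Lemma cantor_seq_separated : separated cantor_seq.
Proof.
  unfold separated.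
  destruct (Glb_Rbar_correct (fun r : R => exists n k : nat, n <> k /\
       r = Cmod ((cantor_seq n - cantor_seq k) / (1 - Cconj (cantor_seq n) * cantor_seq k))%C)) as [_ Hglb].
  apply Rbar_lt_le_trans with (Finite (1 / 5)); [simpl; lra|].
  apply Hglb. intros r (n & k & Hne & ->). simpl.
  replace (Cmod ((cantor_seq n - cantor_seq k) / (1 - Cconj (cantor_seq n) * cantor_seq k))%C)
    with (Cmod (mob (cantor_seq n) (cantor_seq k))).
  2:{ unfold mob, Cdiv. rewrite !Cmod_mult. f_equal. apply Cmod_sub_sym. }
  assert (Hlt : forall i, (snd (code i) < 2 ^ fst (code i))%nat).
  { intros i. destruct (enum_in_block _ (0%nat, 0%nat) block blocks_infinite i) as [m Hm].
    apply in_block in Hm. destruct Hm as (E & _ & Hin). unfold code. rewrite E. now apply (arcs_lt th). }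
  apply disc_pt_separated; auto.
  rewrite <- !surjective_pairing. intros E.
  now apply (enum_injective _ _ _ blocks_infinite NoDup_blocks) in E.
Qed.

(** The points above a good stage contribute exactly half of its density, because their height is
    [/ 2 ^ S n]. *)
Lemma cantor_seq_not_blaschke : ~ Blaschke cantor_seq.
Proof.
  unfold Blaschke. intros Hex.
  destruct (ex_series_lsum_bounded (fun k => 1 - Cmod (cantor_seq k))) as [B HB]; [|exact Hex|].
  - intros k. unfold cantor_seq. rewrite Cmod_pt. apply Rlt_le, half_pow_pos.
  - destruct (good_dens_unbounded th th_pos th_incr th_div (2 * B)) as [N HN].
    specialize (HB (length (concat_blocks _ block N))). unfold cantor_seq, code in HB.
    rewrite (lsum_enum _ _ _ blocks_infinite (fun p => 1 - Cmod (pt p))) in HB.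
    enough (lsum (dens th) (filter (good th) (seq 0 N)) =
      2 * lsum (fun n => lsum (fun p => 1 - Cmod (pt p)) (block n)) (seq 0 N)) by lra.
    rewrite <- lsum_good, <- lsum_scal. apply lsum_ext. intros n _. rewrite lsum_block.
    destruct (good th n); [|ring].
    rewrite (lsum_ext _ (fun _ => / 2 ^ S n)) by (intros j _; apply Cmod_pt).
    rewrite lsum_const. unfold dens, density. simpl. field. apply pow_nonzero. lra.
Qed.

Lemma cantor_seq_thin : thin theta cantor_seq.
Proof.
  set (f := fun z => Cexp (- cantor_herglotz th z)%C).
  assert (Hmod : forall z, Cmod (f z) = exp (- Re (cantor_herglotz th z))).
  { intros z. unfold f. now rewrite Cmod_Cexp. }
  exists f. split; [split|split].
  - intros z Hz. apply cderiv_ex_derive. apply (cdiff_comp Cexp (fun z => - cantor_herglotz th z)%C).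
    + eexists. apply cderiv_exp.
    + now apply cdiff_opp, cantor_herglotz_cdiff.
  - exists 1. intros z Hz. rewrite Hmod, <- exp_0. apply exp_le_compat.
    pose proof (Re_cantor_herglotz_nonneg th z Hz). lra.
  - exists 0%C. split; [unfold in_disc; rewrite Cmod_0; lra|apply Cexp_neq_0].
  - set (term := fun p => thin_term theta f (pt p)).
    assert (Hterm0 : forall p, 0 <= term p).
    { intros p. unfold term, thin_term. destruct (Req_EM_T _ _); [lra|].
      rewrite Cmod_pt. pose proof (half_pow_pos (S (fst p))). pose proof (exp_pos (theta (/ 2 ^ S (fst p)))).
      apply Rmult_le_pos; [|apply Cmod_ge_0]. apply Rmult_le_pos; lra. }
    apply (ex_series_bounded (fun k => term (code k)) 1); [auto|].
    intros N. destruct (blocks_infinite N) as [M HM].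
    apply Rle_trans with (lsum (fun k => term (code k)) (seq 0 (length (concat_blocks _ block M)))).
    { apply lsum_incl; [apply seq_NoDup| |auto]. intros k Hk. apply in_seq in Hk. apply in_seq. lia. }
    unfold code. rewrite (lsum_enum _ _ _ blocks_infinite term).
    eapply Rle_trans; [|apply (dens_exp_sum th M)]. apply lsum_le. intros n _.
    rewrite lsum_block. pose proof (dens_bounds th n) as Hd. pose proof (exp_pos (- dens_sum th n)).
    destruct (good th n) eqn:Hgood; [|nra].
    (* By [cantor_herglotz_lower] the exponential decay of [f] cancels exp(theta) and leaves
       exp(-S_n); summed over the arcs this is the summand of [dens_exp_sum]. *)
    apply Rle_trans with (lsum (fun _ => / 2 ^ S n * exp (- dens_sum th n)) (arcs th n)).
    + apply lsum_le. intros j Hj. unfold term, thin_term.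
      pose proof (half_pow_pos (S n)) as Hp.
      destruct (Req_EM_T _ _); [nra|].
      rewrite Cmod_pt, Hmod. simpl fst. rewrite Rmult_assoc, <- exp_plus.
      apply Rmult_le_compat_l; [lra|]. apply exp_le_compat.
      pose proof (cantor_herglotz_lower th th_pos th_incr th_div n j Hgood Hj) as H1.
      unfold pt. simpl fst. simpl snd. unfold th at 1 in H1. lra.
    + rewrite lsum_const. right. unfold dens, density. simpl. field. apply pow_nonzero. lra.
Qed.
End Sufficiency.

Theorem theorem1p3 (theta : R -> R)
  (theta_pos : forall t : R, 0 < t < 1 -> 0 < theta t)
  (theta_cont : forall t : R, 0 < t < 1 -> continuous theta t)
  (theta_nonincr : forall s t : R, 0 < s -> s <= t -> t < 1 -> theta t <= theta s) :
  (exists z : nat -> C,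
     disc_sequence z /\ separated z /\ thin theta z /\ ~ Blaschke z) <->
  int_0_diverges (fun t : R => / (t * theta t)).
Proof.
  split.
  - intros (z & Hdisc & Hsep & Hthin & Hnot). apply NNPP. intros Hint. apply Hnot.
    destruct (not_int_0_diverges_bounded theta theta_pos theta_cont theta_nonincr Hint)
      as (n & B & Hn & HB).
    exact (thin_separated_blaschke theta theta_pos theta_nonincr z n B Hdisc Hsep Hthin Hn HB).
  - intros Hint.
    pose proof (int_0_diverges_unbounded theta theta_pos theta_cont theta_nonincr Hint) as Hdiv.
    exists (cantor_seq theta). repeat split.
    + now apply cantor_seq_disc.
    + now apply (cantor_seq_disc theta theta_pos theta_nonincr).
    + now apply cantor_seq_separated.
    + now apply cantor_seq_thin.
    + now apply cantor_seq_not_blaschke.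
Qed.
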